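(* Let $\alpha>0$, let $m\ge 2$ be an integer and let the origin be a semi-hyperbolic singularity of a planar analytic vector field $$\begin{cases} x'=-x+\text{h.o.t.},\\ y'=\alpha y^m+\text{h.o.t.}\end{cases}$$ Let $t_S$ (entry transversal) and $t_U$ (exit transversal) be transversals, near the singularity, to a branch of its stable manifold and to the branch of its center manifold lying in $\{y>0\}$ respectively, the two branches bounding a common saddle sector. Let $(y_n)_{n\in\mathbb N}$ be a sequence of points on $t_S$, in the side belonging to this saddle sector, converging monotonically to the intersection of $t_S$ with the stable manifold and such that the distances between consecutive points decrease monotonically. For each $n$ let $x_n$ be the point where the trajectory through $y_n$ intersects $t_U$, and let $\Gamma_n$ be the part of this trajectory between $y_n$ and $x_n$. If the sequence $(y_n)_{n}$ has a Minkowski dimension $\dim_B (y_n)_n$, then the Minkowski dimension of $\bigcup_{n\in\mathbb N}\Gamma_n$ exists and $$\dim_B\Big(\bigcup_{n\in\mathbb N}\Gamma_n\Big)=1+\dim_B (y_n)_n .$$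
   Context: Minkowski (box) dimension: for bounded $G\subset\mathbb R^N$ let $G_\delta=\{p\in\mathbb R^N:\operatorname{dist}(p,G)<\delta\}$ and $|G_\delta|$ its Lebesgue measure. The upper and lower Minkowski dimensions are the $\limsup$ and $\liminf$, as $\delta\to0^+$, of $N-\frac{\ln|G_\delta|}{\ln\delta}$; if they coincide, the common value is the Minkowski dimension $\dim_B G$. The dimension $\dim_B(y_n)_n$ is that of the set $\{y_n:n\in\mathbb N\}$. A singularity is semi-hyperbolic if exactly one eigenvalue of its linear part is zero. ''h.o.t.'' denotes terms of higher order in $(x,y)$ than the displayed term. The transversals are regularly parametrized and taken sufficiently close to the singularity, and the points $y_n$ are close enough to the stable manifold that the trajectory through each $y_n$ reaches $t_U$ while staying near the singularity; monotonicity and distances on $t_S$ refer to the coordinate parametrizing $t_S$. (In normal form coordinates one may think of $t_S=\{x=1\}$, $t_U=\{y=1\}$ and the saddle sector $\{x>0,y>0\}$.) *)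

(* Defs.v *)
From HB Require Import structures.
From mathcomp Require Import all_boot all_order all_algebra.
From mathcomp Require Import all_classical all_reals all_analysis.
Set Implicit Arguments.
Unset Strict Implicit.
Unset Printing Implicit Defensive.
Import Order.TTheory GRing.Theory Num.Theory.
Import numFieldNormedType.Exports.
Local Open Scope classical_set_scope.
Local Open Scope ring_scope.

(* {p : dist(p, G) < delta}; the distance to G is an extended real, so the tube of set0 is set0 *)
Definition tube (R : realType) (T : Type) (dist : T -> T -> R) (G : set T)
    (delta : R) : set T :=
  [set p | (ereal_inf [set (dist p q)%:E | q in G] < delta%:E)%E].

Definition minkowski_quotient (R : realType) (T : Type) (N : nat)
    (dist : T -> T -> R) (mu : set T -> \bar R) (G : set T) (delta : R) :
    \bar R :=
  (N%:R - ln (fine (mu (tube dist G delta))) / ln delta)%:E.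

Definition upper_minkowski_dim (R : realType) (T : Type) (N : nat)
    (dist : T -> T -> R) (mu : set T -> \bar R) (G : set T) : \bar R :=
  limf_esup (minkowski_quotient N dist mu G) (0^'+).

Definition lower_minkowski_dim (R : realType) (T : Type) (N : nat)
    (dist : T -> T -> R) (mu : set T -> \bar R) (G : set T) : \bar R :=
  limf_einf (minkowski_quotient N dist mu G) (0^'+).

Definition dist1 (R : realType) (x y : R) : R := `|x - y|.

(* the library norm on R * R is the sup norm *)
Definition dist2 (R : realType) (p q : R * R) : R :=
  Num.sqrt ((p.1 - q.1) ^+ 2 + (p.2 - q.2) ^+ 2).

Definition has_minkowski_dim1 (R : realType) (G : set R) (d : R) : Prop :=
  let mu := @lebesgue_measure R in
  lower_minkowski_dim 1 (@dist1 R) mu G = d%:E /\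
  upper_minkowski_dim 1 (@dist1 R) mu G = d%:E.

Definition has_minkowski_dim2 (R : realType) (G : set (R * R)) (d : R) : Prop :=
  let mu := (@lebesgue_measure R \x @lebesgue_measure R)%E in
  lower_minkowski_dim 2 (@dist2 R) mu G = d%:E /\
  upper_minkowski_dim 2 (@dist2 R) mu G = d%:E.

Definition box (R : realType) (r : R) : set (R * R) := [set p | `|p| < r].

(* f(p + (x, y)) = \sum_(i, j) c i j x^i y^j near (x, y) = 0, absolutely
   convergent; the double series is grouped by total degree *)
Definition power_expansion (R : realType) (f : R * R -> R) (p : R * R)
    (c : nat -> nat -> R) : Prop :=
  exists2 r : R, 0 < r & forall x y : R, `|x| < r -> `|y| < r ->
    cvgn (series (fun n => \sum_(i < n.+1)
      `|c i (n - i)%N * x ^+ i * y ^+ (n - i)|)) /\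
    series (fun n => \sum_(i < n.+1)
      c i (n - i)%N * x ^+ i * y ^+ (n - i)) @ \oo
      --> f (p.1 + x, p.2 + y).

Definition analytic_on (R : realType) (U : set (R * R)) (f : R * R -> R) :
    Prop :=
  forall p, U p -> exists c, power_expansion f p c.

Definition analytic_field (R : realType) (U : set (R * R))
    (F : R * R -> R * R) : Prop :=
  analytic_on U (fun p => (F p).1) /\ analytic_on U (fun p => (F p).2).

(* f(x, y) = e x^k y^l + terms of total degree > k + l, at the origin *)
Definition leads_with (R : realType) (f : R * R -> R) (k l : nat) (e : R) :
    Prop :=
  exists2 c, power_expansion f 0 c &
    forall i j : nat, (i + j <= k + l)%N ->
      c i j = if (i == k) && (j == l) then e else 0.

Definition trajectory (R : realType) (F : R * R -> R * R) (N : set (R * R))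
    (phi : R -> R * R) (t0 t1 : R) : Prop :=
  forall t : R, t0 <= t <= t1 ->
    N (phi t) /\ is_derive t (1 : R) phi (F (phi t)).

Definition locally_invariant (R : realType) (F : R * R -> R * R)
    (N W : set (R * R)) : Prop :=
  forall (phi : R -> R * R) (t0 t1 : R), trajectory F N phi t0 t1 ->
    forall t t' : R, t0 <= t <= t1 -> t0 <= t' <= t1 ->
      W (phi t) -> W (phi t').

Definition C1_on (R : realType) (V : normedModType R) (g : R -> V) (a b : R) :
    Prop :=
  forall t : R, a < t < b -> derivable g t 1 /\ {for t, continuous (derive1 g)}.

(* Local invariant C^1 curves in box rho tangent at the origin to the eigenspace
   of the nonzero eigenvalue (the x-axis), resp. of the zero eigenvalue (the
   y-axis), for a field with linear part diag(-1, 0).  Convergence to the origin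
   would not single out the stable manifold: next to it there may be a whole
   parabolic sector of trajectories tending to the origin. *)
Definition stable_manifold (R : realType) (F : R * R -> R * R) (rho : R)
    (s : R -> R) : Prop :=
  [/\ C1_on (s : R -> R^o) (- rho) rho, s 0 = 0, derive1 s 0 = 0 &
      locally_invariant F (box rho) [set p | `|p.1| < rho /\ p.2 = s p.1]].

Definition center_manifold (R : realType) (F : R * R -> R * R) (rho : R)
    (h : R -> R) : Prop :=
  [/\ C1_on (h : R -> R^o) (- rho) rho, h 0 = 0, derive1 h 0 = 0 &
      locally_invariant F (box rho) [set p | `|p.2| < rho /\ p.1 = h p.2]].

(* sigma = 1 or -1 selects the branch in {x > 0} or in {x < 0} *)
Definition stable_branch (R : realType) (rho : R) (s : R -> R) (sigma : R) :
    set (R * R) :=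
  [set p | 0 < sigma * p.1 < rho /\ p.2 = s p.1].

Definition upper_center_branch (R : realType) (rho : R) (h : R -> R) :
    set (R * R) :=
  [set p | 0 < p.2 < rho /\ p.1 = h p.2].

(* the sector at the origin between the two branches above *)
Definition saddle_sector (R : realType) (rho : R) (s h : R -> R) (sigma : R) :
    set (R * R) :=
  [set p | [/\ box rho p, s p.1 < p.2 & 0 < sigma * (p.1 - h p.2)]].

(* A C^1 arc g : ]a, b[ -> N; the determinant condition also gives g' != 0. *)
Definition transversal (R : realType) (F : R * R -> R * R) (N : set (R * R))
    (g : R -> R * R) (a b : R) : Prop :=
  C1_on g a b /\
  forall t : R, a < t < b ->
    N (g t) /\
    (derive1 g t).1 * (F (g t)).2 - (derive1 g t).2 * (F (g t)).1 != 0.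

(* an arc transversal to the curve B: the field is tangent to B, so a curve
   transversal to the field that meets B at g c is transversal to B there *)
Definition transversal_to (R : realType) (F : R * R -> R * R)
    (N B : set (R * R)) (g : R -> R * R) (a b c : R) : Prop :=
  [/\ transversal F N g a b, a < c < b & B (g c)].

(* Main.v *)
Require Import Defs.
From HB Require Import structures.
From mathcomp Require Import all_boot all_order all_algebra.
From mathcomp Require Import all_classical all_reals all_analysis.
From mathcomp Require Import ring lra.
Set Implicit Arguments.
Unset Strict Implicit.
Unset Printing Implicit Defensive.
Import Order.TTheory GRing.Theory Num.Theory.
Import numFieldNormedType.Exports.
Local Open Scope classical_set_scope.
Local Open Scope ring_scope.

(* Let u = y - s(x) and v = sigma (x - h(y)) be coordinates vanishing on the
   stable and on the center manifold.  Close to the singularity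
   |u'| <= |u| / 8 and |v' + v| <= v / 8 in the sector, and y' >= - v.

   Upper bound.  Along a passage, v decreases and y - 5 v increases, so each
   Gamma_n is covered by O(1 / delta) squares of side O(delta).  Moreover
   u^2 v decreases, so the passages starting at height at most eta stay in the
   region u <= eta sqrt(2 r / v), covered by O(eta / delta^2 + 1 / delta)
   squares.  Splitting the sequence at the first gap smaller than delta bounds
   the area of the tube of the union by the length of the tube of (y_n),
   up to a factor.

   Lower bound.  The flow box at t_S makes (n, t) |-> phi_n(t) inversely
   Lipschitz for t <= tau, so the tube of the union contains comparably many
   disjoint squares, provided that the passages last at least tau > 0.  They
   do: otherwise t_U would accumulate, inside the sector, at a point of the
   stable manifold with v > 0.  But t_U enters the sector at the center manifold
   and is crossed by the field in one direction only, so it cannot come down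
   again through a barrier obtained by approximately solving
   dy / dv = y' / v' from below a point of t_U. *)

(** * Areas of tubes *)

(** The center manifold is only C^1 and no normal form is used, so u and v are C^1 coordinates in
    which the field is known through inequalities only. In the sector these give (u^2 v)' <= (2/8 -
    7/8) u^2 v; with the exponent 2 the resulting height is of order v^(-1/2), which is integrable
    at v = 0, so the region below it costs an area proportional to eta. The slope y' / v' contains
    h', which is merely continuous. It need not be Lipschitz, so the barriers are Euler polygons
    with a fixed slope error, and every comparison with them has to leave a margin for that error.
    No hypothesis directly keeps t_U away from t_S inside the sector, which is why the lower bound
    needs an argument about the exit transversal at all. Constant factors are harmless in the end:
    they change the logarithm of an area by a bounded amount, which disappears after division by ln
    delta. *)

Lemma limf_einf_esup_at_right0P (R : realType) (q : R -> R) (d : R) :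
  (limf_einf (fun x => (q x)%:E) 0^'+ = d%:E /\
   limf_esup (fun x => (q x)%:E) 0^'+ = d%:E) <->
  forall e : R, 0 < e -> exists2 eta : R, 0 < eta &
    forall x : R, 0 < x < eta -> `|q x - d| <= e.
Proof.
have right0P (A : set R) :
    (0^'+ A) <-> exists2 eta : R, 0 < eta & forall x : R, 0 < x < eta -> A x.
  rewrite /at_right /within/=; split=> [/nbhs_ballP[e /= e0 eA]|[e e0 eA]].
    exists e => // x /andP[x0 xe]; apply: eA => //=.
    by rewrite /ball/= sub0r normrN gtr0_norm.
  apply/nbhs_ballP; exists e => //= x; rewrite /ball/= sub0r normrN => xe x0.
  by apply: eA; rewrite x0 (le_lt_trans _ xe)// ler_norm.
split=> [[hinf hsup] e e0|h].
  have : (limf_esup (fun x => (q x)%:E) 0^'+ < (d + e)%:E)%E.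
    by rewrite hsup lte_fin ltrDl.
  rewrite limf_esupE => /ereal_inf_lt[_ [A /right0P[e1 e10 A1] <-] supA].
  have : ((d - e)%:E < limf_einf (fun x => (q x)%:E) 0^'+)%E.
    by rewrite hinf lte_fin ltrBlDr ltrDl.
  rewrite limf_einfE => /ereal_sup_gt[_ [B /right0P[e2 e20 B2] <-] infB].
  exists (Num.min e1 e2) => [|x]; first by rewrite lt_min e10.
  rewrite lt_min => /and3P[x0 x1 x2]; rewrite ler_distl -!lee_fin.
  apply/andP; split.
    apply: (le_trans (ltW infB)); apply: ereal_inf_lbound.
    by exists x => //; apply: B2; rewrite x0.
  apply: le_trans (ltW supA); apply: ereal_sup_ubound.
  by exists x => //; apply: A1; rewrite x0.
have lo e : 0 < e -> ((d - e)%:E <= limf_einf (fun x => (q x)%:E) 0^'+)%E.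
  move=> /h[eta eta0 qd]; rewrite limf_einfE; apply: ereal_sup_ge.
  exists (ereal_inf [set (q x)%:E | x in [set x | 0 < x < eta]]).
    by exists [set x | 0 < x < eta] => //; apply/right0P; exists eta.
  apply: le_ereal_inf_tmp => _ [x /= /qd qx <-]; rewrite lee_fin.
  by move: qx; rewrite ler_distl => /andP[].
have hi e : 0 < e -> (limf_esup (fun x => (q x)%:E) 0^'+ <= (d + e)%:E)%E.
  move=> /h[eta eta0 qd]; rewrite limf_esupE; apply: ereal_inf_le.
  exists (ereal_sup [set (q x)%:E | x in [set x | 0 < x < eta]]).
    by exists [set x | 0 < x < eta] => //; apply/right0P; exists eta.
  apply: ge_ereal_sup => _ [x /= /qd qx <-]; rewrite lee_fin.
  by move: qx; rewrite ler_distl => /andP[].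
have mid : (limf_einf (fun x => (q x)%:E) 0^'+ <=
    limf_esup (fun x => (q x)%:E) 0^'+)%E.
  rewrite limf_einfE limf_esupE; apply: ge_ereal_sup => _ [A A0 <-].
  apply: le_ereal_inf_tmp => _ [B B0 <-].
  have /right0P[eta eta0 AB] : 0^'+ (A `&` B) by exact: filterI.
  have [Ae Be] : (A `&` B) (eta / 2) by apply: AB; rewrite divr_gt0//= gtr_pMr// invf_lt1// ltr1n.
  apply: (@le_trans _ _ (q (eta / 2))%:E).
    by apply: ereal_inf_lbound; exists (eta / 2).
  by apply: ereal_sup_ubound; exists (eta / 2).
split; apply/eqP; rewrite eq_le; apply/andP; split.
- by apply/lee_addgt0Pr => e /hi; rewrite EFinD; exact: le_trans.
- by apply/lee_subgt0Pr => e /lo; rewrite EFinB.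
- by apply/lee_addgt0Pr => e /hi; rewrite EFinD.
- apply/lee_subgt0Pr => e /lo; rewrite EFinB => /le_trans; exact.
Qed.
Lemma tubeP (R : realType) (T : Type) (dist : T -> T -> R) (G : set T)
    (delta : R) (p : T) :
  tube dist G delta p <-> exists2 q, G q & dist p q < delta.
Proof.
split=> [/ereal_inf_lt[_ [q Gq <-]]|[q Gq pq]].
  by rewrite lte_fin => pq; exists q.
rewrite /tube/=; apply: (@le_lt_trans _ _ (dist p q)%:E); last by rewrite lte_fin.
by apply: ereal_inf_lbound; exists q.
Qed.

(** An open ball for the sup norm, written as a product of intervals so that the product measure can
    be evaluated on it. *)
Definition square (R : realType) (c : R * R) (a : R) : set (R * R) :=
  [set` `]c.1 - a, c.1 + a[ ] `*` [set` `]c.2 - a, c.2 + a[ ].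

Lemma squareP (R : realType) (c : R * R) (a : R) (p : R * R) :
  square c a p <-> `|p.1 - c.1| < a /\ `|p.2 - c.2| < a.
Proof. by rewrite /square/= !in_itv/= -!ltr_distlC !(distrC c.1) !(distrC c.2). Qed.

Notation lebesgue2 R := (@lebesgue_measure R \x @lebesgue_measure R)%E.

Lemma measurable_square (R : realType) (c : R * R) (a : R) :
  measurable (square c a).
Proof. by apply: measurableX; exact: measurable_itv. Qed.

Lemma lebesgue_centered_itv (R : realType) (x a : R) : 0 <= a ->
  lebesgue_measure `]x - a, x + a[%classic = (2 * a)%:E.
Proof.
move=> a0; rewrite lebesgue_measure_itv/= lte_fin ltrBlDr -addrA ltrDl.
have [a1|a1] := ltrP 0 (a + a); first by rewrite -EFinB; congr (_%:E); ring.
by congr (_%:E); lra.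
Qed.

Lemma lebesgue_square (R : realType) (c : R * R) (a : R) : 0 <= a ->
  lebesgue2 R (square c a) = ((2 * a) ^+ 2)%:E.
Proof.
move=> a0; rewrite product_measure1E; try exact: measurable_itv.
rewrite [X in (X * _)%E](lebesgue_centered_itv c.1 a0).
rewrite [X in (_ * X)%E](lebesgue_centered_itv c.2 a0) -EFinM.
by congr (_%:E); rewrite expr2.
Qed.

(** The sigma-algebra on the plane is the product one, so [A] is written as the countable union of
    the rational squares that it contains. *)
Lemma open_measurable2 (R : realType) (A : set (R * R)) :
  open A -> measurable A.
Proof.
move=> oA.
pose sq (i j k : rat) := square (ratr i, ratr j) (ratr k : R).
pose F i j k := if `[< sq i j k `<=` A >] then sq i j k else set0.
rewrite (_ : A = \bigcup_i \bigcup_j \bigcup_k F i j k).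
  do 3 apply: bigcupT_measurable_rat => ?; rewrite /F.
  by case: ifP => _ //; exact: measurable_square.
apply/seteqP; split=> [p Ap|p [i _ [j _ [k _]]]]; last first.
  by rewrite /F; case: ifPn => // /asboolP; exact.
have /nbhs_ballP[e /= e0 eA] := open_nbhs_nbhs (conj oA Ap).
(* The centre will be within [ratr k] of p, so all points of the square are within 2 k < e of p. *)
have [k] : exists k, ratr k \in `]e / 4, e / 2[ by apply: rat_in_itvoo; lra.
rewrite in_itv/= => /andP[k1 k2].
have [i] : exists i, ratr i \in `]p.1 - ratr k, p.1 + ratr k[.
  by apply: rat_in_itvoo; lra.
have [j] : exists j, ratr j \in `]p.2 - ratr k, p.2 + ratr k[.
  by apply: rat_in_itvoo; lra.
rewrite !in_itv/= -!ltr_distl => pj pi.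
exists i => //; exists j => //; exists k => //; rewrite /F; case: ifPn.
  by move=> _; apply/squareP; rewrite !(distrC p.1) !(distrC p.2).
move=> /asboolP; case => q /squareP[/= q1 q2]; apply: eA; split => /=.
  rewrite /ball/= (le_lt_trans (ler_distD (ratr i) _ _))//.
  by move: pi; rewrite distrC => pi; rewrite (distrC _ q.1); lra.
rewrite /ball/= (le_lt_trans (ler_distD (ratr j) _ _))//.
by move: pj; rewrite distrC => pj; rewrite (distrC _ q.2); lra.
Qed.

Lemma dist2_lt (R : realType) (p q : R * R) (a : R) : 0 < a ->
  (dist2 p q < a) = ((p.1 - q.1) ^+ 2 + (p.2 - q.2) ^+ 2 < a ^+ 2).
Proof.
move=> a0; rewrite /dist2 -[in LHS](ger0_norm (ltW a0)) -sqrtr_sqr ltr_sqrt//.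
by rewrite exprn_gt0.
Qed.

Lemma open_tube2 (R : realType) (G : set (R * R)) (delta : R) :
  open (tube (@dist2 R) G delta).
Proof.
rewrite openE => p /tubeP[q Gq pq].
have d0 : 0 < delta by apply: le_lt_trans pq; exact: sqrtr_ge0.
move: pq; rewrite dist2_lt// => pq.
set x := p.1 - q.1 in pq; set y := p.2 - q.2 in pq.
have cf : (fun z : R * R => (z.1 - q.1) ^+ 2 + (z.2 - q.2) ^+ 2) z @[z --> p]
    --> x ^+ 2 + y ^+ 2.
  by rewrite !expr2; apply: cvgD; apply: cvgM; apply: cvgB; 
    [exact: cvg_fst|exact: cvg_cst|exact: cvg_fst|exact: cvg_cst|
     exact: cvg_snd|exact: cvg_cst|exact: cvg_snd|exact: cvg_cst].
rewrite /interior; near=> z; apply/tubeP; exists q => //; rewrite dist2_lt//.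
near: z; exact: cvgr_lt cf _ pq.
Unshelve. all: by end_near. Qed.

Lemma measurable_tube2 (R : realType) (G : set (R * R)) (delta : R) :
  measurable (tube (@dist2 R) G delta).
Proof. by apply: open_measurable2; exact: open_tube2. Qed.

Lemma measurable_tube1 (R : realType) (G : set R) (delta : R) :
  measurable (tube (@dist1 R) G delta).
Proof.
apply: measurable_realfun.open_measurable; rewrite openE => x /tubeP[y Gy xy].
rewrite /interior; near=> z; apply/tubeP; exists y => //; near: z.
have cf : `|z - y| @[z --> x] --> `|x - y|.
  by apply: cvg_norm; apply: cvgB => //; exact: cvg_cst.
exact: cvgr_lt cf _ xy.
Unshelve. all: by end_near. Qed.

(** * Packings and coverings against measures of tubes *)

Lemma measure_packing d (T : measurableType d) (R : realType)
    (mu : {measure set T -> \bar R}) (I : finType) (F : I -> set T)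
    (A : set T) (w : R) :
  measurable A -> (forall i, measurable (F i)) ->
  (forall i j, F i `&` F j !=set0 -> i = j) ->
  (forall i, F i `<=` A) -> (forall i, mu (F i) = w%:E) ->
  ((#|I|%:R * w)%:E <= mu A)%E.
Proof.
move=> mA mF tF FA muF.
(* The finite family is listed along [nat] and padded with [set0], so that additivity over an
   ordinal applies. *)
pose F' k := if insub k is Some i then F (@enum_val I predT i) else set0.
have F'E (i : 'I_#|I|) : F' i = F (enum_val i) by rewrite /F' valK.
have mF' k : measurable (F' k) by rewrite /F'; case: insubP.
have tF' : trivIset setT F'.
  move=> i j _ _; rewrite /F'; case: insubP => [i' _ <-|_ [? []]//].
  case: insubP => [j' _ <-|_ [? []]//].
  by move=> /tF /enum_val_inj ->.
have -> : (#|I|%:R * w)%:E = mu (\big[setU/set0]_(i < #|I|) F' i).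
  rewrite measure_bigsetU// (eq_bigr (fun=> w%:E)).
    by rewrite sumEFin sumr_const card_ord mulr_natl.
  by move=> i _; rewrite F'E; exact: muF.
apply: le_measure; rewrite ?inE//; first exact: bigsetU_measurable.
by rewrite -bigcup_mkord => x [k /= kI]; rewrite /F'; case: insubP => // i _ _ /FA.
Qed.

(** The squares of side a about the points are disjoint, and (a/2)^2 + (a/2)^2 < a^2 puts them
    inside the Euclidean tube. *)
Lemma tube2_packing (R : realType) (G : set (R * R)) (I : finType)
    (p : I -> R * R) (a : R) :
  0 < a -> (forall i, G (p i)) ->
  (forall i j, `|(p i).1 - (p j).1| < a -> `|(p i).2 - (p j).2| < a -> i = j) ->
  ((#|I|%:R * a ^+ 2)%:E <= lebesgue2 R (tube (@dist2 R) G a))%E.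
Proof.
move=> a0 Gp sep; apply: (@measure_packing _ (measurableTypeR R * measurableTypeR R)%type
  R (lebesgue2 R) I (fun i => square (p i) (a / 2))).
- exact: measurable_tube2.
- by move=> i; exact: measurable_square.
- move=> i j [z [/squareP[zi1 zi2] /squareP[zj1 zj2]]]; apply: sep.
    rewrite (le_lt_trans (ler_distD z.1 _ _))// (distrC (p i).1); lra.
  rewrite (le_lt_trans (ler_distD z.2 _ _))// (distrC (p i).2); lra.
- move=> i z /squareP[z1 z2]; apply/tubeP; exists (p i) => //.
  rewrite dist2_lt// -(real_normK (num_real (_ - _))).
  rewrite -(real_normK (num_real (z.2 - _))).
  have := normr_ge0 (z.1 - (p i).1); have := normr_ge0 (z.2 - (p i).2).
  by nra.
- move=> i; rewrite [LHS](lebesgue_square (p i)) ?divr_ge0 ?(ltW a0)//.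
  by congr (_%:E); lra.
Qed.

Lemma tube1_packing (R : realType) (G : set R) (I : finType)
    (p : I -> R) (a : R) :
  0 < a -> (forall i, G (p i)) ->
  (forall i j, `|p i - p j| < a -> i = j) ->
  ((#|I|%:R * a)%:E <= lebesgue_measure (tube (@dist1 R) G a))%E.
Proof.
move=> a0 Gp sep; apply: (@measure_packing _ (measurableTypeR R)
  R (@lebesgue_measure R) I (fun i => `]p i - a / 2, p i + a / 2[%classic)).
- exact: measurable_tube1.
- by move=> i; exact: measurable_itv.
- move=> i j [z /=]; rewrite !in_itv/= -!ltr_distlC => -[zi zj]; apply: sep.
  rewrite (le_lt_trans (ler_distD z _ _))// (distrC z); lra.
- move=> i z /=; rewrite in_itv/= -ltr_distl => zi.
  by apply/tubeP; exists (p i) => //; rewrite /dist1; lra.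
- move=> i; rewrite [LHS](lebesgue_centered_itv (p i)) ?divr_ge0 ?(ltW a0)//.
  by congr (_%:E); lra.
Qed.

(** [K] is a real bound on the number of squares, so that bounds such as L / delta need no rounding;
    the centres may lie outside [G]. *)
Definition covered (R : realType) (G : set (R * R)) (a K : R) : Prop :=
  exists2 s : seq (R * R), (size s)%:R <= K &
    forall p, G p -> exists2 q, q \in s &
      `|p.1 - q.1| <= a /\ `|p.2 - q.2| <= a.

Lemma norm_lt_sqr_sum (R : realType) (x y a : R) : 0 < a ->
  x ^+ 2 + y ^+ 2 < a ^+ 2 -> `|x| < a.
Proof.
move=> a0 xya; rewrite -(@ltr_pXn2r _ 2) ?nnegrE ?normr_ge0 ?(ltW a0)//.
by rewrite real_normK ?num_real// (le_lt_trans _ xya)// lerDl sqr_ge0.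
Qed.

Lemma tube2_covered (R : realType) (G : set (R * R)) (a K delta : R) :
  0 <= a -> 0 < delta -> covered G a K ->
  (lebesgue2 R (tube (@dist2 R) G delta) <=
    (K * (2 * (a + delta)) ^+ 2)%:E)%E.
Proof.
move=> a0 d0 [s sK sG]; pose F k := square (nth 0 s k) (a + delta).
have w0 : 0 <= a + delta by rewrite addr_ge0// ltW.
apply: (@le_trans _ _ (lebesgue2 R (\big[setU/set0]_(k < size s) F k))).
  apply: le_measure; rewrite ?inE; first exact: measurable_tube2.
    by apply: bigsetU_measurable => i _; exact: measurable_square.
  move=> p /tubeP[z /sG[q qs [z1 z2]]]; rewrite dist2_lt// => pz.
  rewrite -bigcup_mkord; exists (index q s) => /=; first by rewrite index_mem.
  rewrite /F nth_index//; apply/squareP.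
  have p1 := norm_lt_sqr_sum d0 pz.
  move: pz; rewrite addrC => /(norm_lt_sqr_sum d0) p2.
  split; first by rewrite (le_lt_trans (ler_distD z.1 _ _))//; lra.
  by rewrite (le_lt_trans (ler_distD z.2 _ _))//; lra.
apply: (le_trans (le_mu_bigsetU _ _)); first by move=> i _; exact: measurable_square.
rewrite (eq_bigr (fun=> ((2 * (a + delta)) ^+ 2)%:E)) => [|i _].
  by rewrite sumEFin sumr_const card_ord lee_fin -[leLHS]mulr_natl ler_wpM2r// sqr_ge0.
exact: lebesgue_square.
Qed.

Lemma coveredW (R : realType) (G : set (R * R)) (a K L : R) :
  K <= L -> covered G a K -> covered G a L.
Proof. by move=> KL [s sK sG]; exists s => //; exact: le_trans KL. Qed.

Lemma covered_sub (R : realType) (G H : set (R * R)) (a K : R) :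
  G `<=` H -> covered H a K -> covered G a K.
Proof. by move=> GH [s sK sH]; exists s => // p /GH /sH. Qed.

Lemma coveredU (R : realType) (G H : set (R * R)) (a K L : R) :
  covered G a K -> covered H a L -> covered (G `|` H) a (K + L).
Proof.
move=> [s sK sG] [t tL tH]; exists (s ++ t).
  by rewrite size_cat natrD lerD.
move=> p [/sG[q qs]|/tH[q qs]] pq; exists q => //; rewrite mem_cat qs ?orbT//.
Qed.

Lemma covered_bigcup (R : realType) (n : nat) (G : nat -> set (R * R)) (a : R)
    (K : nat -> R) :
  (forall i, (i < n)%N -> covered (G i) a (K i)) ->
  covered (\bigcup_(i < n) G i) a (\sum_(i < n) K i).
Proof.
elim: n => [_|n IH h]; first by exists [::] => [|p []//]; rewrite big_ord0.
rewrite big_ord_recr/= bigcup_mkord big_ord_recr/= -bigcup_mkord.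
by apply: coveredU; [apply: IH => i /ltnW|]; exact: h.
Qed.

(** One representative per label serves as a centre. In the applications a label is the integer part
    of some quantity divided by delta. *)
Lemma covered_labels (R : realType) (G : set (R * R)) (a : R) (n : nat)
    (lab : R * R -> nat) :
  (forall p, G p -> (lab p < n)%N) ->
  (forall p q, G p -> G q -> lab p = lab q ->
    `|p.1 - q.1| <= a /\ `|p.2 - q.2| <= a) ->
  covered G a n%:R.
Proof.
move=> labn labG.
(* The value 0 is a default for labels carried by no point of [G]. *)
pose r k : R * R := if pselect (exists2 p, G p & lab p = k) is left e
  then s2val (cid2 e) else 0.
exists [seq r k | k <- iota 0 n]; first by rewrite size_map size_iota.
move=> p Gp; exists (r (lab p)).
  by apply: map_f; rewrite mem_iota/= add0n labn.
rewrite /r; case: pselect => [e|[]]; last by exists p.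
by case: cid2 => q /= Gq qp; apply: labG.
Qed.
(** The constants shift the logarithm of the measure by at most K, and K / ln delta tends to 0; the
    shift of the dimension by 1 is the difference of the ambient dimensions. *)
Lemma has_minkowski_dim_comparable (R : realType) (G : set R)
    (H : set (R * R)) (c C delta0 d : R) :
  0 < c -> 0 < C -> 0 < delta0 ->
  (forall delta, 0 < delta < delta0 ->
    let f := fine (lebesgue_measure (tube (@dist1 R) G delta)) in
    let g := fine (lebesgue2 R (tube (@dist2 R) H delta)) in
    [/\ 0 < f, c * f <= g & g <= C * f]) ->
  has_minkowski_dim1 G d -> has_minkowski_dim2 H (1 + d).
Proof.
move=> c0 C0 delta00 fg.
rewrite /has_minkowski_dim1 /has_minkowski_dim2 /lower_minkowski_dim
  /upper_minkowski_dim /minkowski_quotient.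
move=> /limf_einf_esup_at_right0P h; apply/limf_einf_esup_at_right0P => e e0.
have e2 : 0 < e / 2 by rewrite divr_gt0.
have [eta eta0 qd] := h _ e2.
pose K : R := `|ln c| + `|ln C| + 1.
have K0 : 0 < K by rewrite ltr_wpDl// addr_ge0.
(* Below the last bound, K / |ln x| < e / 2. *)
exists (Num.min (Num.min eta delta0) (expR (- (K / (e / 2))))).
  by rewrite !lt_min eta0 delta00 expR_gt0.
move=> x; rewrite !lt_min => /andP[x0 /andP[/andP[xeta xdelta] xexp]].
have := fg x; rewrite x0 xdelta => /(_ isT)[/=].
have := qd x; rewrite x0 xeta => /(_ isT).
set f := fine _; set g := fine _ => qf f0 cfg gCf.
have g0 : 0 < g by apply: lt_le_trans cfg; rewrite mulr_gt0.
have lnx : ln x < - (K / (e / 2)).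
  by rewrite -[ltRHS]expRK ltr_ln ?posrE ?expR_gt0.
have lnfg : `|ln f - ln g| <= K.
  have lo : ln c + ln f <= ln g by rewrite -lnM ?posrE// ler_ln ?posrE ?mulr_gt0.
  have hi : ln g <= ln C + ln f by rewrite -lnM ?posrE// ler_ln ?posrE ?mulr_gt0.
  have C1 := ler_norm (ln C); have c1 := ler_norm (- ln c); rewrite normrN in c1.
  have C2 := normr_ge0 (ln C); have c2 := normr_ge0 (ln c).
  by rewrite ler_norml /K; apply/andP; split; lra.
have Ke : 0 < K / (e / 2) by rewrite divr_gt0.
have lnx0 : ln x < 0 by lra.
have quot : `|(ln f - ln g) / ln x| <= e / 2.
  rewrite normrM normfV ler_pdivrMr ?normr_gt0 ?lt_eqF// (le_trans lnfg)//.
  rewrite (ltr0_norm lnx0) mulrC -ler_pdivrMr//; lra.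
have -> : 2 - ln g / ln x - (1 + d) =
    (1 - ln f / ln x - d) + (ln f - ln g) / ln x by rewrite mulrBl; ring.
rewrite (le_trans (ler_normD _ _))//; lra.
Qed.
Lemma tube1_covered (R : realType) (G : set R) (a delta : R) (s : seq R) :
  0 <= a -> 0 < delta ->
  (forall x, G x -> exists2 q, q \in s & `|x - q| <= a) ->
  (lebesgue_measure (tube (@dist1 R) G delta) <=
    ((size s)%:R * (2 * (a + delta)))%:E)%E.
Proof.
move=> a0 d0 sG.
pose F k : set R := `](nth 0 s k) - (a + delta), (nth 0 s k) + (a + delta)[%classic.
have w0 : 0 <= a + delta by rewrite addr_ge0// ltW.
apply: (@le_trans _ _ (lebesgue_measure (\big[setU/set0]_(k < size s) F k))).
  apply: le_measure; rewrite ?inE; first exact: measurable_tube1.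
    by apply: bigsetU_measurable => i _; exact: measurable_itv.
  move=> p /tubeP[z /sG[q qs zq]] pz.
  rewrite -bigcup_mkord; exists (index q s) => /=; first by rewrite index_mem.
  rewrite /F nth_index//= in_itv/= -ltr_distlC distrC.
  by rewrite (le_lt_trans (ler_distD z _ _))//; move: pz; rewrite /dist1; lra.
apply: (le_trans (le_mu_bigsetU _ _)); first by move=> i _; exact: measurable_itv.
rewrite (eq_bigr (fun=> (2 * (a + delta))%:E)) => [|i _].
  by rewrite sumEFin sumr_const card_ord lee_fin -[leLHS]mulr_natl.
exact: lebesgue_centered_itv.
Qed.

(** [fine] sends +oo to 0, so finiteness has to be known before the real number can stand for the
    measure; it follows from boundedness of [G]. *)
Lemma tube1_fineK (R : realType) (G : set R) (c B delta : R) :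
  0 <= B -> 0 < delta -> (forall x, G x -> `|x - c| <= B) ->
  (fine (lebesgue_measure (tube (@dist1 R) G delta)))%:E =
  lebesgue_measure (tube (@dist1 R) G delta).
Proof.
move=> B0 d0 GB; rewrite fineK// ge0_fin_numE ?measure_ge0//.
have := @tube1_covered R G B delta [:: c] B0 d0.
move=> /(_ _)/le_lt_trans; apply; last exact: ltry.
by move=> x /GB xc; exists c; rewrite ?mem_head.
Qed.

(** Separated families have bounded size because the tube of radius a has finite length, and one of
    maximal size is an a-net. The threshold [n0] serves properties that hold only for late
    indices. *)
Lemma maximal_packing (R : realType) (w : nat -> R) (c B a : R) (n0 : nat) :
  0 < a -> 0 <= B -> (forall n, `|w n - c| <= B) ->
  exists M : nat, (0 < M)%N /\ exists f : 'I_M -> nat,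
    [/\ forall i, (n0 <= f i)%N,
        forall i j, `|w (f i) - w (f j)| < a -> i = j &
        forall n, (n0 <= n)%N -> exists i, `|w n - w (f i)| <= a].
Proof.
move=> a0 B0 wB.
pose P M := exists f : 'I_M -> nat, (forall i, (n0 <= f i)%N) /\
  forall i j, `|w (f i) - w (f j)| < a -> i = j.
have wR x : range w x -> `|x - c| <= B by move=> [n _ <-].
pose X := fine (lebesgue_measure (tube (@dist1 R) (range w) a)).
have Pub M : `[< P M >] ->
    (M <= Num.truncn (X / a))%N.
  move=> /asboolP[f [_ fa]].
  have := @tube1_packing R (range w) 'I_M (fun i => w (f i)) a a0 _ fa.
  move=> /(_ (fun i => ex_intro2 _ _ (f i) I erefl)).
  rewrite -(tube1_fineK B0 a0 wR) lee_fin card_ord -ler_pdivlMr// => M1.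
  by rewrite -ltnS -(ltr_nat R) (le_lt_trans M1)// truncnS_gt.
have P1 : `[< P 1%N >].
  by apply/asboolP; exists (fun=> n0); split=> // i j _; rewrite !ord1.
have exP : exists M, `[< P M >] by exists 1%N.
case: (ex_maxnP exP Pub) => M /asboolP[f [fn fa]] Mmax.
exists M; split; first exact: (Mmax 1%N P1).
exists f; split => // n n0n; apply: contrapT => /forallNP nclose.
suff : `[< P M.+1 >] by move=> /Mmax; rewrite ltnn.
apply/asboolP; exists (fun i => if unlift ord_max i is Some j then f j else n).
split=> [i|i j]; first by case: unliftP.
case: unliftP => [i' ->|->]; case: unliftP => [j' ->|->] //.
- by move=> /fa ->.
- by move=> h; case: (nclose i'); rewrite distrC ltW.
- by move=> h; case: (nclose j'); rewrite ltW.
Qed.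

(** * Area of the tube of the union against length of the tube of the sequence *)

Lemma natr_dist_lt1 (R : realType) (m n : nat) :
  `|m%:R - n%:R| < 1 :> R -> m = n.
Proof.
rewrite ltr_distl ltrBlDr !(natr1, ltr_nat) !ltnS => /andP[nm mn].
by apply/eqP; rewrite eqn_leq mn.
Qed.

(** Take M indices whose values of [y] are k delta-separated and J times spaced by k delta. The M J
    points P n t are delta-separated, so the area is at least M J delta^2 with J of order tau / (k
    delta), while the tube of [y] has length at most a multiple of (M + n0) delta. *)
Lemma tube_area_ge_of_separated (R : realType) (y : nat -> R) (c B : R)
    (G : set (R * R)) (P : nat -> R -> R * R) (n0 : nat) (tau k : R) :
  0 <= B -> (forall n, `|y n - c| <= B) -> 0 < tau -> 0 < k ->
  (forall n (t : R), (n0 <= n)%N -> 0 <= t <= tau -> G (P n t)) ->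
  (forall n m (t t' e : R), (n0 <= n)%N -> (n0 <= m)%N ->
    0 <= t <= tau -> 0 <= t' <= tau ->
    `|(P n t).1 - (P m t').1| < e -> `|(P n t).2 - (P m t').2| < e ->
    `|t - t'| < k * e /\ `|y n - y m| < k * e) ->
  exists2 C : R, 0 < C & forall delta : R, 0 < delta ->
    ((C * fine (lebesgue_measure (tube (@dist1 R) (range y) delta)))%:E <=
      lebesgue2 R (tube (@dist2 R) G delta))%E.
Proof.
move=> B0 yB tau0 k0 GP sep.
(* The factor n0 + 1 comes from M + n0 <= M (n0 + 1): the early terms are charged to M >= 1. *)
exists (tau / (k * (2 * (k + 1) * n0.+1%:R))).
  by rewrite divr_gt0 ?mulr_gt0//; lra.
move=> delta d0; have a0 : 0 < k * delta by rewrite mulr_gt0.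
have yR x : range y x -> `|x - c| <= B by move=> [n _ <-].
have [M [M0 [f [fn fsep fcov]]]] := maximal_packing n0 a0 B0 yB.
have upper : fine (lebesgue_measure (tube (@dist1 R) (range y) delta)) <=
    (M + n0)%:R * (2 * (k * delta + delta)).
  pose s := [seq y (f i) | i : 'I_M] ++ [seq y i | i <- iota 0 n0].
  have sz : size s = (M + n0)%N.
    by rewrite size_cat !size_map size_iota -enumT size_enum_ord.
  have := @tube1_covered R (range y) (k * delta) delta s (ltW a0) d0.
  rewrite sz -(tube1_fineK B0 d0 yR) lee_fin; apply => _ [n _ <-].
  have [nn0|n0n] := ltnP n n0.
    exists (y n); last by rewrite subrr normr0 ltW.
    by rewrite mem_cat; apply/orP; right; apply: map_f; rewrite mem_iota.
  have [i yi] := fcov n n0n; exists (y (f i)) => //.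
  by rewrite mem_cat; apply/orP; left; apply: map_f; rewrite mem_enum.
(* One more than the integer part: the last index still gives a time at most tau, while J >= tau /
   (k delta). *)
pose J := (Num.truncn (tau / (k * delta))).+1.
have Jtau (j : 'I_J) : 0 <= j%:R * (k * delta) <= tau.
  rewrite mulr_ge0 ?(ltW a0)//= -ler_pdivlMr//.
  have tk : 0 <= tau / (k * delta) by rewrite divr_ge0 ?ltW.
  have /andP[+ _] := truncn_itv tk; apply: le_trans.
  by rewrite ler_nat -ltnS.
have Jge : tau / (k * delta) <= J%:R by rewrite ltW// truncnS_gt.
pose p (ij : 'I_M * 'I_J) := P (f ij.1) (ij.2%:R * (k * delta)).
have Gp ij : G (p ij) by apply: GP => //; exact: Jtau.
have psep ij ij' : `|(p ij).1 - (p ij').1| < delta ->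
    `|(p ij).2 - (p ij').2| < delta -> ij = ij'.
  case: ij ij' => [i j] [i' j'] /= h1 h2.
  have [tt yy] := sep _ _ _ _ _ (fn i) (fn i') (Jtau j) (Jtau j') h1 h2.
  congr pair; first exact: fsep.
  apply/val_inj/eqP; move: tt; rewrite -mulrBl normrM (gtr0_norm a0).
  rewrite -[ltRHS]mul1r ltr_pM2r// => tt.
  exact/eqP/(natr_dist_lt1 tt).
have := tube2_packing d0 Gp psep.
rewrite card_prod !card_ord; apply: le_trans.
rewrite lee_fin natrM.
have n1 : (M + n0)%:R <= M%:R * n0.+1%:R :> R.
  by rewrite -natrM ler_nat mulnS leq_add2l leq_pmull.
apply: (@le_trans _ _ (tau / (k * (2 * (k + 1) * n0.+1%:R)) *
    (M%:R * n0.+1%:R * (2 * (k * delta + delta))))).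
  rewrite ler_wpM2l//; first by rewrite divr_ge0 ?mulr_ge0//; lra.
  by rewrite (le_trans upper)// ler_wpM2r// mulr_ge0//; lra.
have n1pos : n0.+1%:R != 0 :> R by rewrite pnatr_eq0.
have -> : tau / (k * (2 * (k + 1) * n0.+1%:R)) *
    (M%:R * n0.+1%:R * (2 * (k * delta + delta))) =
    M%:R * (tau / (k * delta)) * delta ^+ 2.
  move: n1pos; move: (n0.+1%:R : R) => z z0.
  by field; rewrite z0 !gt_eqF//; lra.
by rewrite ler_wpM2r ?sqr_ge0// ler_wpM2l.
Qed.
(** If N is the first index with a gap below delta, then after multiplication by delta^2 the numbers
    of squares become multiples of N delta, w N and delta. Each of these is at most the length of
    the tube of the sequence. *)
Lemma tube_area_le_of_covered (R : realType) (w : nat -> R) (c sg : R)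
    (G : nat -> set (R * R)) (k L C0 : R) :
  sg = 1 \/ sg = - 1 -> 0 < k -> 0 < L -> 0 < C0 ->
  (forall n, 0 < w n) -> nonincreasing_seq w -> w @ \oo --> 0 ->
  nonincreasing_seq (fun n => w n - w n.+1) ->
  (forall n (delta : R), 0 < delta < 1 -> covered (G n) (k * delta) (L / delta)) ->
  (forall N (delta : R), 0 < delta < 1 ->
    covered (\bigcup_(n in [set n | (N <= n)%N]) G n) (k * delta)
      (C0 * (w N / delta ^+ 2 + delta^-1))) ->
  let y n := c + sg * w n in
  exists2 C : R, 0 < C & forall delta : R, 0 < delta < 1 ->
    let f := fine (lebesgue_measure (tube (@dist1 R) (range y) delta)) in
    0 < f /\ (lebesgue2 R (tube (@dist2 R) (\bigcup_n G n) delta) <=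
      (C * f)%:E)%E.
Proof.
move=> sgE k0 L0 C00 w0 wdec w_cvg gapdec cov1 covN y.
have sg1 : `|sg| = 1 by case: sgE => ->; rewrite ?normrN normr1.
have ydist x z : `|c + sg * x - (c + sg * z)| = `|x - z|.
  by rewrite opprD addrACA subrr add0r -mulrBr normrM sg1 mul1r.
have yR x : range y x -> `|x - c| <= w 0.
  move=> [n _ <-]; rewrite /y addrAC subrr add0r normrM sg1 mul1r.
  by rewrite gtr0_norm//; exact: wdec.
exists (4 * (k + 1) ^+ 2 * (L + 2 * C0)).
  by rewrite !mulr_gt0 ?exprn_gt0//; lra.
move=> delta dd; move: (dd) => /andP[d0 d1] f.
have fE : f%:E = lebesgue_measure (tube (@dist1 R) (range y) delta).
  exact: tube1_fineK (ltW (w0 0)) d0 yR.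
have fdelta : delta <= f.
  have := @tube1_packing R (range y) 'I_1 (fun=> y 0) delta d0.
  rewrite -fE lee_fin card_ord mul1r; apply; first by move=> _; exists 0.
  by move=> i j _; rewrite !ord1.
split; first exact: lt_le_trans fdelta.
have exN : exists N, w N - w N.+1 < delta.
  have /cvgrPdist_lt/(_ _ d0)[N _ /(_ N (leqnn N))] := w_cvg.
  rewrite sub0r normrN gtr0_norm// => wN.
  by exists N; have := w0 N.+1; lra.
case: (ex_minnP exN) => N gapN minN.
have gap_lt n : (N <= n)%N -> w n - w n.+1 < delta.
  by move=> /gapdec/le_lt_trans; apply.
have gap_ge n : (n < N)%N -> delta <= w n - w n.+1.
  by move=> nN; rewrite leNgt; apply/negP => /minN; rewrite leqNgt nN.
have fN : N%:R * delta <= f.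
  have := @tube1_packing R (range y) 'I_N (fun i => y i) delta d0.
  rewrite -fE lee_fin card_ord; apply; first by move=> i; exists i.
  have aux (i j : 'I_N) : (i < j)%N -> `|y i - y j| < delta -> False.
    move=> ij; rewrite ydist => /ltr_normlW.
    have := gap_ge i (ltn_ord i); have := wdec _ _ ij; lra.
  move=> i j yij; apply/val_inj/eqP; case: ltngtP => // ij.
    by case: (aux _ _ ij).
  by case: (aux _ _ ij); rewrite distrC.
(* From N on, consecutive points are less than delta apart, so the tube contains the whole open
   interval between c and c + sg w N. *)
have fw : w N <= f.
  pose I : set R := `](c + sg * (w N / 2)) - w N / 2, (c + sg * (w N / 2)) + w N / 2[%classic.
  rewrite -lee_fin fE (_ : (w N)%:E = lebesgue_measure I); last first.
    by rewrite [RHS]lebesgue_centered_itv ?divr_ge0 ?ltW//; congr (_%:E); lra.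
  apply: le_measure; rewrite ?inE; first exact: measurable_itv.
    exact: measurable_tube1.
  move=> x; rewrite /I /= in_itv/= => xI.
  pose t := sg * (x - c).
  have xE : x = c + sg * t.
    by rewrite /t; case: sgE => ->; lra.
  have /andP[t0 tN] : 0 < t < w N.
    by rewrite /t; case: sgE xI => -> /andP[h1 h2]; apply/andP; split; lra.
  have exn : exists n, w n <= t.
    have /cvgrPdist_lt/(_ _ t0)[n _ /(_ n (leqnn n))] := w_cvg.
    by rewrite sub0r normrN gtr0_norm// => wn; exists n; exact: ltW.
  case: (ex_minnP exn) => -[|n] wnt minn.
    by have := wdec _ _ (leq0n N); lra.
  have tn : t < w n by rewrite ltNge; apply/negP => /minn; rewrite ltnn.
  have Nn : (N <= n)%N.
    rewrite leqNgt; apply/negP => nN; have := wdec _ _ nN; lra.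
  apply/tubeP; exists (y n.+1); first by exists n.+1.
  rewrite /dist1 xE ydist ger0_norm ?subr_ge0//.
  by have := gap_lt _ Nn; lra.
have cov : covered (\bigcup_n G n) (k * delta)
    (N%:R * (L / delta) + C0 * (w N / delta ^+ 2 + delta^-1)).
  apply: (@covered_sub _ _ ((\bigcup_(i < N) G i) `|`
      \bigcup_(n in [set n | (N <= n)%N]) G n)).
    move=> p [n _ Gp]; have [nN|Nn] := ltnP n N; [left|right]; by exists n.
  apply: coveredU; last exact: covN.
  have -> : N%:R * (L / delta) = \sum_(i < N) (L / delta).
    by rewrite sumr_const card_ord mulr_natl.
  by apply: (@covered_bigcup _ N G _ (fun=> L / delta)) => i _; exact: cov1.
have := tube2_covered (ltW (mulr_gt0 k0 d0)) d0 cov.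
move=> /le_trans; apply; rewrite lee_fin.
have dn0 : delta != 0 by rewrite gt_eqF.
rewrite (_ : _ * _ ^+ 2 = 4 * (k + 1) ^+ 2 *
    (N%:R * delta * L + C0 * (w N + delta))); last by field.
rewrite -[leRHS]mulrA; apply: ler_wpM2l; first by rewrite mulr_ge0 ?sqr_ge0.
rewrite mulrDl lerD//; first by rewrite mulrC ler_wpM2l// ltW.
rewrite [2 * C0]mulrC -mulrA; apply: ler_wpM2l; first exact: ltW.
lra.
Qed.

(** * Power series *)

Lemma series_bound_limit (R : realType) (u : R^nat) (l b C : R) (n0 : nat) :
  u @ \oo --> l -> (forall n, (n0 <= n)%N -> `|u n - b| <= C) -> `|l - b| <= C.
Proof.
move=> ul ub; apply/ler_addgt0Pr => e e0.
have /cvgrPdist_le/(_ _ e0)[N _ uN] := ul.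
have h1 := uN _ (leq_maxr n0 N); have h2 := ub _ (leq_maxl n0 N).
by rewrite (le_trans (ler_distD (u (maxn n0 N)) _ _))// addrC lerD.
Qed.

(** The factor q on the left avoids the exponent i - 1, which would be truncated at i = 0. *)
Lemma expr_dist_le (R : realType) (q D x x' : R) (i : nat) :
  0 <= q -> `|x| <= q -> `|x'| <= q -> `|x - x'| <= D ->
  q * `|x ^+ i - x' ^+ i| <= i%:R * q ^+ i * D.
Proof.
move=> q0 xq xq' xx; elim: i => [|i IH]; first by rewrite subrr normr0 mulr0 !mul0r.
have D0 : 0 <= D := le_trans (normr_ge0 _) xx.
have -> : x ^+ i.+1 - x' ^+ i.+1 = x * (x ^+ i - x' ^+ i) + (x - x') * x' ^+ i.
  by rewrite !exprS; ring.
have h1 : q * `|x * (x ^+ i - x' ^+ i)| <= q * (i%:R * q ^+ i * D).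
  by rewrite normrM mulrCA; apply: ler_pM => //; rewrite mulr_ge0.
have h2 : q * `|(x - x') * x' ^+ i| <= q * (D * q ^+ i).
  rewrite ler_wpM2l// normrM normrX; apply: ler_pM => //.
  by rewrite lerXn2r// nnegrE.
have := ler_wpM2l q0 (ler_normD (x * (x ^+ i - x' ^+ i)) ((x - x') * x' ^+ i)).
move=> /le_trans; apply; rewrite mulrDr (le_trans (lerD h1 h2))//.
by rewrite exprS -natr1 le_eqVlt; apply/orP; left; apply/eqP; ring.
Qed.

Lemma monomial_dist_le (R : realType) (q D x x' y y' : R) (i j : nat) :
  0 <= q -> `|x| <= q -> `|x'| <= q -> `|y| <= q -> `|y'| <= q ->
  `|x - x'| <= D -> `|y - y'| <= D ->
  q * `|x ^+ i * y ^+ j - x' ^+ i * y' ^+ j| <= (i + j)%:R * q ^+ (i + j) * D.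
Proof.
move=> q0 xq xq' yq yq' xx yy.
have -> : x ^+ i * y ^+ j - x' ^+ i * y' ^+ j =
  (x ^+ i - x' ^+ i) * y ^+ j + x' ^+ i * (y ^+ j - y' ^+ j) by ring.
have pow z k : `|z| <= q -> `|z ^+ k| <= q ^+ k.
  by move=> zq; rewrite normrX lerXn2r// nnegrE.
have h1 : q * `|(x ^+ i - x' ^+ i) * y ^+ j| <= i%:R * q ^+ i * D * q ^+ j.
  rewrite normrM mulrA; apply: ler_pM => //; first by rewrite mulr_ge0.
    exact: expr_dist_le.
  exact: pow.
have h2 : q * `|x' ^+ i * (y ^+ j - y' ^+ j)| <= q ^+ i * (j%:R * q ^+ j * D).
  rewrite normrM mulrCA; apply: ler_pM => //; first by rewrite mulr_ge0.
    exact: pow.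
  exact: expr_dist_le.
have := ler_wpM2l q0 (ler_normD ((x ^+ i - x' ^+ i) * y ^+ j)
  (x' ^+ i * (y ^+ j - y' ^+ j))).
move=> /le_trans; apply; rewrite mulrDr (le_trans (lerD h1 h2))//.
by rewrite exprD natrD le_eqVlt; apply/orP; left; apply/eqP; ring.
Qed.

(** The ratio of consecutive terms is at most (k + 1) / (4 k) < 1, so k = 2 is the worst case. This
    extracts a factor q^2 from every term of degree at least two. *)
Lemma mul_expr_le (R : realType) (t : R) (k : nat) :
  0 <= t <= 1 / 4 -> (2 <= k)%N -> k%:R * t ^+ k <= 2 * t ^+ 2.
Proof.
move=> /andP[t0 t4]; case: k => [|[|k]]// _.
suff : k.+2%:R * t ^+ k <= 2.
  by rewrite -(addn2 k) exprD mulrA addn2 => h; rewrite ler_wpM2r// sqr_ge0.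
elim: k => [|k IH]; first by rewrite expr0 mulr1.
apply: le_trans IH; rewrite exprS mulrA ler_wpM2r ?exprn_ge0//.
have k1 : 1 <= k.+2%:R :> R by rewrite ler1n.
by rewrite -(natr1 k.+2); nra.
Qed.

Definition homogeneous_part (R : realType) (c : nat -> nat -> R) (n : nat)
    (x y : R) : R := \sum_(i < n.+1) c i (n - i)%N * x ^+ i * y ^+ (n - i).

(** Both bounds hold monomial by monomial and are summed by absolute convergence. In the first, each
    term of degree at least two is Lipschitz on the box of radius q with a constant O(q). *)
Lemma power_expansion0_bounds (R : realType) (f : R * R -> R)
    (c : nat -> nat -> R) : power_expansion f 0 c ->
  exists2 r : R, 0 < r &
  (exists2 K : R, 0 <= K & forall q D x y x' y' : R,
      q <= r -> `|x| <= q -> `|x'| <= q -> `|y| <= q -> `|y'| <= q ->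
      `|x - x'| <= D -> `|y - y'| <= D ->
      `|f (x, y) - f (x', y') -
        (homogeneous_part c 1 x y - homogeneous_part c 1 x' y')| <= K * q * D) /\
  (forall N, (forall n, (n < N)%N -> forall x y, homogeneous_part c n x y = 0) ->
   exists2 K : R, 0 <= K & forall q x y : R,
      q <= r -> `|x| <= q -> `|y| <= q ->
      `|f (x, y) - homogeneous_part c N x y| <= K * q ^+ N.+1).
Proof.
(* At the diagonal point (r1, r1) every monomial of degree n equals r1^n, so absolute convergence
   there makes [A n * r1 ^+ n] summable. *)
move=> [r r0 fr]; pose r1 := r / 2.
have r10 : 0 < r1 by rewrite /r1; lra.
pose A n : R := \sum_(i < n.+1) `|c i (n - i)%N|.
have A0 n : 0 <= A n by apply: sumr_ge0.
have r1r : `|r1| < r by rewrite gtr0_norm// /r1; lra.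
have [+ _] := fr r1 r1 r1r r1r.
rewrite (_ : (fun n => _) = (fun n => A n * r1 ^+ n)); last first.
  apply/funext => n; rewrite /A mulr_suml; apply: eq_bigr => i _.
  rewrite !normrM !normrX (gtr0_norm r10) -mulrA -exprD subnKC//.
  by rewrite -ltnS.
move=> cvgA; pose S : R := limn (series (fun n => A n * r1 ^+ n)).
have AS n : \sum_(k < n) A k * r1 ^+ k <= S.
  have := @nondecreasing_cvgn_le R (series (fun n => A n * r1 ^+ n)) _ cvgA n.
  rewrite /series/= big_mkord; apply.
  by apply: nondecreasing_series => k _ _; rewrite mulr_ge0// exprn_ge0// ltW.
have S0 : 0 <= S by have := AS 0; rewrite big_ord0.
have fE x y : `|x| < r -> `|y| < r ->
    series (fun n => homogeneous_part c n x y) @ \oo --> f (x, y).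
  by move=> xr yr; have [_] := fr x y xr yr; rewrite !add0r.
(* This choice gives q / r1 <= 1 / 4, as [mul_expr_le] requires. *)
exists (r1 / 4); first by lra.
split.
  exists (2 * S / r1 ^+ 2); first by apply: divr_ge0; [exact: mulr_ge0|apply: exprn_ge0; exact: ltW].
  move=> q D x y x' y' qr xq xq' yq yq' xx yy.
  have D0 : 0 <= D := le_trans (normr_ge0 _) xx.
  have : 0 <= q := le_trans (normr_ge0 _) xq.
  rewrite le_eqVlt => /predU1P[q0|q0].
    move: xq xq' yq yq'; rewrite -q0 !normr_le0 => /eqP-> /eqP-> /eqP-> /eqP->.
    by rewrite !subrr normr0 mulr0 mul0r.
  have qr' : q < r by rewrite (le_lt_trans qr)// /r1; lra.
  have u_cvg : (fun n => series (fun n => homogeneous_part c n x y) n -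
      series (fun n => homogeneous_part c n x' y') n) @ \oo -->
      f (x, y) - f (x', y').
    by apply: cvgB; apply: fE; exact: (le_lt_trans _ qr').
  apply: (series_bound_limit (n0 := 2) u_cvg) => n n2.
  rewrite /series/= !big_mkord -sumrB.
  pose t k : R := homogeneous_part c k x y - homogeneous_part c k x' y'.
  have t0 : t 0%N = 0 by rewrite /t /homogeneous_part !big_ord1 !expr0; ring.
  have tk k : q * `|t k| <= A k * (k%:R * q ^+ k * D).
    rewrite /t /homogeneous_part -sumrB /A mulr_suml.
    apply: (le_trans (ler_wpM2l (ltW q0) (ler_norm_sum _ _ _))).
    rewrite mulr_sumr; apply: ler_sum => i _.
    rewrite -!mulrA -mulrBr normrM mulrCA ler_wpM2l//.
    have := monomial_dist_le i (k - i) (ltW q0) xq xq' yq yq' xx yy.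
    by rewrite subnKC ?mulrA// -ltnS.
  rewrite -/(t 1%N) -(ler_pM2l q0).
  have -> : \sum_(i < n) (homogeneous_part c i x y - homogeneous_part c i x' y')
      - t 1%N = \sum_(i < n | (2 <= i)%N) t i.
    case: n n2 => [|[|n]]// _.
    rewrite [RHS]big_mkcond !big_ord_recl/= -/(t 0%N) -/(t 1%N) t0 !add0r.
    by rewrite addrAC subrr add0r.
  apply: (le_trans (ler_wpM2l (ltW q0) (ler_norm_sum _ _ _))).
  rewrite mulr_sumr.
  have tq : 0 <= q / r1 <= 1 / 4.
    by rewrite divr_ge0 ?(ltW q0) ?(ltW r10)//= ler_pdivrMr// mulrAC mul1r.
  apply: (@le_trans _ _ (\sum_(i < n) A i * r1 ^+ i * (2 * (q / r1) ^+ 2 * D))).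
    rewrite big_mkcond/=; apply: ler_sum => i _; case: ifPn => [i2|_]; last first.
      by rewrite !mulr_ge0// ?exprn_ge0 ?invr_ge0 ?ltW.
    rewrite (le_trans (tk i))// -[leRHS]mulrA ler_wpM2l// [leRHS]mulrA ler_wpM2r//.
    have -> : q ^+ i = r1 ^+ i * (q / r1) ^+ i.
      by rewrite -exprMn mulrCA divff ?mulr1// gt_eqF.
    by rewrite mulrCA ler_wpM2l ?exprn_ge0 ?(ltW r10)// mul_expr_le.
  rewrite -mulr_suml (le_trans (ler_wpM2r _ (AS n)))//.
    by rewrite !mulr_ge0// ?exprn_ge0 ?invr_ge0 ?ltW.
  by rewrite le_eqVlt; apply/orP; left; apply/eqP; field; rewrite gt_eqF.
move=> N hN; exists (S / r1 ^+ N.+1); first by apply: divr_ge0 => //; apply: exprn_ge0; exact: ltW.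
move=> q x y qr xq yq.
have q0 : 0 <= q := le_trans (normr_ge0 _) xq.
have qr' : q < r by rewrite (le_lt_trans qr)// /r1; lra.
have u_cvg : series (fun n => homogeneous_part c n x y) @ \oo --> f (x, y).
  by apply: fE; exact: (le_lt_trans _ qr').
apply: (series_bound_limit (n0 := N.+1) u_cvg) => n nN.
rewrite /series/= big_mkord.
have tk k : `|homogeneous_part c k x y| <= A k * q ^+ k.
  rewrite /homogeneous_part /A mulr_suml.
  apply: (le_trans (ler_norm_sum _ _ _)); apply: ler_sum => i _.
  rewrite -mulrA normrM ler_wpM2l// normrM !normrX.
  rewrite -[in q ^+ k](@subnKC i k) -1?ltnS// exprD.
  by apply: ler_pM => //; rewrite lerXn2r// nnegrE.
have -> : \sum_(i < n) homogeneous_part c i x y - homogeneous_part c N x y =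
    \sum_(i < n | (N < i)%N) homogeneous_part c i x y.
  rewrite (bigD1 (Ordinal nN))//= addrAC subrr add0r.
  rewrite big_mkcond [RHS]big_mkcond/=; apply: eq_bigr => i _.
  rewrite -(inj_eq val_inj)/=; case: ltngtP => //= iN.
  by rewrite hN.
apply: (le_trans (ler_norm_sum _ _ _)).
have tq : 0 <= q / r1 <= 1.
  rewrite divr_ge0 ?(ltW r10)//= ler_pdivrMr// mul1r.
  by rewrite (le_trans qr)//; lra.
apply: (@le_trans _ _ (\sum_(i < n) A i * r1 ^+ i * (q / r1) ^+ N.+1)).
  rewrite big_mkcond/=; apply: ler_sum => i _; case: ifPn => [iN|_]; last first.
    move: tq => /andP[tq0 _]; apply: mulr_ge0; last exact: exprn_ge0.
    by apply: mulr_ge0 => //; apply: exprn_ge0; exact: ltW.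
  rewrite (le_trans (tk i))// -[leRHS]mulrA ler_wpM2l//.
  have -> : q ^+ i = r1 ^+ i * (q / r1) ^+ i.
    by rewrite -exprMn mulrCA divff ?mulr1// gt_eqF.
  rewrite ler_wpM2l ?exprn_ge0 ?(ltW r10)//.
  by move: tq => /andP[tq0 tq1]; apply: ler_wiXn2l.
rewrite -mulr_suml (le_trans (ler_wpM2r _ (AS n)))//.
  by move: tq => /andP[tq0 _]; exact: exprn_ge0.
by rewrite exprMn exprVn mulrA mulrAC.
Qed.
Lemma leads_with_part_lt (R : realType) (c : nat -> nat -> R) (k l : nat)
    (e : R) :
  (forall i j : nat, (i + j <= k + l)%N ->
    c i j = if (i == k) && (j == l) then e else 0) ->
  forall n, (n < k + l)%N -> forall x y, homogeneous_part c n x y = 0.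
Proof.
move=> hc n nkl x y; rewrite /homogeneous_part big1// => i _.
have ni : (i + (n - i))%N = n by rewrite subnKC// -ltnS.
rewrite hc ?ni ?(ltnW nkl)//; case: ifPn; rewrite ?mul0r//.
by move=> /andP[/eqP ik /eqP il]; move: nkl; rewrite -{1}ni ik -il ik ltnn.
Qed.

Lemma leads_with_part_eq (R : realType) (c : nat -> nat -> R) (k l : nat)
    (e : R) :
  (forall i j : nat, (i + j <= k + l)%N ->
    c i j = if (i == k) && (j == l) then e else 0) ->
  forall x y, homogeneous_part c (k + l) x y = e * x ^+ k * y ^+ l.
Proof.
move=> hc x y; rewrite /homogeneous_part.
have kkl : (k < (k + l).+1)%N by rewrite ltnS leq_addr.
rewrite (bigD1 (Ordinal kkl))//= big1 ?addr0.
  by rewrite hc ?addKn ?eqxx.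
move=> i; rewrite -(inj_eq val_inj)/= => /negPf ik.
by rewrite hc ?ik ?mul0r// subnKC// -ltnS.
Qed.

(** The linear part is diag(-1, 0), where m >= 2 removes the linear term of the second component.
    Once x - x' is added back to the first component, only terms of degree at least two contribute
    to the differences. *)
Lemma semihyperbolic_bounds (R : realType) (F : R * R -> R * R) (alpha : R)
    (m : nat) :
  (2 <= m)%N ->
  leads_with (fun p => (F p).1) 1 0 (- 1) ->
  leads_with (fun p => (F p).2) 0 m alpha ->
  exists2 r : R, 0 < r & exists2 K : R, 0 < K &
  [/\ F 0 = 0,
      forall q D x y x' y' : R, q <= r ->
        `|x| <= q -> `|x'| <= q -> `|y| <= q -> `|y'| <= q ->
        `|x - x'| <= D -> `|y - y'| <= D ->
        `|(F (x, y)).1 - (F (x', y')).1 + (x - x')| <= K * q * D /\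
        `|(F (x, y)).2 - (F (x', y')).2| <= K * q * D &
      forall q x y : R, q <= r -> `|x| <= q -> `|y| <= q ->
        `|(F (x, y)).2 - alpha * y ^+ m| <= K * q ^+ m.+1].
Proof.
move=> m2 [c1 exp1 hc1] [c2 exp2 hc2].
have [r1 r10 [[K1 K10 lip1] rem1]] := power_expansion0_bounds exp1.
have [r2 r20 [[K2 K20 lip2] rem2]] := power_expansion0_bounds exp2.
have [K3 K30 rem3] := rem2 m (leads_with_part_lt hc2).
have [K4 K40 rem4] := rem1 1%N (leads_with_part_lt hc1).
have part1 x y := leads_with_part_eq hc1 x y.
have partm x y := leads_with_part_eq hc2 x y.
have part2 x y : homogeneous_part c2 1 x y = 0.
  by apply: leads_with_part_lt hc2 _ _ _ _; rewrite add0n.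
exists (Num.min r1 r2); first by rewrite lt_min r10.
exists (K1 + K2 + K3 + 1); first by lra.
split.
- have h1 := rem4 0 0 0 (ltW r10); have h2 := rem3 0 0 0 (ltW r20).
  rewrite !normr0 !lexx in h1 h2; move: (h1 isT isT) (h2 isT isT).
  rewrite part1 partm expr1 mulr0 mul0r subr0 !expr0n/= !mulr0 normr_le0 => /eqP F1.
  have -> : (m == 0)%N = false by apply/eqP => m0; rewrite m0 in m2.
  by rewrite mulr0 subr0 normr_le0 => /eqP F2; rewrite [LHS]surjective_pairing F1 F2.
- move=> q D x y x' y'; rewrite le_min => /andP[q1 q2] xq xq' yq yq' xx yy.
  have q0 : 0 <= q := le_trans (normr_ge0 _) xq.
  have D0 : 0 <= D := le_trans (normr_ge0 _) xx.
  have qD : 0 <= q * D by rewrite mulr_ge0.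
  split.
    have := lip1 q D x y x' y' q1 xq xq' yq yq' xx yy.
    rewrite !part1 !expr1 !expr0 (_ : _ - (_ - _) =
      (F (x, y)).1 - (F (x', y')).1 + (x - x')); last by ring.
    by move=> /le_trans; apply; rewrite -!mulrA ler_wpM2r//; lra.
  have := lip2 q D x y x' y' q2 xq xq' yq yq' xx yy.
  rewrite !part2 !subr0 => /le_trans; apply.
  by rewrite -!mulrA ler_wpM2r//; lra.
- move=> q x y; rewrite le_min => /andP[q1 q2] xq yq.
  have q0 : 0 <= q := le_trans (normr_ge0 _) xq.
  have := rem3 q x y q2 xq yq; rewrite partm expr0 mulr1 => /le_trans; apply.
  by rewrite ler_wpM2r ?exprn_ge0//; lra.
Qed.

(** * Ordinary differential equations *)

(** The same inequality for a single fixed e is what an approximate solution satisfies, so exact and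
    approximate derivatives can be handled alike. *)
Lemma is_derive1_distP (R : realType) (V : normedModType R) (f : R -> V)
    (t : R) (a : V) :
  is_derive t (1 : R) f a <->
  forall e : R, 0 < e -> exists2 d : R, 0 < d & forall t' : R, `|t' - t| < d ->
    `|f t' - f t - (t' - t) *: a| <= e * `|t' - t|.
Proof.
have quotE (h : R) : h != 0 ->
    a - h^-1 *: ((f \o shift t) (h *: 1) - f t) =
    - (h^-1 *: (f (h + t) - f t - h *: a)).
  move=> h0; have -> : h *: (1 : R) = h by rewrite [LHS]mulr1.
  by rewrite [in RHS]scalerBr opprB scalerA mulVf// scale1r.
split=> [[df dfE] e e0|h].
  have : h^-1 *: ((f \o shift t) (h *: 1) - f t) @[h --> 0^'] --> a.
    by rewrite -dfE.
  move=> /cvgrPdist_le/(_ _ e0)[/= d d0 hd]; exists d => // t' td.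
  have [->|tt] := eqVneq t' t.
    by rewrite !subrr scale0r subr0 !normr0 mulr0.
  have h0 : t' - t != 0 by rewrite subr_eq0.
  have := hd (t' - t); rewrite /ball_/= sub0r normrN td => /(_ isT h0).
  rewrite quotE// normrN normrZ normfV subrK ler_pdivrMl ?normr_gt0//.
  by rewrite mulrC.
have : h^-1 *: ((f \o shift t) (h *: 1) - f t) @[h --> 0^'] --> a.
  apply/cvgrPdist_le => e e0; have [d d0 hd] := h e e0.
  exists d => //= s; rewrite /ball_/= sub0r normrN => sd s0.
  rewrite quotE// normrN normrZ normfV ler_pdivrMl ?normr_gt0//.
  by have := hd (s + t); rewrite addrK mulrC; apply.
by move=> fa; split; [apply/cvg_ex; exists a|exact: cvg_lim].
Qed.

Lemma is_derive1_fst (R : realType) (phi : R -> R * R) (t : R) (a : R * R) :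
  is_derive t (1 : R) phi a -> is_derive t (1 : R) (fun t => (phi t).1 : R^o) a.1.
Proof.
move=> /is_derive1_distP h; apply/is_derive1_distP => e /h[d d0 hd].
exists d => // t' /hd; apply: le_trans.
by rewrite [leRHS]prod_normE le_max lexx.
Qed.

Lemma is_derive1_snd (R : realType) (phi : R -> R * R) (t : R) (a : R * R) :
  is_derive t (1 : R) phi a -> is_derive t (1 : R) (fun t => (phi t).2 : R^o) a.2.
Proof.
move=> /is_derive1_distP h; apply/is_derive1_distP => e /h[d d0 hd].
exists d => // t' /hd; apply: le_trans.
by rewrite [leRHS]prod_normE le_max lexx orbT.
Qed.

(** Let c be the supremum of the t such that P holds on [a, t]. The third hypothesis gives P c, and
    the second would push beyond c unless c = b. *)
Lemma real_induction (R : realType) (P : R -> Prop) (a b : R) :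
  P a ->
  (forall t : R, a <= t < b -> (forall s : R, a <= s <= t -> P s) ->
     exists2 d : R, 0 < d & forall s : R, t < s < t + d -> s <= b -> P s) ->
  (forall t : R, a < t <= b -> (forall s : R, a <= s < t -> P s) -> P t) ->
  forall t : R, a <= t <= b -> P t.
Proof.
move=> Pa Pstep Plim t /andP[at_ tb].
pose S := [set t | a <= t <= b /\ forall s : R, a <= s <= t -> P s].
have ab : a <= b := le_trans at_ tb.
have Sa : S a.
  split; first by rewrite lexx.
  by move=> s sa; rewrite (_ : s = a)//; apply/eqP; rewrite eq_le andbC.
have supS : has_sup S by split; [exists a|exists b => s [/andP[]]].
pose c := sup S.
have ac : a <= c by apply: ub_le_sup => //; case: supS.
have cb : c <= b by apply: ge_sup; [exists a|move=> s [/andP[]]].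
have Plt s : a <= s < c -> P s.
  move=> /andP[as_ /(sup_gt _)]; move=> /(_ (ex_intro _ _ Sa))[u [_ Pu] su].
  by apply: Pu; rewrite as_ ltW.
have Pc : P c.
  have [<-//|ca] := eqVneq a c.
  by apply: Plim => //; rewrite lt_neqAle ca ac.
have Ple s : a <= s <= c -> P s.
  move=> /andP[as_]; rewrite le_eqVlt => /predU1P[->//|sc].
  by apply: Plt; rewrite as_.
have [cb'|bc] := ltP c b; last first.
  by apply: Ple; rewrite at_ (le_trans tb).
have [|d d0 Pd] := Pstep c _ Ple; first by rewrite ac.
have : S (Num.min b (c + d / 2)).
  split; first by rewrite le_min ge_min lexx ab (le_trans ac)// lerDl divr_ge0// ltW.
  move=> s /andP[as_]; rewrite le_min => /andP[sb sd].
  have [sc|cs] := leP s c; first by apply: Ple; rewrite as_.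
  by apply: Pd => //; rewrite cs (le_lt_trans sd)// ltrD2l gtr_pMr// invf_lt1// ltr1n.
move=> Sd; have := ub_le_sup supS.2 Sd; rewrite -/c.
by rewrite ge_min leNgt cb'/= gerDl leNgt divr_gt0.
Qed.

Lemma local_lipschitz_segment (R : realType) (V : normedModType R) (f : R -> V)
    (a b K : R) :
  (forall t : R, a <= t <= b -> exists2 d : R, 0 < d & forall t' : R, a <= t' <= b ->
     `|t' - t| < d -> `|f t' - f t| <= K * `|t' - t|) ->
  forall t : R, a <= t <= b -> `|f t - f a| <= K * (t - a).
Proof.
move=> h; apply: real_induction.
- by rewrite !subrr normr0 mulr0.
- move=> t /andP[at_ tb] Ps; have [|d d0 hd] := h t; first by rewrite at_ ltW.
  exists d => // s /andP[ts sd] sb.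
  have := hd s; rewrite sb (le_trans at_ (ltW ts)) gtr0_norm ?subr_gt0//.
  rewrite ltrBlDr addrC sd => /(_ isT isT) h1.
  have h2 := Ps t; rewrite at_ lexx in h2.
  have := ler_distD (f t) (f s) (f a); move=> /le_trans; apply.
  by rewrite (_ : K * (s - a) = K * (s - t) + K * (t - a)) ?lerD ?h2//; ring.
- move=> t /andP[at_ tb] Ps; have [|d d0 hd] := h t; first by rewrite tb ltW.
  pose s := Num.max a (t - d / 2).
  have as_ : a <= s by rewrite le_max lexx.
  have st : s < t by rewrite gt_max at_ ltrBlDr ltrDl divr_gt0.
  have sd : `|s - t| < d.
    rewrite distrC gtr0_norm ?subr_gt0// ltrBlDr -ltrBlDl.
    by rewrite lt_max; apply/orP; right; lra.
  have := hd s; rewrite as_ (le_trans (ltW st) tb) sd => /(_ isT isT) h1.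
  rewrite (distrC (f s)) (distrC s) gtr0_norm ?subr_gt0// in h1.
  have h2 := Ps s; rewrite as_ st in h2.
  have := ler_distD (f s) (f t) (f a); move=> /le_trans; apply.
  by rewrite (_ : K * (t - a) = K * (t - s) + K * (s - a)) ?lerD ?h2//; ring.
Qed.
(* Euler polygons *)
Lemma approximate_solution (R : realType) (V : normedModType R)
    (f : R -> V -> V) (x0 : V) (M : R) :
  0 <= M -> (forall t x, `|f t x| <= M) ->
  (forall e : R, 0 < e -> exists2 d : R, 0 < d & forall (t s : R) (x y : V),
     `|t - s| <= d -> `|x - y| <= d -> `|f t x - f s y| <= e) ->
  forall e T : R, 0 < e -> 0 <= T -> exists2 L : R -> V, L 0 = x0 &
    forall t : R, 0 <= t <= T -> exists2 d : R, 0 < d & forall t' : R, 0 <= t' <= T ->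
      `|t' - t| < d -> `|L t' - L t - (t' - t) *: f t (L t)| <= e * `|t' - t|.
Proof.
move=> M0 fM UC e T e0 T0.
have [d d0 fd] := UC e e0.
(* During one step the time moves by at most d and the polygon by at most dt M <= d, so the slope
   changes by at most e. *)
pose dt := d / (M + 1).
have dt0 : 0 < dt by rewrite divr_gt0// ltr_wpDl.
pose good (c : R) (L : R -> V) := L 0 = x0 /\
  forall t : R, 0 <= t <= c -> exists2 d : R, 0 < d & forall t' : R, 0 <= t' <= c ->
    `|t' - t| < d -> `|L t' - L t - (t' - t) *: f t (L t)| <= e * `|t' - t|.
have goodW c c' L : c <= c' -> good c' L -> good c L.
  move=> cc [L0 gL]; split=> // t /andP[t0 tc].
  have [|d1 d10 Ld] := gL t; first by rewrite t0 (le_trans tc).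
  by exists d1 => // t' /andP[t'0 t'c]; apply: Ld; rewrite t'0 (le_trans t'c).
suff [k [L gL]] : exists k : nat, exists L, good (k%:R * dt) L /\ T <= k%:R * dt.
  by have [] := goodW _ _ _ gL.2 gL.1; exists L.
exists (Num.truncn (T / dt)).+1.
have Tk : T <= (Num.truncn (T / dt)).+1%:R * dt.
  by rewrite -ler_pdivrMr// ltW// truncnS_gt.
move: Tk; set k := _.+1 => Tk.
suff [L gL] : exists L, good (k%:R * dt) L by exists L.
elim: k {Tk} => [|k [L [L0 gL]]].
  exists (fun=> x0); split => // t; rewrite mul0r -eq_le => /eqP <-.
  exists 1 => // t'; rewrite -eq_le => /eqP <- _.
  by rewrite !subrr scale0r subrr !normr0 mulr0.
set c := k%:R * dt in gL.
have c0 : 0 <= c by rewrite mulr_ge0// ltW.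
have -> : k.+1%:R * dt = c + dt by rewrite -natr1 mulrDl mul1r.
(* One more edge, with the slope frozen at its left end. *)
pose L' t := if t <= c then L t else L c + (t - c) *: f c (L c).
have L'le t : t <= c -> L' t = L t by rewrite /L' => ->.
have L'ge t : c <= t -> L' t = L c + (t - c) *: f c (L c).
  rewrite /L' le_eqVlt => /predU1P[->|ct]; first by rewrite lexx subrr scale0r addr0.
  by rewrite leNgt ct.
exists L'; split; first by rewrite L'le.
move=> t /andP[t0 tc]; have [tc'|ct|tc'] := ltrgtP t c.
- have [|d1 d10 Ld] := gL t; first by rewrite t0 ltW.
  exists (Num.min d1 (c - t)); first by rewrite lt_min d10 subr_gt0.
  move=> t' /andP[t'0 _]; rewrite lt_min => /andP[td1 tct].
  have t'c : t' <= c.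
    have := ler_norm (t' - t); lra.
  by rewrite (L'le t') ?(L'le t) ?(ltW tc')//; apply: Ld => //; rewrite t'0.
- exists (t - c); first by rewrite subr_gt0.
  move=> t' _ tt.
  have ct' : c <= t'.
    have := ler_norm (t - t'); rewrite distrC; lra.
  rewrite (L'ge t')// (L'ge t) ?(ltW ct)// opprD addrACA subrr add0r -scalerBl.
  rewrite opprB addrA subrK -scalerBr normrZ mulrC ler_wpM2r//.
  have tcdt : 0 <= t - c <= dt by rewrite subr_ge0 (ltW ct)/= lerBlDl.
  apply: fd.
    rewrite distrC ger0_norm; last by case/andP: tcdt.
    rewrite (le_trans (proj2 (andP tcdt)))// ler_pdivrMr ?ltr_wpDl//.
    by rewrite mulrDr mulr1 lerDr mulr_ge0// ltW.
  rewrite opprD addrA subrr add0r normrN normrZ ger0_norm; last by case/andP: tcdt.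
  apply: (@le_trans _ _ (dt * M)); first by apply: ler_pM => //; case/andP: tcdt.
  by rewrite mulrAC ler_pdivrMr ?ltr_wpDl// ler_wpM2l ?(ltW d0)// lerDl.
- rewrite tc'; have [|d1 d10 Ld] := gL c; first by rewrite c0 lexx.
  exists d1 => // t' /andP[t'0 _] td.
  have [t'c|/ltW ct'] := leP t' c.
    by rewrite !L'le//; apply: Ld => //; rewrite t'0.
  rewrite (L'ge t')// (L'le c)// [_ + _ *: _ - _]addrAC subrr add0r subrr normr0.
  by rewrite mulr_ge0// ltW.
Qed.
Lemma pair_ext (R : realType) (p q : R * R) : p.1 = q.1 -> p.2 = q.2 -> p = q.
Proof. by case: p q => [a b] [c d] /= -> ->. Qed.

Lemma fstD (R : realType) (p q : R * R) : (p + q).1 = p.1 + q.1. Proof. by []. Qed.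
Lemma sndD (R : realType) (p q : R * R) : (p + q).2 = p.2 + q.2. Proof. by []. Qed.
Lemma fstN (R : realType) (p : R * R) : (- p).1 = - p.1. Proof. by []. Qed.
Lemma sndN (R : realType) (p : R * R) : (- p).2 = - p.2. Proof. by []. Qed.
Lemma fstZ (R : realType) (a : R) (p : R * R) : (a *: p).1 = a * p.1. Proof. by []. Qed.
Lemma sndZ (R : realType) (a : R) (p : R * R) : (a *: p).2 = a * p.2. Proof. by []. Qed.
Definition pairE := (fstD, sndD, fstN, sndN, fstZ, sndZ).

Lemma cvg_of_cauchy_bound (R : realType) (u a : R^nat) :
  a @ \oo --> 0 -> (forall n m, `|u n - u m| <= a n + a m) ->
  exists l, forall n, `|l - u n| <= a n.
Proof.
move=> a_cvg ua.
have cu : cvg (u @ \oo).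
  apply: cauchy_cvg; apply: cauchy_exP => e e0.
  have e2 : 0 < e / 2 by rewrite divr_gt0.
  have /cvgrPdist_lt/(_ _ e2)[N _ aN] := a_cvg.
  have aN' n : (N <= n)%N -> a n < e / 2.
    by move=> /aN; rewrite sub0r normrN => /(le_lt_trans (ler_norm _)).
  exists (u N); exists N => // n /= Nn; rewrite /ball/=.
  by rewrite (le_lt_trans (ua N n))//; have := aN' _ Nn; have := aN' _ (leqnn N); lra.
exists (limn u) => n; apply/ler_addgt0Pr => e e0.
have /cvgrPdist_lt/(_ _ e0)[N _ aN] := a_cvg.
apply: (series_bound_limit (n0 := N) cu) => m Nm; rewrite (le_trans (ua m n))//.
rewrite addrC lerD2l; have := aN _ Nm; rewrite sub0r normrN => /ltW.
by apply: le_trans; exact: ler_norm.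
Qed.

Lemma prod_norm_le (R : realType) (p : R * R) (a : R) :
  (`|p| <= a) = (`|p.1| <= a) && (`|p.2| <= a).
Proof. by rewrite [`|p|]prod_normE ge_max. Qed.

(** Euler polygons with slope errors e n = 1 / (n + 1) are uniformly Cauchy. The largest distance S
    between two of them satisfies S <= (K S + e n + e m) tau, and K tau = 1 / 2 lets S be absorbed
    on the left. *)
Lemma lipschitz_field_trajectory (R : realType) (F : R * R -> R * R)
    (K M : R) (p0 : R * R) :
  0 < K -> 0 <= M -> (forall p q, `|F p - F q| <= K * `|p - q|) ->
  (forall p, `|F p| <= M) ->
  exists2 tau : R, 0 < tau & exists2 phi : R -> R * R, phi 0 = p0 &
    forall t : R, 0 <= t < tau -> is_derive t (1 : R) phi (F (phi t)).
Proof.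
move=> K0 M0 FK FM.
pose tau := (2 * K)^-1.
have tau0 : 0 < tau by rewrite invr_gt0 mulr_gt0.
have Ktau : K * tau = 2^-1 by rewrite /tau invfM mulrCA divff ?mulr1// gt_eqF.
pose e (n : nat) : R := n.+1%:R^-1.
have e0 n : 0 < e n by rewrite invr_gt0.
have e1 n : e n <= 1 by rewrite invf_le1// ler1n.
have UC (eps : R) : 0 < eps -> exists2 d : R, 0 < d & forall (t s : R) (x y : R * R),
     `|t - s| <= d -> `|x - y| <= d -> `|F x - F y| <= eps.
  move=> eps0; exists (eps / K); first by rewrite divr_gt0.
  move=> _ _ x y _ xy; rewrite (le_trans (FK x y))// mulrC -ler_pdivlMr//.
have sol n : exists L : R -> R * R, L 0 = p0 /\
    forall t : R, 0 <= t <= tau -> exists2 d : R, 0 < d & forall t' : R, 0 <= t' <= tau ->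
      `|t' - t| < d -> `|L t' - L t - (t' - t) *: F (L t)| <= e n * `|t' - t|.
  have [L L0 Lsol] := @approximate_solution R _ (fun=> F) p0 M M0
    (fun=> FM) UC (e n) tau (e0 n) (ltW tau0).
  by exists L.
have /choice[L Lsol] := sol.
have L0 n : L n 0 = p0 := (Lsol n).1.
have Llip n (t t' : R) : 0 <= t <= t' -> t' <= tau ->
    `|L n t' - L n t| <= (M + 1) * (t' - t).
  move=> /andP[t0 tt'] t'tau.
  apply: (@local_lipschitz_segment _ _ (L n) t t'); last by rewrite tt' lexx.
  move=> s /andP[ts st']; have [|d d0 Ld] := (Lsol n).2 s.
    by rewrite (le_trans t0 ts) (le_trans st' t'tau).
  exists d => // s' /andP[ts' s't'] sd.
  have := Ld s'; rewrite (le_trans t0 ts') (le_trans s't' t'tau) => /(_ isT sd) h1.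
  rewrite -[X in `|X|](subrK ((s' - s) *: F (L n s))) (le_trans (ler_normD _ _))//.
  rewrite mulrDl mul1r addrC lerD//; first by rewrite normrZ mulrC ler_wpM2r.
  by rewrite (le_trans h1)// ler_piMl.
have Lsmall n (t : R) : 0 <= t <= tau -> `|L n t - p0| <= (M + 1) * tau.
  move=> /andP[t0 tt]; rewrite -(L0 n) (le_trans (Llip n 0 t _ tt)) ?lexx//.
  by rewrite subr0 ler_wpM2l// addr_ge0.
pose a n := 2 * e n * tau.
have Lcauchy n m (t : R) : 0 <= t <= tau -> `|L n t - L m t| <= a n + a m.
  pose A := [set `|L n t - L m t| | t in [set t | 0 <= t <= tau]].
  have supA : has_sup A.
    split; first by exists `|L n 0 - L m 0|, 0 => //=; rewrite lexx ltW.
    exists ((M + 1) * tau + (M + 1) * tau) => _ [s s_ <-].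
    by rewrite (le_trans (ler_distD p0 _ _))// lerD// ?Lsmall// distrC Lsmall.
  pose S := sup A.
  have AS (s : R) : 0 <= s <= tau -> `|L n s - L m s| <= S.
    by move=> s_; apply: ub_le_sup; [exact: supA.2|exists s].
  have gS (s : R) : 0 <= s <= tau -> `|L n s - L m s| <= (K * S + e n + e m) * s.
    move=> s_; have := @local_lipschitz_segment _ _ (fun s => L n s - L m s)
      0 tau (K * S + e n + e m).
    move=> /(_ _ s s_); rewrite !L0 subrr !subr0; apply => u u_.
    have [d1 d10 Ld1] := (Lsol n).2 u u_; have [d2 d20 Ld2] := (Lsol m).2 u u_.
    exists (Num.min d1 d2); first by rewrite lt_min d10.
    move=> u' u'_; rewrite lt_min => /andP[ud1 ud2].
    have h1 := Ld1 u' u'_ ud1; have h2 := Ld2 u' u'_ ud2.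
    have -> : L n u' - L m u' - (L n u - L m u) =
      (L n u' - L n u - (u' - u) *: F (L n u)) -
      (L m u' - L m u - (u' - u) *: F (L m u)) +
      (u' - u) *: (F (L n u) - F (L m u)).
      by apply: pair_ext; rewrite !pairE; ring.
    rewrite (le_trans (ler_normD _ _))//.
    have h3 : `|(u' - u) *: (F (L n u) - F (L m u))| <= K * S * `|u' - u|.
      rewrite normrZ mulrC ler_wpM2r// (le_trans (FK _ _))// ler_wpM2l ?(ltW K0)//.
      exact: AS.
    have h4 := ler_normB (L n u' - L n u - (u' - u) *: F (L n u))
      (L m u' - L m u - (u' - u) *: F (L m u)).
    by rewrite !mulrDl; lra.
  move=> t_; rewrite (le_trans (AS t t_))//.
  have S0 : 0 <= S := le_trans (normr_ge0 _) (AS t t_).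
  have : S <= (K * S + e n + e m) * tau.
    apply: ge_sup; first exact: supA.1.
    move=> _ [s s_ <-]; rewrite (le_trans (gS s s_))// ler_wpM2l//.
      by rewrite !addr_ge0// ?mulr_ge0// ltW.
    by case/andP: s_.
  rewrite (_ : _ * tau = (K * tau) * S + (e n + e m) * tau); last by ring.
  by rewrite Ktau /a; lra.
have a_cvg : a @ \oo --> 0.
  rewrite (_ : 0 = 2 * 0 * tau); last by rewrite mulr0 mul0r.
  by apply: cvgMl; apply: cvgMr; exact: cvg_harmonic.
have lim1 (t : R) : exists l : R, 0 <= t <= tau -> forall n, `|l - (L n t).1| <= a n.
  have [tt|_] := boolP (0 <= t <= tau); last by exists 0.
  have [|l hl] := @cvg_of_cauchy_bound R (fun n => (L n t).1) a a_cvg; last by exists l.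
  by move=> n m; have := Lcauchy n m t tt; rewrite prod_norm_le => /andP[].
have lim2 (t : R) : exists l : R, 0 <= t <= tau -> forall n, `|l - (L n t).2| <= a n.
  have [tt|_] := boolP (0 <= t <= tau); last by exists 0.
  have [|l hl] := @cvg_of_cauchy_bound R (fun n => (L n t).2) a a_cvg; last by exists l.
  by move=> n m; have := Lcauchy n m t tt; rewrite prod_norm_le => /andP[].
have /choice[l1 hl1] := lim1; have /choice[l2 hl2] := lim2.
pose phi (t : R) : R * R := (l1 t, l2 t).
have phiL (t : R) n : 0 <= t <= tau -> `|phi t - L n t| <= a n.
  by move=> tt; rewrite prod_norm_le/= hl1// hl2.
have phi0 : phi 0 = p0.
  have z : (0 : R) <= 0 <= tau by rewrite lexx ltW.
  apply/eqP; rewrite -subr_eq0 -normr_le0; apply/ler_addgt0Pr => eps eps0.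
  have /cvgrPdist_lt/(_ _ eps0)[N _ /(_ N (leqnn N))] := a_cvg.
  rewrite sub0r normrN add0r => /(le_lt_trans (ler_norm _))/ltW; apply: le_trans.
  by rewrite -(L0 N) phiL.
(* The quadratic term has a constant independent of n, so the estimate passes to the limit and gives
   the derivative there. *)
have Ltaylor n (t t' : R) : 0 <= t <= tau -> 0 <= t' <= tau ->
    `|L n t' - L n t - (t' - t) *: F (L n t)| <=
    (e n + K * (M + 1) * `|t' - t|) * `|t' - t|.
  move=> t_ t'_.
  have aux (u v : R) : 0 <= u <= v -> v <= tau -> t \in [:: u; v] ->
      `|L n v - L n u - (v - u) *: F (L n t)| <=
      (e n + K * (M + 1) * (v - u)) * (v - u).
    move=> /andP[u0 uv] vtau tuv.
    have := @local_lipschitz_segment _ _ (fun s => L n s - s *: F (L n t)) u v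
       (e n + K * (M + 1) * (v - u)).
    move=> /(_ _ v); rewrite uv lexx => /(_ _ isT).
    rewrite (_ : L n v - v *: F (L n t) - (L n u - u *: F (L n t)) =
      L n v - L n u - (v - u) *: F (L n t)); last first.
      by apply: pair_ext; rewrite !pairE; ring.
    apply => s /andP[us sv].
    have s_ : 0 <= s <= tau by rewrite (le_trans u0 us) (le_trans sv vtau).
    have [d d0 Ld] := (Lsol n).2 s s_.
    exists d => // s' /andP[us' s'v] sd.
    have s'_ : 0 <= s' <= tau by rewrite (le_trans u0 us') (le_trans s'v vtau).
    have h1 := Ld s' s'_ sd.
    have -> : L n s' - s' *: F (L n t) - (L n s - s *: F (L n t)) =
      (L n s' - L n s - (s' - s) *: F (L n s)) +
      (s' - s) *: (F (L n s) - F (L n t)).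
      by apply: pair_ext; rewrite !pairE; ring.
    rewrite (le_trans (ler_normD _ _))// mulrDl lerD// normrZ mulrC ler_wpM2r//.
    rewrite (le_trans (FK _ _))// -mulrA ler_wpM2l ?(ltW K0)//.
    have M1 : 0 <= M + 1 by rewrite addr_ge0.
    move: tuv; rewrite !inE => /orP[/eqP->|/eqP->].
      rewrite (le_trans (Llip n u s _ _)) ?u0//; first by case/andP: s_.
      by rewrite ler_wpM2l// lerD2r.
    rewrite distrC (le_trans (Llip n s v _ _)) ?sv ?andbT//; first by case/andP: s_.
    by rewrite ler_wpM2l// lerD2l lerN2.
  have [tt'|t't] := leP t t'.
    rewrite [`|t' - t|]ger0_norm ?subr_ge0//; apply: aux; rewrite ?mem_head//.
      by case/andP: t_ => ->.
    by case/andP: t'_.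
  have -> : L n t' - L n t - (t' - t) *: F (L n t) =
      - (L n t - L n t' - (t - t') *: F (L n t)).
    by apply: pair_ext; rewrite !pairE; ring.
  rewrite normrN (distrC t').
  rewrite [`|t - t'|]gtr0_norm ?subr_gt0//.
  case/andP: t_ => t0 ttau; case/andP: t'_ => t'0 _.
  by apply: aux; rewrite ?inE ?eqxx ?orbT// t'0 ltW.
have phitaylor (t t' : R) : 0 <= t <= tau -> 0 <= t' <= tau ->
    `|phi t' - phi t - (t' - t) *: F (phi t)| <= K * (M + 1) * `|t' - t| * `|t' - t|.
  move=> t_ t'_; apply/ler_addgt0Pr => eps eps0.
  pose C := 2 * tau + 2 * tau + K * 2 * tau * `|t' - t| + `|t' - t| + 1.
  have C0 : 0 < C.
    by rewrite ltr_wpDl// !addr_ge0// !mulr_ge0// ltW.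
  have [n en] : exists n, e n < eps / C.
    have epsC : 0 < eps / C by rewrite divr_gt0.
    have /cvgrPdist_lt/(_ _ epsC)[N _ /(_ N (leqnn N))] := @cvg_harmonic R.
    by rewrite sub0r normrN ger0_norm ?invr_ge0// => eN; exists N.
  have -> : phi t' - phi t - (t' - t) *: F (phi t) =
    (L n t' - L n t - (t' - t) *: F (L n t)) + (phi t' - L n t') -
    (phi t - L n t) - (t' - t) *: (F (phi t) - F (L n t)).
    by apply: pair_ext; rewrite !pairE; ring.
  have h1 := Ltaylor n t t' t_ t'_.
  have h2 := phiL t' n t'_; have h3 := phiL t n t_.
  have h4 : `|(t' - t) *: (F (phi t) - F (L n t))| <= `|t' - t| * (K * a n).
    by rewrite normrZ ler_wpM2l// (le_trans (FK _ _))// ler_wpM2l// ltW.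
  have h5 : e n * C < eps by rewrite -ltr_pdivlMr.
  apply: (le_trans (ler_normB _ _)); apply: (le_trans (lerD (ler_normB _ _) h4)).
  apply: (le_trans (lerD (lerD (ler_normD _ _) h3) (lexx _))).
  apply: (le_trans (lerD (lerD (lerD h1 h2) (lexx _)) (lexx _))).
  rewrite (_ : _ + _ = K * (M + 1) * `|t' - t| * `|t' - t| + (e n * C - e n)).
    by rewrite lerD2l; have := e0 n; lra.
  by rewrite /C /a; ring.
(* The solution is continued by its tangent for t < 0, because the derivative at 0 is two-sided. *)
pose psi (t : R) : R * R := if 0 <= t then phi t else p0 + t *: F p0.
exists tau => //; exists psi; first by rewrite /psi lexx.
move=> t /andP[t0 ttau]; apply/is_derive1_distP => eps eps0.
have KM0 : 0 < K * (M + 1) by rewrite mulr_gt0// ltr_wpDl.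
pose d1 : R := if t == 0 then 1 else t.
have d10 : 0 < d1.
  by rewrite /d1; case: ifPn => // tn0; rewrite lt_neqAle eq_sym tn0.
exists (Num.min d1 (Num.min (tau - t) (eps / (K * (M + 1))))).
  by rewrite !lt_min d10 subr_gt0 ttau divr_gt0.
move=> t'; rewrite !lt_min => /and3P[td1 ttau' teps].
have ttau2 : t' <= tau by have := ler_norm (t' - t); lra.
have [t'0|t'0] := leP 0 t'.
  have t_ : 0 <= t <= tau by rewrite t0 ltW.
  have t'_ : 0 <= t' <= tau by rewrite t'0.
  rewrite /psi t0 t'0 (le_trans (phitaylor t t' t_ t'_))//.
  by rewrite ler_wpM2r// mulrC -ler_pdivlMr// ltW.
have tE : t = 0.
  move: td1; rewrite /d1; case: ifPn => [/eqP//|_]; rewrite ltr_norml; lra.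
rewrite /psi t0 (leNgt 0 t') t'0/= tE phi0 subr0 [p0 + _]addrC addrK subrr normr0.
by rewrite mulr_ge0// ltW.
Qed.

(** * Local coordinates at the saddle *)

(** Composition with this 1-Lipschitz retraction onto [-q, q] extends data given on a box to bounded
    data on the whole space. *)
Definition clampr (R : realType) (q x : R) : R := Num.max (- q) (Num.min q x).

Lemma maxr_dist (R : realType) (a x y : R) :
  `|Num.max a x - Num.max a y| <= `|x - y|.
Proof.
wlog xy : x y / x <= y.
  by move=> wl; have [/wl//|/ltW/wl] := leP x y; rewrite distrC (distrC y).
rewrite distrC (distrC x) (ger0_norm (_ : 0 <= y - x)) ?subr_ge0//.
rewrite ger0_norm ?subr_ge0 ?le_max2//.
by case: (leP a x) => ax; case: (leP a y) => ay; lra.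
Qed.

Lemma minr_dist (R : realType) (a x y : R) :
  `|Num.min a x - Num.min a y| <= `|x - y|.
Proof.
rewrite -[a]opprK -[in leLHS](opprK x) -[in leLHS](opprK y) -!oppr_max.
by rewrite -opprD normrN (le_trans (maxr_dist _ _ _))// -opprD normrN.
Qed.

Lemma clampr_dist (R : realType) (q x y : R) :
  `|clampr q x - clampr q y| <= `|x - y|.
Proof. exact: le_trans (maxr_dist _ _ _) (minr_dist _ _ _). Qed.

Lemma clampr_norm (R : realType) (q x : R) : 0 <= q -> `|clampr q x| <= q.
Proof.
move=> q0; rewrite ler_norml /clampr le_max lexx/= ge_max ge_min lexx/= andbT.
lra.
Qed.

Lemma clampr_id (R : realType) (q x : R) : `|x| <= q -> clampr q x = x.
Proof.
rewrite ler_norml => /andP[qx xq]; rewrite /clampr (min_idPr xq).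
exact/max_idPr.
Qed.

Definition lipschitz_box (R : realType) (F : R * R -> R * R) (q K : R) : Prop :=
  forall p p' : R * R, `|p| <= q -> `|p'| <= q -> `|F p - F p'| <= K * `|p - p'|.

(** The clamped field is globally Lipschitz, and its solution solves the original equation as long
    as it stays in the box. Local invariance speaks only of given trajectories, so some have to be
    produced. *)
Lemma local_trajectory (R : realType) (F : R * R -> R * R) (rho q K : R)
    (p0 : R * R) :
  0 < K -> q < rho -> lipschitz_box F q K -> `|p0| < q ->
  exists2 t1 : R, 0 < t1 & exists2 phi : R -> R * R, phi 0 = p0 &
    trajectory F (box rho) phi 0 t1.
Proof.
move=> K0 qrho FK p0q.
have q0 : 0 < q := le_lt_trans (normr_ge0 _) p0q.
pose c (p : R * R) : R * R := (clampr q p.1, clampr q p.2).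
have cq p : `|c p| <= q by rewrite prod_norm_le/= !clampr_norm// ltW.
have cid p : `|p| <= q -> c p = p.
  by rewrite prod_norm_le => /andP[p1 p2]; rewrite /c !clampr_id//; case: (p).
have cdist p p' : `|c p - c p'| <= `|p - p'|.
  rewrite prod_norm_le !pairE/=.
  have : `|p - p'| <= `|p - p'| by [].
  rewrite prod_norm_le !pairE => /andP[h1 h2].
  by rewrite (le_trans (clampr_dist _ _ _) h1) (le_trans (clampr_dist _ _ _) h2).
have FcK p p' : `|F (c p) - F (c p')| <= K * `|p - p'|.
  by rewrite (le_trans (FK _ _ (cq _) (cq _)))// ler_wpM2l// ltW.
have FcM p : `|F (c p)| <= `|F 0| + K * q.
  have z : `|0 : R * R| <= q by rewrite normr0 ltW.
  rewrite -[F (c p)](subrK (F 0)) (le_trans (ler_normD _ _))// addrC lerD2l.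
  by rewrite (le_trans (FK _ _ (cq _) z))// subr0 ler_wpM2l// ltW.
have M0 : 0 <= `|F 0| + K * q by rewrite addr_ge0// mulr_ge0// ltW.
have [tau tau0 [phi phi0 phiF]] :=
  @lipschitz_field_trajectory R (F \o c) K _ p0 K0 M0 FcK FcM.
have := phiF 0; rewrite lexx tau0 => /(_ isT)/is_derive1_distP/(_ 1 ltr01)[d d0].
set a := (F \o c) _ => phid.
(* Differentiability at 0 with error 1 gives |phi t - p0| <= (|a| + 1) t for small t, which is at
   most q - |p0| up to time b. *)
pose b := (q - `|p0|) / (`|a| + 1).
have b0 : 0 < b by rewrite divr_gt0 ?subr_gt0// ltr_wpDl.
pose t1 := Num.min (tau / 2) (Num.min (d / 2) b).
have t10 : 0 < t1 by rewrite !lt_min b0 !divr_gt0.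
have inq t : 0 <= t <= t1 -> `|phi t| <= q.
  rewrite !le_min => /andP[t0 /and3P[_ td tb]].
  have := phid t; rewrite subr0 ger0_norm// phi0 mul1r => h.
  have d2 : d / 2 < d by lra.
  have {}h := h (le_lt_trans td d2).
  rewrite -(subrK (t *: a) (phi t)) -(subrK p0 (phi t - t *: a)).
  rewrite (le_trans (ler_normD _ _))// (le_trans (lerD (ler_normD _ _) (lexx _)))//.
  rewrite addrAC in h.
  move: tb; rewrite ler_pdivlMr ?ltr_wpDl// mulrDr mulr1 => tb.
  by rewrite normrZ ger0_norm//; lra.
exists t1 => //; exists phi => // t tt; split.
  by rewrite /box/=; exact: le_lt_trans (inq t tt) qrho.
have := phiF t; case/andP: (tt) => -> tt1; rewrite /= cid ?inq//; apply.
by rewrite (le_lt_trans tt1)// gt_min gtr_pMr// invf_lt1// ltr1n.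
Qed.

Lemma derive_eq0_of_right (R : realType) (k : R -> R) (D t1 : R) :
  0 < t1 -> is_derive 0 (1 : R) (k : R -> R^o) D ->
  (forall t, 0 <= t <= t1 -> k t = 0) -> D = 0.
Proof.
move=> t10 /is_derive1_distP kD k0; apply/eqP; rewrite -normr_le0.
apply/ler_addgt0Pr => e /kD[d d0]; rewrite add0r.
pose t := Num.min t1 (d / 2).
have t0 : 0 < t by rewrite lt_min t10 divr_gt0.
have td : t < d by rewrite gt_min gtr_pMr// invf_lt1// ltr1n orbT.
move=> /(_ t); rewrite subr0 gtr0_norm// => /(_ td).
rewrite !k0 ?lexx ?(ltW t10)//; last by rewrite (ltW t0) ge_min lexx.
rewrite subrr sub0r normrN [X in `|X|]/(t * D) normrM gtr0_norm//.
by rewrite mulrC ler_pM2r.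
Qed.

(** Along the trajectory that starts on the graph, y - s(x) vanishes for t >= 0; its derivative at 0
    is the difference of the two sides. Invariance thus becomes tangency of the field. *)
Lemma invariant_horizontal_graph (R : realType) (F : R * R -> R * R)
    (rho q K : R) (s : R -> R) (x : R) :
  0 < K -> q < rho -> lipschitz_box F q K ->
  locally_invariant F (box rho) [set p | `|p.1| < rho /\ p.2 = s p.1] ->
  `|x| < q -> `|s x| < q -> derivable (s : R -> R^o) x 1 ->
  (F (x, s x)).2 = derive1 s x * (F (x, s x)).1.
Proof.
move=> K0 qrho FK inv xq sxq ds.
have p0q : `|(x, s x)| < q by rewrite [`|_|]prod_normE/= gt_max xq.
have [t1 t10 [phi phi0 phiF]] := local_trajectory K0 qrho FK p0q.
have z : (0 : R) <= 0 <= t1 by rewrite lexx ltW.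
have [_ phi0F] := phiF 0 z.
have dk : is_derive 0 (1 : R) (fun t => (phi t).2 - s (phi t).1 : R^o)
    ((F (x, s x)).2 - derive1 s x * (F (x, s x)).1).
  rewrite -phi0; apply: is_deriveB; first exact: is_derive1_snd.
  apply: is_derive1_comp; last exact: is_derive1_fst.
  by rewrite phi0/= derive1E; apply/derivableP.
apply/eqP; rewrite -subr_eq0; apply/eqP; apply: derive_eq0_of_right t10 dk _.
move=> t tt; have W0 : [set p | `|p.1| < rho /\ p.2 = s p.1] (phi 0).
  by rewrite phi0/=; split => //; exact: lt_trans qrho.
by have [_ ->] := inv phi 0 t1 phiF 0 t z tt W0; rewrite subrr.
Qed.

Lemma invariant_vertical_graph (R : realType) (F : R * R -> R * R)
    (rho q K : R) (h : R -> R) (y : R) :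
  0 < K -> q < rho -> lipschitz_box F q K ->
  locally_invariant F (box rho) [set p | `|p.2| < rho /\ p.1 = h p.2] ->
  `|y| < q -> `|h y| < q -> derivable (h : R -> R^o) y 1 ->
  (F (h y, y)).1 = derive1 h y * (F (h y, y)).2.
Proof.
move=> K0 qrho FK inv yq hyq dh.
have p0q : `|(h y, y)| < q by rewrite [`|_|]prod_normE/= gt_max yq hyq.
have [t1 t10 [phi phi0 phiF]] := local_trajectory K0 qrho FK p0q.
have z : (0 : R) <= 0 <= t1 by rewrite lexx ltW.
have [_ phi0F] := phiF 0 z.
have dk : is_derive 0 (1 : R) (fun t => (phi t).1 - h (phi t).2 : R^o)
    ((F (h y, y)).1 - derive1 h y * (F (h y, y)).2).
  rewrite -phi0; apply: is_deriveB; first exact: is_derive1_fst.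
  apply: is_derive1_comp; last exact: is_derive1_snd.
  by rewrite phi0/= derive1E; apply/derivableP.
apply/eqP; rewrite -subr_eq0; apply/eqP; apply: derive_eq0_of_right t10 dk _.
move=> t tt; have W0 : [set p | `|p.2| < rho /\ p.1 = h p.2] (phi 0).
  by rewrite phi0/=; split => //; exact: lt_trans qrho.
by have [_ ->] := inv phi 0 t1 phiF 0 t z tt W0; rewrite subrr.
Qed.

(** What the local estimates know about the field: on the box of radius [r0] it differs from (-x, 0)
    by a map with Lipschitz constant 1/16 in the sup norm, and both invariant curves have slope at
    most 1/16. The number alpha and the exponent m survive only as the sign in [sm_Qpos]. *)
Record saddle_model (R : realType) (F : R * R -> R * R) (r0 sg : R)
    (s h : R -> R) : Prop := SaddleModel {
  sm_r0 : 0 < r0;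
  sm_sg : sg = 1 \/ sg = - 1;
  sm_F0 : F 0 = 0;
  sm_P : forall x y x' y' D : R, `|x| < r0 -> `|x'| < r0 -> `|y| < r0 ->
    `|y'| < r0 -> `|x - x'| <= D -> `|y - y'| <= D ->
    `|(F (x, y)).1 - (F (x', y')).1 + (x - x')| <= D / 16;
  sm_Q : forall x y x' y' D : R, `|x| < r0 -> `|x'| < r0 -> `|y| < r0 ->
    `|y'| < r0 -> `|x - x'| <= D -> `|y - y'| <= D ->
    `|(F (x, y)).2 - (F (x', y')).2| <= D / 16;
  sm_Qpos : forall y : R, 0 < y < r0 -> 0 < (F (h y, y)).2;
  sm_s0 : s 0 = 0;
  sm_h0 : h 0 = 0;
  sm_ds : forall x : R, `|x| < r0 -> [/\ derivable (s : R -> R^o) x 1,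
    `|derive1 s x| <= 1 / 16 & {for x, continuous (derive1 s)}];
  sm_dh : forall x : R, `|x| < r0 -> [/\ derivable (h : R -> R^o) x 1,
    `|derive1 h x| <= 1 / 16 & {for x, continuous (derive1 h)}];
  sm_s_inv : forall x : R, `|x| < r0 ->
    (F (x, s x)).2 = derive1 s x * (F (x, s x)).1;
  sm_h_inv : forall y : R, `|y| < r0 ->
    (F (h y, y)).1 = derive1 h y * (F (h y, y)).2 }.

Lemma is_derive_derive1 (R : realType) (f : R -> R) (x : R) :
  derivable (f : R -> R^o) x 1 -> is_derive x (1 : R) (f : R -> R^o) (derive1 f x).
Proof. by move=> df; rewrite derive1E; apply/derivableP. Qed.

Lemma lipschitz_of_derive1 (R : realType) (f : R -> R) (c K x x' : R) :
  (forall x : R, `|x| < c -> derivable (f : R -> R^o) x 1 /\ `|derive1 f x| <= K) ->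
  `|x| < c -> `|x'| < c -> `|f x - f x'| <= K * `|x - x'|.
Proof.
move=> df; wlog xx' : x x' / x' < x.
  move=> wl xc xc'; have [xx|xx|->] := ltgtP x x'; last by rewrite !subrr !normr0 mulr0.
    by rewrite distrC (distrC x); apply: wl.
  exact: wl.
move=> xc xc'.
have zc z : x' <= z <= x -> `|z| < c.
  move: xc xc'; rewrite !ltr_norml => /andP[_ xc] /andP[xc' _] /andP[z1 z2].
  by rewrite (lt_le_trans xc' z1) (le_lt_trans z2 xc).
have d1 z : z \in `]x', x[ -> is_derive z (1 : R) (f : R -> R^o) (derive1 f z).
  rewrite in_itv/= => /andP[z1 z2].
  by apply: is_derive_derive1; apply: (df _ _).1; apply: zc; rewrite !ltW.
have c1 : {within `[x', x], continuous f}.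
  apply: derivable_within_continuous => z; rewrite in_itv/= => z_.
  by apply: (df _ _).1; exact: zc.
have [z z_ ->] := MVT xx' d1 c1.
rewrite normrM ler_wpM2r//; apply: (df _ _).2; apply: zc.
by move: z_; rewrite in_itv/= => /andP[z1 z2]; rewrite !ltW.
Qed.

Lemma saddle_model_exists (R : realType) (alpha : R) (m : nat)
    (F : R * R -> R * R) (rho sg : R) (s h : R -> R) :
  0 < alpha -> (2 <= m)%N ->
  leads_with (fun p => (F p).1) 1 0 (- 1) ->
  leads_with (fun p => (F p).2) 0 m alpha ->
  0 < rho -> stable_manifold F rho s -> center_manifold F rho h ->
  sg = 1 \/ sg = - 1 ->
  exists2 r0 : R, r0 < rho & saddle_model F r0 sg s h.
Proof.
move=> alpha0 m2 F1 F2 rho0 [C1s s0 ds0 invs] [C1h h0 dh0 invh] sgE.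
have [r1 r10 [K K0 [F0 lip rem]]] := semihyperbolic_bounds m2 F1 F2.
have small (f : R -> R) : C1_on (f : R -> R^o) (- rho) rho -> derive1 f 0 = 0 ->
    exists2 d : R, 0 < d & forall x : R, `|x| < d -> `|derive1 f x| <= 1 / 16.
  move=> C1f df0; have [|_ cf] := C1f 0; first by rewrite oppr_lt0 rho0.
  have e0 : 0 < 1 / 16 :> R by rewrite divr_gt0.
  move: cf; rewrite /prop_for/continuous_at df0.
  move=> /cvgrPdist_le/(_ _ e0)/nbhs_ballP[d /= d0 dd]; exists d => // x xd.
  by have := dd x; rewrite /ball/= !sub0r !normrN; apply.
have [d1 d10 sd] := small s C1s ds0.
have [d2 d20 hd] := small h C1h dh0.
(* In order: [r0] below rho; the range of the expansion bounds; slopes of s and h at most 1/16; K r0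
   <= 1/16 for the Lipschitz constants; and alpha y^m dominating the remainder K y^(m+1) on the
   center manifold. *)
pose r0 := Num.min (Num.min (rho / 2) r1)
  (Num.min (Num.min d1 d2) (Num.min (1 / 16 / K) (alpha / (2 * K)))).
have r00 : 0 < r0 by rewrite !lt_min d10 d20 r10 !divr_gt0// mulr_gt0.
have : r0 <= r0 by [].
rewrite {2}/r0 !le_min => /andP[/andP[r0rho r0r1] /andP[/andP[r0d1 r0d2]]].
move=> /andP[r0K r0al].
have Kr0 : K * r0 <= 1 / 16 by rewrite mulrC -ler_pdivlMr.
have Kal : K * r0 <= alpha / 2.
  move: r0al; rewrite ler_pdivlMr ?mulr_gt0// => ?; nra.
have rhor0 : r0 < rho by lra.
have inrho (x : R) : `|x| < r0 -> - rho < x < rho.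
  by rewrite -ltr_norml => xr; exact: lt_trans rhor0.
have ds (x : R) : `|x| < r0 -> [/\ derivable (s : R -> R^o) x 1,
    `|derive1 s x| <= 1 / 16 & {for x, continuous (derive1 s)}].
  by move=> xr; have [] := C1s x (inrho x xr); split => //; apply: sd; exact: lt_le_trans r0d1.
have dh (x : R) : `|x| < r0 -> [/\ derivable (h : R -> R^o) x 1,
    `|derive1 h x| <= 1 / 16 & {for x, continuous (derive1 h)}].
  by move=> xr; have [] := C1h x (inrho x xr); split => //; apply: hd; exact: lt_le_trans r0d2.
have lip0 (f : R -> R) (x : R) : f 0 = 0 -> (forall x : R, `|x| < r0 ->
    [/\ derivable (f : R -> R^o) x 1,
    `|derive1 f x| <= 1 / 16 & {for x, continuous (derive1 f)}]) ->
    `|x| < r0 -> `|f x| <= 1 / 16 * `|x|.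
  move=> f0 df xr; rewrite -[f x]subr0 -f0 -[in leRHS](subr0 x).
  apply: lipschitz_of_derive1 xr _; last by rewrite normr0.
  by move=> z /df[].
have lipF (x y x' y' D : R) : `|x| <= r0 -> `|x'| <= r0 -> `|y| <= r0 ->
    `|y'| <= r0 -> `|x - x'| <= D -> `|y - y'| <= D ->
    `|(F (x, y)).1 - (F (x', y')).1 + (x - x')| <= D / 16 /\
    `|(F (x, y)).2 - (F (x', y')).2| <= D / 16.
  move=> xr xr' yr yr' xx yy.
  have [h1 h2] := lip r0 D x y x' y' r0r1 xr xr' yr yr' xx yy.
  have D0 : 0 <= D := le_trans (normr_ge0 _) xx.
  have : K * r0 * D <= D / 16 by nra.
  by move=> KD; split; apply: le_trans KD.
have lbox : lipschitz_box F r0 2.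
  move=> [x y] [x' y']; rewrite !prod_norm_le/= => /andP[xr yr] /andP[xr' yr'].
  have /andP[xx yy] : (`|x - x'| <= `|(x, y) - (x', y')|) && (`|y - y'| <= `|(x, y) - (x', y')|).
    by rewrite -[_ && _](prod_norm_le ((x, y) - (x', y'))).
  have [h1 h2] := lipF _ _ _ _ _ xr xr' yr yr' xx yy.
  set D : R := `|(x, y) - (x', y')|; rewrite -/D in xx yy h1 h2.
  have D0 : 0 <= D by exact: normr_ge0.
  apply/andP; split; last by lra.
  rewrite -[X in `|X|](addrK (x - x')) (le_trans (ler_normB _ _))//; lra.
exists r0 => //; split => //.
- move=> x y x' y' D xr xr' yr yr' xx yy.
  by have [] := lipF x y x' y' D (ltW xr) (ltW xr') (ltW yr) (ltW yr') xx yy.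
- move=> x y x' y' D xr xr' yr yr' xx yy.
  by have [] := lipF x y x' y' D (ltW xr) (ltW xr') (ltW yr) (ltW yr') xx yy.
- move=> y /andP[y0 yr]; have yr' : `|y| < r0 by rewrite gtr0_norm.
  have hy : `|h y| <= y.
    by have := lip0 h y h0 dh yr'; rewrite (gtr0_norm y0) => hy; lra.
  have := rem y (h y) y (le_trans (ltW yr) r0r1) hy.
  rewrite gtr0_norm// lexx => /(_ isT); rewrite ler_distl => /andP[+ _].
  apply: lt_le_trans; rewrite subr_gt0 exprS mulrA ltr_pM2r ?exprn_gt0//.
  nra.
- move=> x xr; apply: (@invariant_horizontal_graph _ F rho r0 2) => //.
    by have := lip0 s x s0 ds xr; lra.
  by have [] := ds x xr.
- move=> y yr; apply: (@invariant_vertical_graph _ F rho r0 2) => //.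
    by have := lip0 h y h0 dh yr; lra.
  by have [] := dh y yr.
Qed.

(** * The coordinates u and v and their rates of change *)

Definition ucoord (R : realType) (s : R -> R) (p : R * R) : R := p.2 - s p.1.

Definition vcoord (R : realType) (sg : R) (h : R -> R) (p : R * R) : R :=
  sg * (p.1 - h p.2).

(** The derivative of [ucoord] at p in the direction w. It is used with w = F p for trajectories and
    with w the velocity of a transversal arc. *)
Definition urate (R : realType) (s : R -> R) (p w : R * R) : R :=
  w.2 - derive1 s p.1 * w.1.

Definition vrate (R : realType) (sg : R) (h : R -> R) (p w : R * R) : R :=
  sg * (w.1 - derive1 h p.2 * w.2).

Lemma norm_pair_lt (R : realType) (p : R * R) (a : R) :
  (`|p| < a) = (`|p.1| < a) && (`|p.2| < a).
Proof. by rewrite [`|p|]prod_normE gt_max. Qed.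

Lemma norm_fst_le (R : realType) (p : R * R) : `|p.1| <= `|p|.
Proof. by rewrite [leRHS]prod_normE le_max lexx. Qed.

Lemma norm_snd_le (R : realType) (p : R * R) : `|p.2| <= `|p|.
Proof. by rewrite [leRHS]prod_normE le_max lexx orbT. Qed.

Section saddle_model_facts.
Context (R : realType) (F : R * R -> R * R) (r0 sg : R) (s h : R -> R).
Hypothesis sm : saddle_model F r0 sg s h.
Local Notation u := (ucoord s).
Local Notation v := (vcoord sg h).

Lemma sg_norm : `|sg| = 1.
Proof. by case: (sm_sg sm) => ->; rewrite ?normrN normr1. Qed.

Lemma sg_sqr x : sg * (sg * x) = x.
Proof. by case: (sm_sg sm) => ->; ring. Qed.

Lemma sg_normM x : `|sg * x| = `|x|.
Proof. by rewrite normrM sg_norm mul1r. Qed.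

Lemma s_lip x x' : `|x| < r0 -> `|x'| < r0 -> `|s x - s x'| <= `|x - x'| / 16.
Proof.
move=> xr xr'; rewrite mulrC -[16^-1]div1r.
by apply: lipschitz_of_derive1 xr xr' => z /(sm_ds sm)[].
Qed.

Lemma h_lip x x' : `|x| < r0 -> `|x'| < r0 -> `|h x - h x'| <= `|x - x'| / 16.
Proof.
move=> xr xr'; rewrite mulrC -[16^-1]div1r.
by apply: lipschitz_of_derive1 xr xr' => z /(sm_dh sm)[].
Qed.

Lemma s_small x : `|x| < r0 -> `|s x| <= `|x| / 16.
Proof.
move=> xr; have := s_lip xr (x' := 0); rewrite normr0 (sm_s0 sm) !subr0.
by apply; exact: sm_r0 sm.
Qed.

Lemma h_small x : `|x| < r0 -> `|h x| <= `|x| / 16.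
Proof.
move=> xr; have := h_lip xr (x' := 0); rewrite normr0 (sm_h0 sm) !subr0.
by apply; exact: sm_r0 sm.
Qed.

(** By tangency the rate vanishes at the point of the stable manifold with the same abscissa, at
    distance |u|. The difference of the fields costs (1/16 + 1/256) |u|. *)
Lemma urate_le p : `|p| < r0 -> `|urate s p (F p)| <= `|u p| / 8.
Proof.
rewrite norm_pair_lt => /andP[xr yr].
have sr : `|s p.1| < r0 by have := s_small xr; have := normr_ge0 p.1; lra.
have [_ ds _] := sm_ds sm xr.
have z : `|p.1 - p.1| <= `|u p| by rewrite subrr normr0.
have uu : `|p.2 - s p.1| <= `|u p| by [].
have h1 := sm_P sm xr xr yr sr z uu; have h2 := sm_Q sm xr xr yr sr z uu.
have inv := sm_s_inv sm xr.
rewrite subrr addr0 -surjective_pairing in h1.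
rewrite -surjective_pairing in h2.
have -> : urate s p (F p) = ((F p).2 - (F (p.1, s p.1)).2) -
    derive1 s p.1 * ((F p).1 - (F (p.1, s p.1)).1) by rewrite inv /urate; ring.
have h3 : `|derive1 s p.1 * ((F p).1 - (F (p.1, s p.1)).1)| <= 1 / 16 * (`|u p| / 16).
  by rewrite normrM; apply: ler_pM.
have := ler_normB ((F p).2 - (F (p.1, s p.1)).2)
    (derive1 s p.1 * ((F p).1 - (F (p.1, s p.1)).1)).
by move: h2 h3; have := normr_ge0 (u p); move=> *; lra.
Qed.

(** The comparison point is now on the center manifold at the same ordinate; the linear part -x of
    the first component accounts for the term -v. *)
Lemma vrate_le p : `|p| < r0 -> `|vrate sg h p (F p) + v p| <= `|v p| / 8.
Proof.
rewrite norm_pair_lt => /andP[xr yr].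
have hr : `|h p.2| < r0 by have := h_small yr; have := normr_ge0 p.2; lra.
have [_ dh _] := sm_dh sm yr.
have vv : `|v p| = `|p.1 - h p.2| by rewrite sg_normM.
have z : `|p.2 - p.2| <= `|v p| by rewrite subrr normr0.
have uu : `|p.1 - h p.2| <= `|v p| by rewrite vv.
have h1 := sm_P sm xr hr yr yr uu z; have h2 := sm_Q sm xr hr yr yr uu z.
have inv := sm_h_inv sm yr.
rewrite -surjective_pairing in h1; rewrite -surjective_pairing in h2.
have -> : vrate sg h p (F p) + v p =
    sg * (((F p).1 - (F (h p.2, p.2)).1 + (p.1 - h p.2)) -
    derive1 h p.2 * ((F p).2 - (F (h p.2, p.2)).2)).
  by rewrite inv /vrate /vcoord; ring.
have h3 : `|derive1 h p.2 * ((F p).2 - (F (h p.2, p.2)).2)| <= 1 / 16 * (`|v p| / 16).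
  by rewrite normrM; apply: ler_pM.
rewrite sg_normM; have := ler_normB ((F p).1 - (F (h p.2, p.2)).1 + (p.1 - h p.2))
    (derive1 h p.2 * ((F p).2 - (F (h p.2, p.2)).2)).
by move: h1 h3; have := normr_ge0 (v p); move=> *; lra.
Qed.

(** For y > 0, compare with the point of the center manifold at the same height, where y' > 0. For y
    <= 0 the condition u > 0 forces |y| <= |x| / 16, hence |x| <= 2 v, and comparison with the
    origin suffices. *)
Lemma yrate_ge p : `|p| < r0 -> 0 < v p -> 0 < u p -> - v p <= (F p).2.
Proof.
rewrite norm_pair_lt => /andP[xr yr] v0 u0.
have hr : `|h p.2| < r0 by have := h_small yr; have := normr_ge0 p.2; lra.
have vv : `|p.1 - h p.2| = v p by rewrite -sg_normM gtr0_norm.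
have [y0|y0] := ltP 0 p.2.
  have z : `|p.2 - p.2| <= v p by rewrite subrr normr0 ltW.
  have uu : `|p.1 - h p.2| <= v p by rewrite vv.
  have h2 := sm_Q sm xr hr yr yr uu z; rewrite -surjective_pairing in h2.
  have q0 : 0 < (F (h p.2, p.2)).2.
    by apply: (sm_Qpos sm); rewrite y0 (le_lt_trans _ yr)// ler_norm.
  move: h2; rewrite ler_distl => /andP[+ _].
  by move: q0 v0; move=> *; lra.
have xs := s_small xr; have yh := h_small yr.
have y1 : `|p.2| <= `|p.1| / 16.
  rewrite ler0_norm//; move: u0 xs; rewrite /ucoord ler_norml => + /andP[+ _].
  by move=> *; lra.
have x1 : `|p.1| <= 2 * v p.
  have := ler_normD (p.1 - h p.2) (h p.2); rewrite subrK vv.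
  by move: y1 yh; move=> *; lra.
have x0 : `|p.1 - 0| <= `|p.1| by rewrite subr0.
have y2 : `|p.2 - 0| <= `|p.1|.
  by rewrite subr0; move: y1; have := normr_ge0 p.1; move=> *; lra.
have z0 : `|0 : R| < r0 by rewrite normr0; exact: sm_r0 sm.
have := sm_Q sm xr z0 yr z0 x0 y2; rewrite -surjective_pairing.
rewrite (_ : (0, 0) = 0)// (sm_F0 sm) subr0 ler_norml => /andP[+ _].
by move: x1 v0; move=> *; lra.
Qed.

Lemma is_derive_ucoord (g : R -> R * R) (t : R) (w : R * R) :
  is_derive t (1 : R) g w -> `|g t| < r0 ->
  is_derive t (1 : R) (fun t => u (g t) : R^o) (urate s (g t) w).
Proof.
move=> dg; rewrite norm_pair_lt => /andP[xr _].
have [ds _ _] := sm_ds sm xr.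
apply: is_deriveB; first exact: is_derive1_snd.
by apply: is_derive1_comp; [exact: is_derive_derive1|exact: is_derive1_fst].
Qed.

Lemma is_derive_vcoord (g : R -> R * R) (t : R) (w : R * R) :
  is_derive t (1 : R) g w -> `|g t| < r0 ->
  is_derive t (1 : R) (fun t => v (g t) : R^o) (vrate sg h (g t) w).
Proof.
move=> dg; rewrite norm_pair_lt => /andP[_ yr].
have [dh _ _] := sm_dh sm yr.
apply: is_deriveZ; apply: is_deriveB; first exact: is_derive1_fst.
by apply: is_derive1_comp; [exact: is_derive_derive1|exact: is_derive1_snd].
Qed.

Lemma coord_bilip p q (a : R) : `|p| < r0 -> `|q| < r0 ->
  `|v p - v q| <= a -> `|u p - u q| <= a ->
  `|p.1 - q.1| <= 2 * a /\ `|p.2 - q.2| <= 2 * a.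
Proof.
rewrite !norm_pair_lt => /andP[xp yp] /andP[xq yq].
rewrite -mulrBr sg_normM => vpq upq.
have hs := s_lip xp xq; have hh := h_lip yp yq.
have h1 : `|p.1 - q.1| <= a + `|p.2 - q.2| / 16.
  have -> : p.1 - q.1 = (p.1 - h p.2 - (q.1 - h q.2)) + (h p.2 - h q.2) by ring.
  by rewrite (le_trans (ler_normD _ _))// lerD.
have h2 : `|p.2 - q.2| <= a + `|p.1 - q.1| / 16.
  have -> : p.2 - q.2 = (u p - u q) + (s p.1 - s q.1) by rewrite /ucoord; ring.
  by rewrite (le_trans (ler_normD _ _))// lerD.
have := normr_ge0 (p.1 - q.1); have := normr_ge0 (p.2 - q.2).
by move: h1 h2; move=> *; split; lra.
Qed.

Lemma ucoord_lip p q : `|p| < r0 -> `|q| < r0 ->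
  `|u p - u q| <= 2 * `|p - q|.
Proof.
rewrite !norm_pair_lt => /andP[xp yp] /andP[xq yq].
have hs := s_lip xp xq.
have h1 := norm_fst_le (p - q); have h2 := norm_snd_le (p - q).
rewrite !pairE in h1 h2.
have -> : u p - u q = (p.2 - q.2) - (s p.1 - s q.1) by rewrite /ucoord; ring.
rewrite (le_trans (ler_normB _ _))//.
by move: (normr_ge0 (p.1 - q.1)) hs h1 h2; move=> *; lra.
Qed.

Lemma field_lip : forall p q, `|p| < r0 -> `|q| < r0 ->
  `|F p - F q| <= 2 * `|p - q|.
Proof.
move=> p q; rewrite !norm_pair_lt => /andP[xp yp] /andP[xq yq].
have h1 := norm_fst_le (p - q); have h2 := norm_snd_le (p - q).
rewrite !pairE in h1 h2.
have := sm_P sm xp xq yp yq h1 h2; have := sm_Q sm xp xq yp yq h1 h2.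
rewrite -!surjective_pairing => q1 q2.
rewrite prod_norm_le !pairE; apply/andP; split; last first.
  by move: (normr_ge0 (p - q)) q1; move=> *; lra.
rewrite -[X in `|X|](addrK (p.1 - q.1)) (le_trans (ler_normB _ _))//.
by move: (normr_ge0 (p - q)) h1 q2; move=> *; lra.
Qed.

End saddle_model_facts.

(** * Covering the passages *)

Lemma ge0_is_derive_le (R : realType) (f df : R -> R) (a b : R) : a <= b ->
  (forall t, a <= t <= b -> is_derive t (1 : R) (f : R -> R^o) (df t)) ->
  (forall t, a <= t <= b -> 0 <= df t) -> f a <= f b.
Proof.
rewrite le_eqVlt => /predU1P[->//|ab] fdf df0.
have d1 z : z \in `]a, b[ -> is_derive z (1 : R) (f : R -> R^o) (df z).
  by rewrite in_itv/= => /andP[z1 z2]; apply: fdf; rewrite !ltW.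
have c1 : {within `[a, b], continuous f}.
  by apply: derivable_within_continuous => z; rewrite in_itv/= => /fdf[].
have [z z_ fE] := MVT ab d1 c1.
rewrite -subr_ge0 fE mulr_ge0 ?subr_ge0 ?(ltW ab)// df0//.
by move: z_; rewrite in_itv/= => /andP[z1 z2]; rewrite !ltW.
Qed.

Lemma pos_of_neq0 (R : realType) (f : R -> R) (a b : R) :
  (forall t, a <= t <= b -> derivable (f : R -> R^o) t 1) ->
  0 < f a -> (forall t, a <= t <= b -> f t <> 0) ->
  forall t, a <= t <= b -> 0 < f t.
Proof.
move=> df fa f0 t /andP[at_ tb]; rewrite ltNge; apply/negP => ft.
have c1 : {within `[a, t], continuous f}.
  apply: derivable_within_continuous => z; rewrite in_itv/= => /andP[z1 z2].
  by apply: df; rewrite z1 (le_trans z2).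
have [|z] := @IVT R f a t 0 at_ c1.
  by rewrite ge_min le_max ft (ltW fa) orbT.
rewrite in_itv/= => /andP[z1 z2] /f0; apply.
by rewrite z1 (le_trans z2).
Qed.

(** Telescoping: 1 = (b - a)(b + a) <= 2 b (b - a) for consecutive square roots a and b. *)
Lemma sum_invsqrt_le (R : realType) (n : nat) :
  \sum_(i < n) (Num.sqrt (i.+1%:R : R))^-1 <= 2 * Num.sqrt n%:R.
Proof.
elim: n => [|n IH]; first by rewrite big_ord0 sqrtr0 mulr0.
rewrite big_ord_recr/=.
pose a : R := Num.sqrt n%:R; pose b : R := Num.sqrt n.+1%:R.
have b0 : 0 < b by rewrite sqrtr_gt0.
have a0 : 0 <= a by rewrite sqrtr_ge0.
have ab : b ^+ 2 = a ^+ 2 + 1 by rewrite !sqr_sqrtr// natr1.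
rewrite (le_trans (lerD IH (lexx _)))// -/a -/b -lerBrDl -mulrBr.
rewrite -[b^-1]mul1r ler_pdivrMr//; nra.
Qed.

Lemma truncn_eq_dist (R : realType) (x y : R) : 0 <= x -> 0 <= y ->
  Num.truncn x = Num.truncn y -> `|x - y| < 1.
Proof.
move=> x0 y0 xy; have /andP[] := truncn_itv x0; have /andP[] := truncn_itv y0.
by rewrite xy -natr1 => *; rewrite ltr_norml; apply/andP; split; lra.
Qed.

Section sector_trajectories.
Context (R : realType) (F : R * R -> R * R) (r0 sg : R) (s h : R -> R).
Hypothesis sm : saddle_model F r0 sg s h.
Local Notation u := (ucoord s).
Local Notation v := (vcoord sg h).

(** Neither coordinate can vanish: local invariance, applied from the time of vanishing back to time
    0, would put the starting point on the invariant curve. *)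
Lemma trajectory_in_sector (rho r T : R) (phi : R -> R * R) :
  r <= r0 -> r0 < rho ->
  locally_invariant F (box rho) [set p | `|p.1| < rho /\ p.2 = s p.1] ->
  locally_invariant F (box rho) [set p | `|p.2| < rho /\ p.1 = h p.2] ->
  trajectory F (box r) phi 0 T -> 0 < u (phi 0) -> 0 < v (phi 0) ->
  forall t, 0 <= t <= T -> 0 < u (phi t) /\ 0 < v (phi t).
Proof.
move=> rr0 r0rho invs invh phiF u0 v0 t tT.
have T0 : 0 <= T by case/andP: tT => t0; exact: le_trans.
have phirho : trajectory F (box rho) phi 0 T.
  move=> t' tT'; have [Bt dphi] := phiF t' tT'; split => //.
  by apply: lt_trans r0rho; exact: lt_le_trans rr0.
have phir0 t' : 0 <= t' <= T -> `|phi t'| < r0.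
  by move=> /phiF[Bt _]; exact: lt_le_trans rr0.
have z : (0 : R) <= 0 <= T by rewrite lexx.
split.
  apply: (@pos_of_neq0 _ (fun t => u (phi t)) 0 T) => // t' tT'.
    have [_ dphi] := phiF t' tT'.
    by have [] := is_derive_ucoord sm dphi (phir0 t' tT').
  move=> /eqP; rewrite subr_eq0 => /eqP ut.
  have := phir0 t' tT'; rewrite norm_pair_lt => /andP[xt yt].
  have [|_ +] := invs phi 0 T phirho t' 0 tT' z.
    by split => //; exact: lt_trans r0rho.
  by move: u0; rewrite /ucoord subr_gt0 => + E; rewrite E ltxx.
apply: (@pos_of_neq0 _ (fun t => v (phi t)) 0 T) => // t' tT'.
  have [_ dphi] := phiF t' tT'.
  by have [] := is_derive_vcoord sm dphi (phir0 t' tT').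
move=> vt; have {}vt : (phi t').1 = h (phi t').2.
  apply/eqP; rewrite -subr_eq0; apply/eqP.
  by rewrite -[LHS](sg_sqr sm) -/(v (phi t')) vt mulr0.
have := phir0 t' tT'; rewrite norm_pair_lt => /andP[xt yt].
have [|_ +] := invh phi 0 T phirho t' 0 tT' z.
  by split => //; exact: lt_trans r0rho.
by move=> E; move: v0; rewrite /vcoord E subrr mulr0 ltxx.
Qed.

Section one_trajectory.
Variables (r T : R) (phi : R -> R * R).
Hypothesis rr0 : r <= r0.
Hypothesis T0 : 0 <= T.
Hypothesis phiF : trajectory F (box r) phi 0 T.
Hypothesis phiS : forall t, 0 <= t <= T -> 0 < u (phi t) /\ 0 < v (phi t).

Let phir0 t : 0 <= t <= T -> `|phi t| < r0.
Proof. by move=> /phiF[Bt _]; exact: lt_le_trans rr0. Qed.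

Let sub a b t : 0 <= a -> b <= T -> a <= t <= b -> 0 <= t <= T.
Proof. by move=> a0 bT /andP[at_ tb]; rewrite (le_trans a0 at_) (le_trans tb). Qed.

Lemma vcoord_decr t t' : 0 <= t -> t <= t' -> t' <= T -> v (phi t') <= v (phi t).
Proof.
move=> t0 tt' t'T; rewrite -lerN2.
apply: (@ge0_is_derive_le _ (fun t => - v (phi t))
  (fun t => - vrate sg h (phi t) (F (phi t)))) => // z /(sub t0 t'T) zT.
  apply: is_deriveN; apply: (is_derive_vcoord sm) (phir0 zT).
  by have [] := phiF zT.
have [uz vz] := phiS zT; have := vrate_le sm (phir0 zT).
rewrite (gtr0_norm vz) ler_norml => /andP[_]; lra.
Qed.

(** The lower bound y' >= -v is outweighed by -4 v' >= 7 v / 2. *)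
Lemma y4v_incr t t' : 0 <= t -> t <= t' -> t' <= T ->
  (phi t).2 - 4 * v (phi t) <= (phi t').2 - 4 * v (phi t').
Proof.
move=> t0 tt' t'T.
apply: (@ge0_is_derive_le _ (fun t => (phi t).2 - 4 * v (phi t))
  (fun t => (F (phi t)).2 - 4 * vrate sg h (phi t) (F (phi t)))) => // z /(sub t0 t'T) zT.
  apply: is_deriveB; first by apply: is_derive1_snd; have [] := phiF zT.
  apply: is_deriveZ; apply: (is_derive_vcoord sm) (phir0 zT).
  by have [] := phiF zT.
have [uz vz] := phiS zT; have := vrate_le sm (phir0 zT).
have := yrate_ge sm (phir0 zT) vz uz.
rewrite (gtr0_norm vz) ler_norml => h1 /andP[_]; lra.
Qed.

Lemma u2v_decr t t' : 0 <= t -> t <= t' -> t' <= T ->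
  u (phi t') ^+ 2 * v (phi t') <= u (phi t) ^+ 2 * v (phi t).
Proof.
move=> t0 tt' t'T; rewrite !expr2 -!mulrA -lerN2.
apply: (@ge0_is_derive_le _ (fun t => - (u (phi t) * (u (phi t) * v (phi t))))
  (fun t => - (u (phi t) * (u (phi t) * vrate sg h (phi t) (F (phi t)) +
    v (phi t) * urate s (phi t) (F (phi t))) +
    u (phi t) * v (phi t) * urate s (phi t) (F (phi t))))) => // z /(sub t0 t'T) zT.
  have [_ dphi] := phiF zT.
  have du := is_derive_ucoord sm dphi (phir0 zT).
  have dv := is_derive_vcoord sm dphi (phir0 zT).
  by apply: is_deriveN; apply: is_deriveM; apply: is_deriveM.
have [uz vz] := phiS zT.
have h1 := vrate_le sm (phir0 zT); have h2 := urate_le sm (phir0 zT).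
move: h1 h2; rewrite (gtr0_norm vz) (gtr0_norm uz) !ler_norml.
set U := u _ in uz *; set V := v _ in vz *.
move: (vrate _ _ _ _) (urate _ _ _) => dV dU /andP[_ h1] /andP[_ h2].
rewrite oppr_ge0.
have -> : U * (U * dV + V * dU) + U * V * dU = U * (U * dV + 2 * (V * dU)) by ring.
rewrite mulr_ge0_le0 ?(ltW uz)//; nra.
Qed.

Lemma covered_trajectory (delta : R) : 0 < delta < 1 ->
  covered (phi @` `[0, T]) (5 * delta) ((22 * r + 1) / delta).
Proof.
move=> /andP[d0 d1].
(* M is the sum of y - 4 v and -v, both nondecreasing along the passage. If M changes by less than
   delta, so does each of them, and then y changes by at most 5 delta. *)
pose M p := p.2 - 5 * v p.
have vle t : 0 <= t <= T -> v (phi t) <= 2 * r.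
  move=> tT; have [Bt _] := phiF tT; have := phir0 tT.
  move: Bt; rewrite /box/= !norm_pair_lt => /andP[x1 y1] /andP[x2 y2].
  rewrite (le_trans (ler_norm _))// (sg_normM sm).
  have := h_small sm y2; have := ler_normB (phi t).1 (h (phi t).2).
  have := normr_ge0 (phi t).1; lra.
(* The shift by 11 r makes the quantity nonnegative, as needed for integer parts. *)
have Mb t : 0 <= t <= T -> 0 <= M (phi t) + 11 * r <= 22 * r.
  move=> tT; have [Bt _] := phiF tT; have [_ vt] := phiS tT.
  move: Bt; rewrite /box/= norm_pair_lt => /andP[_]; rewrite ltr_norml => /andP[y1 y2].
  by have := vle t tT; rewrite /M => *; apply/andP; split; lra.
pose lab p := Num.truncn ((M p + 11 * r) / delta).
have t0T : (0 : R) <= 0 <= T by rewrite lexx.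
have r_ge0 : 0 <= r.
  by have [Bt _] := phiF t0T; apply: le_trans (ltW Bt).
apply: (@coveredW _ _ _ (Num.truncn (22 * r / delta)).+1%:R).
  rewrite -[leLHS]natr1 (mulrDl (22 * r)) mul1r; apply: lerD.
    have q0 : 0 <= 22 * r / delta by rewrite divr_ge0 ?mulr_ge0// ltW.
    by have /andP[] := truncn_itv q0.
  by rewrite -[1]invr1 lef_pV2 ?posrE// ltW.
apply: (@covered_labels _ _ _ _ lab).
  move=> _ [t /= + <-]; rewrite in_itv/= => tT; rewrite ltnS.
  have /andP[M0 M1] := Mb t tT.
  rewrite /lab truncn_le_nat (le_lt_trans _ (truncnS_gt _))//.
  by rewrite ler_wpM2r// invr_ge0 ltW.
suff wl t t' : 0 <= t -> t <= t' -> t' <= T -> lab (phi t) = lab (phi t') ->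
    `|(phi t).1 - (phi t').1| <= 5 * delta /\ `|(phi t).2 - (phi t').2| <= 5 * delta.
  move=> _ _ [t /= + <-] [t' /= + <-]; rewrite !in_itv/=.
  move=> /andP[t_0 tT] /andP[t'0 t'T] labE.
  have [tt'|/ltW t't] := leP t t'; first exact: wl.
  by rewrite distrC (distrC (phi t).2); apply: wl.
move=> t_0 tt' t'T labE.
have tT : 0 <= t <= T by rewrite t_0 (le_trans tt').
have t'T' : 0 <= t' <= T by rewrite (le_trans t_0).
have v1 := vcoord_decr t_0 tt' t'T; have y1 := y4v_incr t_0 tt' t'T.
have MM : `|M (phi t) - M (phi t')| < delta.
  have /andP[M1 _] := Mb t tT; have /andP[M2 _] := Mb t' t'T'.
  have := truncn_eq_dist _ _ labE; rewrite !divr_ge0 ?(ltW d0)// => /(_ isT isT).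
  rewrite -mulrBl normrM normfV (gtr0_norm d0) ltr_pdivrMr// mul1r.
  by rewrite opprD addrACA subrr addr0.
move: MM; rewrite /M ltr_norml => /andP[MM1 MM2].
have yy : `|(phi t).2 - (phi t').2| <= 5 * delta.
  by rewrite ler_norml; apply/andP; split; lra.
split => //.
have := phir0 tT; have := phir0 t'T'; rewrite !norm_pair_lt => /andP[_ yr'] /andP[_ yr].
have hh := h_lip sm yr yr'.
have vv : `|v (phi t) - v (phi t')| <= delta.
  by rewrite ler_norml; apply/andP; split; lra.
move: vv; rewrite -mulrBr (sg_normM sm) => vv.
have -> : (phi t).1 - (phi t').1 = ((phi t).1 - h (phi t).2 -
  ((phi t').1 - h (phi t').2)) + (h (phi t).2 - h (phi t').2) by ring.
by rewrite (le_trans (ler_normD _ _))//; lra.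
Qed.

End one_trajectory.
End sector_trajectories.

Section nucleus.
Context (R : realType) (F : R * R -> R * R) (r0 sg : R) (s h : R -> R).
Hypothesis sm : saddle_model F r0 sg s h.
Local Notation u := (ucoord s).
Local Notation v := (vcoord sg h).

(* On the region below, u <= eta sqrt(2 r / v), which is integrable in v. *)
Lemma covered_nucleus (r eta delta : R) : 0 < r -> r <= r0 -> 0 <= eta ->
  0 < delta < 1 ->
  covered [set p | [/\ `|p| < r, 0 < v p, 0 < u p &
                       u p ^+ 2 * v p <= 2 * r * eta ^+ 2]]
    (5 * delta) (4 * r * (eta / delta ^+ 2) + (4 * r + 2) / delta).
Proof.
move=> rpos rr0 eta0 /andP[d0 d1]; set A := [set p | _].
have r2 : 0 < 2 * r by rewrite mulr_gt0.
pose J := Num.truncn (2 * r / delta).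
have q0 : 0 <= 2 * r / delta by rewrite divr_ge0 ?ltW.
have Jle : J%:R <= 2 * r / delta by have /andP[] := truncn_itv q0.
have vu2 p : A p -> v p < 2 * r /\ u p < 2 * r.
  case=> pr _ _ _; have pr0 : `|p| < r0 := lt_le_trans pr rr0.
  move: pr pr0; rewrite !norm_pair_lt => /andP[x1 y1] /andP[x2 y2].
  have hh := h_small sm y2; have ss := s_small sm x2.
  have n1 := normr_ge0 p.1; have n2 := normr_ge0 p.2; split.
    rewrite (le_lt_trans (ler_norm _))// (sg_normM sm).
    have := ler_normB p.1 (h p.2); lra.
  have := ler_norm p.2; have := ler_norm (- s p.1); rewrite normrN /ucoord; lra.
(* Column j collects the points with j delta <= v < (j + 1) delta, where u <= eta sqrt(2 r / (j
   delta)). In column 0 this bound is infinite and is replaced by the size of the box. *)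
pose U j := if j is j'.+1 then eta * Num.sqrt (2 * r / delta) * (Num.sqrt (j'.+1%:R : R))^-1
            else 2 * r.
have U0 j : 0 <= U j.
  case: j => [|j]; first exact: ltW.
  by rewrite /U !mulr_ge0// ?invr_ge0 sqrtr_ge0.
pose col j := A `&` [set p | Num.truncn (v p / delta) = j].
have colcov j : covered (col j) (5 * delta) (U j / delta + 1).
  have q1 : 0 <= U j / delta by rewrite divr_ge0// ltW.
  apply: (@coveredW _ _ _ (Num.truncn (U j / delta)).+1%:R).
    by rewrite -[leLHS]natr1 lerD2r; have /andP[] := truncn_itv q1.
  apply: (@covered_labels _ _ _ _ (fun p => Num.truncn (u p / delta))).
    move=> p [Ap pj]; rewrite ltnS truncn_le_nat.
    apply: le_lt_trans (truncnS_gt _); rewrite ler_wpM2r ?invr_ge0 ?(ltW d0)//.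
    have [_ up2] := vu2 p Ap; case: Ap => _ vp up uv.
    case: j pj q1 => [|j] pj _; rewrite /U; first exact: ltW.
    have vj : j.+1%:R * delta <= v p.
      rewrite -ler_pdivlMr// -pj.
      have q3 : 0 <= v p / delta by rewrite divr_ge0 ?ltW.
      by have /andP[] := truncn_itv q3.
    have j0 : 0 < (j.+1%:R : R) by [].
    rewrite -(@ler_pXn2r _ 2)// ?nnegrE ?(ltW up)//; last first.
      by rewrite !mulr_ge0// ?invr_ge0 sqrtr_ge0.
    rewrite !exprMn exprVn !sqr_sqrtr//.
    rewrite ler_pdivlMr// mulrA ler_pdivlMr// -mulrA [eta ^+ 2 * _]mulrC.
    apply: le_trans uv; rewrite ler_wpM2l ?sqr_ge0//.
  move=> p q [Ap pj] [Aq qj] pq.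
  case: Ap => pr vp up _; case: Aq => qr vq uq _.
  have dist (a b : R) : 0 < a -> 0 < b ->
      Num.truncn (a / delta) = Num.truncn (b / delta) -> `|a - b| <= delta.
    move=> a0 b0 /truncn_eq_dist; rewrite !divr_ge0 ?(ltW a0) ?(ltW b0) ?(ltW d0)// => /(_ isT isT).
    by rewrite -mulrBl normrM normfV (gtr0_norm d0) ltr_pdivrMr// mul1r => /ltW.
  have [h1 h2] := coord_bilip sm (lt_le_trans pr rr0) (lt_le_trans qr rr0)
    (dist _ _ vp vq (etrans pj (esym qj))) (dist _ _ up uq pq).
  by split; lra.
apply: (@covered_sub _ _ (\bigcup_(j < J.+1) col j)).
  move=> p Ap; exists (Num.truncn (v p / delta)) => //=.
  have [vp2 _] := vu2 p Ap; rewrite ltnS /J.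
  rewrite truncn_le_nat (le_lt_trans _ (truncnS_gt _))//.
  by rewrite ler_wpM2r ?invr_ge0 ?ltW.
have cov := @covered_bigcup R J.+1 col (5 * delta) (fun j => U j / delta + 1)
  (fun j _ => colcov j).
apply: coveredW cov.
rewrite big_split/= sumr_const card_ord -mulr_suml big_ord_recl/=.
rewrite -mulr_sumr.
have sum := sum_invsqrt_le R J.
(* There are about J = 2 r / delta columns, so the sum of the inverse square roots, of order sqrt J,
   combines with sqrt(2 r / delta) to a multiple of r / delta. *)
have sqJ : Num.sqrt (2 * r / delta) * Num.sqrt J%:R <= 2 * r / delta.
  rewrite -[leRHS](@sqr_sqrtr _ (2 * r / delta))// expr2.
  by rewrite ler_wpM2l ?sqrtr_ge0// ler_sqrt.
set X := Num.sqrt (2 * r / delta) in sqJ *.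
have X0 : 0 <= X by exact: sqrtr_ge0.
set S := \sum_(i < J) _ in sum *.
have XS : X * S <= 2 * (2 * r / delta) by nra.
have h1 : eta * X * S <= eta * (2 * (2 * r / delta)) by rewrite -mulrA ler_wpM2l.
have d1' : 1 <= delta^-1 by rewrite -[1]invr1 lef_pV2 ?posrE// ltW.
have h2 : (2 * r + eta * X * S) / delta <=
    (2 * r + eta * (2 * (2 * r / delta))) / delta.
  by rewrite ler_wpM2r ?invr_ge0 ?(ltW d0)// lerD2l.
rewrite (le_trans (lerD h2 (lexx _)))//.
have -> : (2 * r + eta * (2 * (2 * r / delta))) / delta + J.+1%:R =
   4 * r * (eta / delta ^+ 2) + (2 * r / delta + J.+1%:R).
  by field; rewrite gt_eqF.
rewrite lerD2l -natr1.
have -> : (4 * r + 2) / delta = 2 * r / delta + 2 * r / delta + 2 * delta^-1.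
  by field; rewrite gt_eqF.
by rewrite -addrA lerD2l; lra.
Qed.

End nucleus.

(** * Separation of trajectories near the entry transversal *)

(** For vector values there is no intermediate point; the bound comes from the local estimate with K
    + e', with e' arbitrarily small. *)
Lemma mean_value_norm (R : realType) (V : normedModType R) (f df : R -> V)
    (a b K : R) :
  (forall t : R, a <= t <= b -> is_derive t (1 : R) f (df t)) ->
  (forall t : R, a <= t <= b -> `|df t| <= K) ->
  forall t : R, a <= t <= b -> `|f t - f a| <= K * (t - a).
Proof.
move=> fdf dfK t tab; apply/ler_addgt0Pr => e e0.
have ta : 0 <= t - a by rewrite subr_ge0; case/andP: tab.
pose e' := e / (t - a + 1); have e'0 : 0 < e' by rewrite divr_gt0// ltr_wpDl.
have := @local_lipschitz_segment R V f a b (K + e').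
move=> /(_ _ t tab) h; apply: le_trans (h _) _.
  move=> z zab; have /is_derive1_distP/(_ _ e'0)[d d0 hd] := fdf z zab.
  exists d => // z' _ zd; have := hd z' zd => {}hd.
  rewrite -(subrK ((z' - z) *: df z) (f z' - f z)).
  rewrite (le_trans (ler_normD _ _))// addrC mulrDl lerD//.
  by rewrite normrZ mulrC ler_wpM2r// dfK.
rewrite mulrDl lerD2l /e' mulrAC ler_pdivrMr ?ltr_wpDl//.
by rewrite ler_wpM2l ?(ltW e0)// lerDl.
Qed.

(** Cramer's rule: the determinant times a is the determinant of w and q, and the determinant times
    b is that of p and w. *)
Lemma pair_norm_det (R : realType) (p q w : R * R) (a b : R) :
  w = a *: p + b *: q ->
  (`|a| + `|b|) * `|p.1 * q.2 - p.2 * q.1| <= 2 * (`|p| + `|q|) * `|w|.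
Proof.
move=> wE; have w1 := norm_fst_le w; have w2 := norm_snd_le w.
have p1 := norm_fst_le p; have p2 := norm_snd_le p.
have q1 := norm_fst_le q; have q2 := norm_snd_le q.
have detle (x y z t X Y : R) : `|x| <= X -> `|y| <= X -> `|z| <= Y -> `|t| <= Y ->
    `|x * t - y * z| <= 2 * (X * Y).
  move=> hx hy hz ht; rewrite (le_trans (ler_normB _ _))// !normrM.
  have h1 : `|x| * `|t| <= X * Y by apply: ler_pM.
  have h2 : `|y| * `|z| <= X * Y by apply: ler_pM.
  lra.
have ha : `|a| * `|p.1 * q.2 - p.2 * q.1| <= 2 * (`|w| * `|q|).
  rewrite -normrM (_ : a * _ = w.1 * q.2 - w.2 * q.1); first exact: detle.
  by rewrite wE !pairE; ring.
have hb : `|b| * `|p.1 * q.2 - p.2 * q.1| <= 2 * (`|p| * `|w|).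
  rewrite -normrM (_ : b * _ = p.1 * w.2 - p.2 * w.1); first exact: detle.
  by rewrite wE !pairE; ring.
by rewrite mulrDl; lra.
Qed.

Lemma C1_strict_derivative (R : realType) (V : normedModType R) (g : R -> V)
    (a b c e : R) : C1_on g a b -> a < c < b -> 0 < e ->
  exists2 d : R, 0 < d & forall x y : R, `|x - c| < d -> `|y - c| < d ->
    a < x < b /\ `|g x - g y - (x - y) *: derive1 g c| <= e * `|x - y|.
Proof.
move=> gC1 cab e0; have [_ cg] := gC1 c cab.
have [d1 /= d10 hd] : exists2 d : R, 0 < d & forall x, `|x - c| < d ->
    `|derive1 g x - derive1 g c| <= e.
  move: cg => /cvgrPdist_le/(_ _ e0)/nbhs_ballP[d /= d0 hd].
  by exists d => // x xd; rewrite distrC; apply: hd; rewrite /ball/= distrC.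
pose d := Num.min d1 (Num.min (c - a) (b - c)).
have d0 : 0 < d by rewrite !lt_min d10 !subr_gt0.
have inab x : `|x - c| < d -> a < x < b /\ `|x - c| < d1.
  rewrite !lt_min => /and3P[-> xa xb]; split => //.
  move: xa xb; rewrite !ltr_norml => /andP[? _] /andP[_ ?].
  by apply/andP; split; lra.
exists d => //.
have key x y : y <= x -> `|x - c| < d -> `|y - c| < d ->
    `|g x - g y - (x - y) *: derive1 g c| <= e * `|x - y|.
  move=> yx xd yd.
  have zd z : y <= z <= x -> `|z - c| < d.
    move: xd yd; rewrite !ltr_norml => /andP[_ ?] /andP[? _] /andP[? ?].
    by apply/andP; split; lra.
  have := @mean_value_norm R V (fun t => g t - t *: derive1 g c)
    (fun t => derive1 g t - derive1 g c) y x e.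
  move=> /(_ _ _ x); rewrite yx lexx => /(_ _ _ isT).
  rewrite (_ : g x - x *: derive1 g c - (g y - y *: derive1 g c) =
    g x - g y - (x - y) *: derive1 g c); last first.
    by rewrite scalerBl !opprD !opprK addrACA.
  rewrite ger0_norm ?subr_ge0//; apply => z zxy.
    have [zab _] := inab z (zd z zxy); apply: is_deriveB.
      by rewrite derive1E; apply/derivableP; apply: (gC1 z zab).1.
    apply/is_derive1_distP => e' e'0; exists 1 => // t' _.
    by rewrite -scalerBl subrr normr0 mulr_ge0// ltW.
  by apply: hd; have [] := inab z (zd z zxy).
move=> x y xd yd; split; first by have [] := inab x xd.
have [yx|/ltW xy] := leP y x; first exact: key.
rewrite (distrC x) (_ : g x - g y - (x - y) *: derive1 g c =
  - (g y - g x - (y - x) *: derive1 g c)); first by rewrite normrN; exact: key.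
by rewrite !scalerBl !opprD !opprK; congr (_ + _); exact: addrC.
Qed.

Section separation.
Context (R : realType) (F : R * R -> R * R) (r0 sg : R) (s h : R -> R).
Hypothesis sm : saddle_model F r0 sg s h.

(** Up to a small multiple of |y_n - y_m| + |t - t'|, the difference phi_n(t) - phi_m(t') is (y_n -
    y_m) G + (t - t') Fc. Transversality makes G and Fc linearly independent, which bounds this
    combination from below. *)
Lemma transversal_flow_separation (r a b c tau1 : R) (g : R -> R * R)
    (y T : nat -> R) (phi : nat -> R -> R * R) (n1 : nat) :
  r <= r0 -> Defs.transversal F (box r) g a b -> a < c < b -> y @ \oo --> c ->
  (forall n, trajectory F (box r) (phi n) 0 (T n)) ->
  (forall n, phi n 0 = g (y n)) ->
  0 < tau1 -> (forall n, (n1 <= n)%N -> tau1 <= T n) ->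
  exists (n0 : nat) (tau k : R), [/\ 0 < tau, 0 < k,
    (forall n, (n0 <= n)%N -> tau <= T n) &
    forall n m (t t' e : R), (n0 <= n)%N -> (n0 <= m)%N ->
      0 <= t <= tau -> 0 <= t' <= tau ->
      `|(phi n t).1 - (phi m t').1| < e -> `|(phi n t).2 - (phi m t').2| < e ->
      `|t - t'| < k * e /\ `|y n - y m| < k * e].
Proof.
move=> rr0 [gC1 gF] cab y_cvg phiF phi0 tau10 tauT.
have [Bc det] := gF c cab.
pose G := derive1 g c; pose Fc := F (g c).
pose D := `|G.1 * Fc.2 - G.2 * Fc.1|.
have D0 : 0 < D by rewrite normr_gt0.
pose N := 2 * (`|G| + `|Fc|) + 1.
have N0 : 0 < N by rewrite ltr_wpDl// mulr_ge0// addr_ge0.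
pose c0 := D / N; have c00 : 0 < c0 by rewrite divr_gt0.
have lin (A B : R) : c0 * (`|A| + `|B|) <= `|A *: G + B *: Fc|.
  have := pair_norm_det (erefl (A *: G + B *: Fc)); rewrite -/D.
  set W := `|_ *: _ + _|; have W0 : 0 <= W by exact: normr_ge0.
  move=> hdet; rewrite /c0 mulrAC ler_pdivrMr// [D * _]mulrC (le_trans hdet)//.
  by rewrite /N [W * _]mulrC ler_wpM2r//; lra.
(* The total error will be at most 2 e (|A| + |B|), a quarter of the lower bound c0 (|A| + |B|). *)
pose e := c0 / 8; have e0 : 0 < e by rewrite divr_gt0.
have [d d0 gd] := C1_strict_derivative gC1 cab e0.
have glip (x z : R) : `|x - c| < d -> `|z - c| < d ->
    `|g x - g z| <= (`|G| + e) * `|x - z|.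
  move=> xd zd; have [_ h1] := gd x z xd zd.
  rewrite -(subrK ((x - z) *: G) (g x - g z)) (le_trans (ler_normD _ _))//.
  by rewrite addrC mulrDl lerD// normrZ mulrC.
have G0 : 0 < `|G| + e by rewrite ltr_wpDl.
pose eta := Num.min d (e / (8 * (`|G| + e))).
have eta0 : 0 < eta by rewrite lt_min d0 divr_gt0// mulr_gt0.
have /cvgrPdist_lt/(_ _ eta0)[n2 _ yn2] := y_cvg.
(* The bound 1/8 absorbs the growth of the distance between two passages, the next keeps the field
   close to Fc, and the last makes their relative drift at most e |A|. *)
pose tau := Num.min tau1 (Num.min (1 / 8)
  (Num.min (e / (16 * (r0 + 1))) (e / (8 * (`|G| + e))))).
have r00 := sm_r0 sm.
have tau0 : 0 < tau.
  by rewrite !lt_min tau10 !divr_gt0// ?mulr_gt0//; lra.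
have : tau <= tau by [].
rewrite {2}/tau !le_min => /and4P[tautau1 tau8 taur taue].
exists (maxn n1 n2), tau, (2 / c0); split => //.
- by rewrite divr_gt0.
- by move=> n; rewrite geq_max => /andP[/tauT + _]; apply: le_trans.
have phir0 n t : (maxn n1 n2 <= n)%N -> 0 <= t <= tau ->
    `|phi n t| < r0 /\ is_derive t (1 : R) (phi n) (F (phi n t)).
  rewrite geq_max => /andP[/tauT Tn _] /andP[t0 tt].
  have [|Bt dphi] := phiF n t; first by rewrite t0 (le_trans tt (le_trans tautau1 Tn)).
  by split => //; exact: lt_le_trans rr0.
have FM p : `|p| < r0 -> `|F p| <= 2 * r0.
  move=> pr; have z : `|0 : R * R| < r0 by rewrite normr0.
  have := field_lip sm pr z; rewrite (sm_F0 sm) !subr0 => /le_trans; apply.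
  by rewrite ler_wpM2l// ltW.
have yd n : (maxn n1 n2 <= n)%N -> `|y n - c| < eta.
  by rewrite geq_max => /andP[_ /yn2]; rewrite distrC.
have etad : eta <= d by rewrite ge_min lexx.
have Bc0 : `|g c| < r0 := lt_le_trans Bc rr0.
have Fnear n t : (maxn n1 n2 <= n)%N -> 0 <= t <= tau ->
    `|F (phi n t) - Fc| <= e.
  move=> nn tt; have [pr _] := phir0 n t nn tt.
  apply: (le_trans (field_lip sm pr Bc0)).
  have h1 : `|phi n t - phi n 0| <= 2 * r0 * (t - 0).
    apply: (@mean_value_norm _ _ (phi n) (fun t => F (phi n t)) 0 tau) => //.
      by move=> z zt; have [] := phir0 n z nn zt.
    by move=> z zt; apply: FM; have [] := phir0 n z nn zt.
  have cc : `|c - c| < d by rewrite subrr normr0.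
  have h2 := glip _ _ (lt_le_trans (yd n nn) etad) cc.
  rewrite -phi0 in h2.
  have h3 : (`|G| + e) * `|y n - c| <= e / 8.
    have : `|y n - c| <= e / (8 * (`|G| + e)).
      by rewrite (le_trans (ltW (yd n nn)))// ge_min lexx orbT.
    rewrite ler_pdivlMr ?mulr_gt0// => ?; lra.
  have h4 : 2 * r0 * (t - 0) <= e / 8.
    move: taur; rewrite ler_pdivlMr ?mulr_gt0 ?addr_gt0// => taur.
    case/andP: tt => t0 tt; rewrite subr0.
    have : t * r0 <= tau * r0 by rewrite ler_wpM2r// ltW.
    nra.
  have := ler_distD (phi n 0) (phi n t) (g c); lra.
move=> n m t t' e' nn mm tt tt' h1 h2.
pose A := y n - y m; pose B := t - t'.
have AG : `|phi n 0 - phi m 0 - A *: G| <= e * `|A|.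
  by rewrite !phi0; apply: (gd _ _ _ _).2; apply: lt_le_trans etad; exact: yd.
have A0 : `|phi n 0 - phi m 0| <= (`|G| + e) * `|A|.
  by rewrite !phi0; apply: glip; apply: lt_le_trans etad; exact: yd.
have BF : `|phi m t - phi m t' - B *: Fc| <= e * `|B|.
  have aux a' b' : 0 <= a' -> a' <= b' -> b' <= tau ->
      `|phi m b' - phi m a' - (b' - a') *: Fc| <= e * (b' - a').
    move=> a'0 ab' b't.
    have := @mean_value_norm R _ (fun t => phi m t - t *: Fc)
      (fun t => F (phi m t) - Fc) a' b' e.
    move=> /(_ _ _ b'); rewrite ab' lexx => /(_ _ _ isT).
    rewrite (_ : phi m b' - b' *: Fc - (phi m a' - a' *: Fc) =
      phi m b' - phi m a' - (b' - a') *: Fc); last first.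
      by apply: pair_ext; rewrite !pairE; ring.
    apply => z /andP[z1 z2].
      have zt : 0 <= z <= tau by rewrite (le_trans a'0 z1) (le_trans z2).
      apply: is_deriveB; first by have [] := phir0 m z mm zt.
      apply/is_derive1_distP => e1 e10; exists 1 => // t1 _.
      by rewrite -scalerBl subrr normr0 mulr_ge0// ltW.
    by apply: Fnear => //; rewrite (le_trans a'0 z1) (le_trans z2).
  case/andP: tt tt' => t0 tt /andP[t'0 tt'].
  have [t't|/ltW tt1] := leP t' t.
    by rewrite /B [in leRHS]ger0_norm ?subr_ge0//; exact: aux.
  have -> : phi m t - phi m t' - B *: Fc = - (phi m t' - phi m t - (t' - t) *: Fc).
    by rewrite /B; apply: pair_ext; rewrite !pairE; ring.
  rewrite normrN /B (_ : `|t - t'| = t' - t); first exact: aux.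
  by rewrite distrC ger0_norm ?subr_ge0.
have dphi z : 0 <= z <= tau -> is_derive z (1 : R) (fun t => phi n t - phi m t)
    (F (phi n z) - F (phi m z)).
  by move=> zt; apply: is_deriveB; [have [] := phir0 n z nn zt|have [] := phir0 m z mm zt].
(* In place of an exponential bound: S <= |phi n 0 - phi m 0| + 2 S tau, where tau <= 1/8 allows S
   to be absorbed. *)
pose S := sup [set `|phi n z - phi m z| | z in [set z | 0 <= z <= tau]].
have supS : has_sup [set `|phi n z - phi m z| | z in [set z | 0 <= z <= tau]].
  split; first by exists `|phi n t - phi m t|, t.
  exists (r0 + r0) => _ [z zt <-]; rewrite (le_trans (ler_normB _ _))// lerD//.
    by have [/ltW] := phir0 n z nn zt.
  by have [/ltW] := phir0 m z mm zt.
have zS z : 0 <= z <= tau -> `|phi n z - phi m z| <= S.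
  by move=> zt; apply: ub_le_sup; [exact: supS.2|exists z].
have S0 : 0 <= S := le_trans (normr_ge0 _) (zS t tt).
have drift z : 0 <= z <= tau ->
    `|phi n z - phi m z - (phi n 0 - phi m 0)| <= 2 * S * tau.
  move=> zt; have := @mean_value_norm R _ (fun t => phi n t - phi m t)
      (fun z => F (phi n z) - F (phi m z)) 0 tau (2 * S) dphi.
  move=> /(_ _ z zt) h3; apply: le_trans (h3 _) _; last first.
    by rewrite subr0 ler_wpM2l ?mulr_ge0//; case/andP: zt.
  move=> z' zt'; have [pn _] := phir0 n z' nn zt'; have [pm _] := phir0 m z' mm zt'.
  by rewrite (le_trans (field_lip sm pn pm))// ler_wpM2l// zS.
have SA : S <= 2 * `|phi n 0 - phi m 0|.
  have : S <= `|phi n 0 - phi m 0| + 2 * S * tau.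
    apply: ge_sup; first exact: supS.1.
    move=> _ [z zt <-]; have := drift z zt.
    have := ler_normD (phi n z - phi m z - (phi n 0 - phi m 0)) (phi n 0 - phi m 0).
    rewrite subrK; lra.
  nra.
have drift_small : `|phi n t - phi m t - (phi n 0 - phi m 0)| <= e * `|A|.
  apply: (le_trans (drift t tt)).
  move: taue; rewrite ler_pdivlMr ?mulr_gt0// => taue.
  have : 2 * S * tau <= 4 * ((`|G| + e) * `|A|) * tau.
    by rewrite ler_wpM2r ?(ltW tau0)//; lra.
  have : (tau * (8 * (`|G| + e))) * `|A| <= e * `|A| by rewrite ler_wpM2r.
  have : 0 <= e * `|A| by rewrite mulr_ge0// ltW.
  lra.
have total : `|phi n t - phi m t' - (A *: G + B *: Fc)| <= 2 * e * `|A| + e * `|B|.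
  have -> : phi n t - phi m t' - (A *: G + B *: Fc) =
    (phi n t - phi m t - (phi n 0 - phi m 0)) + (phi n 0 - phi m 0 - A *: G) +
    (phi m t - phi m t' - B *: Fc) by apply: pair_ext; rewrite !pairE; ring.
  apply: (le_trans (ler_normD _ _)); apply: (le_trans (lerD (ler_normD _ _) (lexx _))).
  lra.
have small : `|phi n t - phi m t'| < e' by rewrite norm_pair_lt !pairE h1.
have := lin A B.
have := ler_normB (phi n t - phi m t') (phi n t - phi m t' - (A *: G + B *: Fc)).
rewrite opprB addrC subrK => l1 l2.
have nA := normr_ge0 A; have nB := normr_ge0 B.
have fin : c0 * (`|A| + `|B|) < 2 * e'.
  have : e = c0 / 8 by []. nra.
have k1 : forall X : R, c0 * X < 2 * e' -> X < 2 / c0 * e'.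
  by move=> X hX; rewrite [2 / c0 * _]mulrAC ltr_pdivlMr// mulrC.
split; apply: k1; apply: le_lt_trans fin; by rewrite ler_wpM2l ?(ltW c00)// ?lerDl ?lerDr.
Qed.

End separation.

(** * Barriers for the exit transversal *)

Definition lip_at (R : realType) (a b : R) (f : R -> R) (t : R) : Prop :=
  exists C d : R, [/\ 0 <= C, 0 < d & forall t' : R, a <= t' <= b ->
    `|t' - t| < d -> `|f t' - f t| <= C * `|t' - t|].

(** A derivative known only up to the fixed slope error [e], as for an Euler polygon at a corner. *)
Definition approx_derive (R : realType) (a b e : R) (f : R -> R) (t m : R) :
    Prop :=
  exists2 d : R, 0 < d & forall t' : R, a <= t' <= b -> `|t' - t| < d ->
    `|f t' - f t - (t' - t) * m| <= e * `|t' - t|.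

Lemma lip_at_near (R : realType) (a b : R) (f : R -> R) (t e : R) :
  lip_at a b f t -> 0 < e -> exists2 d : R, 0 < d &
    forall t' : R, a <= t' <= b -> `|t' - t| < d -> `|f t' - f t| < e.
Proof.
move=> [C [d [C0 d0 fC]]] e0; have C1 : 0 < C + 1 by rewrite ltr_wpDl.
exists (Num.min d (e / (C + 1))) => [|t' tab].
  by rewrite lt_min d0 divr_gt0.
rewrite lt_min => /andP[td te]; apply: (le_lt_trans (fC t' tab td)).
rewrite ltr_pdivlMr// in te; rewrite (le_lt_trans _ te)//.
by rewrite mulrC ler_wpM2l// lerDl.
Qed.

Lemma approx_derive_lip (R : realType) (a b e : R) (f : R -> R) (t m : R) :
  0 <= e -> approx_derive a b e f t m -> lip_at a b f t.
Proof.
move=> e0 [d d0 fd]; exists (`|m| + e), d; split => //; first by rewrite addr_ge0.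
move=> t' tab td; rewrite -(subrK ((t' - t) * m) (f t' - f t)).
rewrite (le_trans (ler_normD _ _))// [leLHS]addrC [leRHS]mulrDl lerD//.
  by rewrite normrM mulrC.
exact: fd.
Qed.

Lemma approx_derive_of_derive (R : realType) (a b e : R) (f : R -> R) (t m : R) :
  0 < e -> is_derive t (1 : R) (f : R -> R^o) m -> approx_derive a b e f t m.
Proof.
by move=> e0 /is_derive1_distP/(_ _ e0)[d d0 fd]; exists d => // t' _; exact: fd.
Qed.

Lemma approx_deriveD (R : realType) (a b e1 e2 : R) (f g : R -> R) (t m n : R) :
  approx_derive a b e1 f t m -> approx_derive a b e2 g t n ->
  approx_derive a b (e1 + e2) (fun t => f t + g t) t (m + n).
Proof.
move=> [d1 d10 fd] [d2 d20 gd]; exists (Num.min d1 d2); first by rewrite lt_min d10.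
move=> t' tab; rewrite lt_min => /andP[/(fd t' tab) h1 /(gd t' tab) h2].
rewrite (_ : _ - _ - _ = (f t' - f t - (t' - t) * m) + (g t' - g t - (t' - t) * n)).
  by rewrite (le_trans (ler_normD _ _))// [leRHS]mulrDl lerD.
ring.
Qed.

Lemma approx_deriveN (R : realType) (a b e : R) (f : R -> R) (t m : R) :
  approx_derive a b e f t m -> approx_derive a b e (fun t => - f t) t (- m).
Proof.
move=> [d d0 fd]; exists d => // t' tab td.
by rewrite (_ : _ - _ - _ = - (f t' - f t - (t' - t) * m)) ?normrN ?fd//; ring.
Qed.

(** The slope of g scales the error of f down to e / 16, and the nonlinearity of g costs at most e /
    2, so the total is again at most e. *)
Lemma approx_derive_comp_small (R : realType) (a b e : R) (f g : R -> R)
    (t m n : R) : 0 < e -> `|n| <= 1 / 16 ->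
  approx_derive a b e f t m -> is_derive (f t) (1 : R) (g : R -> R^o) n ->
  approx_derive a b e (fun t => g (f t)) t (n * m).
Proof.
move=> e0 n16 fm; have e00 := ltW e0.
have [C [d1 [C0 d10 fC]]] := approx_derive_lip e00 fm.
case: fm => d2 d20 fm.
have C1 : 0 < C + 1 by rewrite ltr_wpDl.
pose e' := e / (2 * (C + 1)); have e'0 : 0 < e' by rewrite divr_gt0// mulr_gt0.
move=> /is_derive1_distP/(_ _ e'0)[d3 d30 gd].
exists (Num.min (Num.min d1 d2) (d3 / (C + 1))).
  by rewrite !lt_min d10 d20 divr_gt0.
move=> t' tab; rewrite !lt_min => /andP[/andP[td1 td2] td3].
have h1 := fC t' tab td1; have h2 := fm t' tab td2.
have h3 : `|f t' - f t| < d3.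
  rewrite ltr_pdivlMr// in td3; apply: le_lt_trans td3.
  by rewrite (le_trans h1)// mulrC ler_wpM2l// lerDl.
have {}h3 := gd _ h3.
rewrite (_ : _ - _ - _ = (g (f t') - g (f t) - (f t' - f t) * n) +
  n * (f t' - f t - (t' - t) * m)); last by ring.
rewrite (le_trans (ler_normD _ _))//.
have h4 : `|n * (f t' - f t - (t' - t) * m)| <= 1 / 16 * (e * `|t' - t|).
  by rewrite normrM; apply: ler_pM.
have h5 : e' * `|f t' - f t| <= e / 2 * `|t' - t|.
  rewrite (le_trans (ler_wpM2l (ltW e'0) h1))// mulrA ler_wpM2r//.
  rewrite /e' mulrAC ler_pdivrMr ?mulr_gt0//.
  have -> : e / 2 * (2 * (C + 1)) = e * (C + 1) by field.
  by rewrite ler_wpM2l// lerDl.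
have eX : 0 <= e * `|t' - t| by rewrite mulr_ge0.
have h6 := le_trans h3 h5; rewrite (le_trans (lerD h6 h4))//; lra.
Qed.

(** The outer error acts on an increment of slope at most |n| + 1; the inner one, multiplied by |m|,
    is kept below one further e. *)
Lemma approx_derive_comp_derive (R : realType) (a b A B e : R) (L f : R -> R)
    (t m n : R) : 0 < e -> (forall t, a <= t <= b -> A <= f t <= B) ->
  approx_derive A B e L (f t) m -> is_derive t (1 : R) (f : R -> R^o) n ->
  approx_derive a b (e * (`|n| + 2)) (fun t => L (f t)) t (m * n).
Proof.
move=> e0 fAB [d1 d10 Ld] /is_derive1_distP fd.
pose e' := Num.min 1 (e / (`|m| + 1)).
have m1 : 0 < `|m| + 1 by rewrite ltr_wpDl.
have e'0 : 0 < e' by rewrite lt_min ltr01 divr_gt0.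
have [d2 d20 fd2] := fd e' e'0.
have n1 : 0 < `|n| + 1 by rewrite ltr_wpDl.
exists (Num.min d2 (d1 / (`|n| + 1))); first by rewrite lt_min d20 divr_gt0.
move=> t' tab; rewrite lt_min => /andP[/fd2 h1 td].
have e'1 : e' <= 1 by rewrite ge_min lexx.
have e'm : `|m| * e' <= e.
  have : e' * (`|m| + 1) <= e by rewrite -ler_pdivlMr// ge_min lexx orbT.
  by rewrite mulrDr mulr1 mulrC; lra.
have {}h1 : `|f t' - f t - (t' - t) * n| <= e' * `|t' - t| by [].
have h2 : `|f t' - f t| <= (`|n| + 1) * `|t' - t|.
  rewrite -(subrK ((t' - t) * n) (f t' - f t)) (le_trans (ler_normD _ _))//.
  rewrite [leLHS]addrC [leRHS]mulrDl lerD//; first by rewrite normrM mulrC.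
  by rewrite (le_trans h1)// ler_wpM2r.
have h3 : `|f t' - f t| < d1.
  by rewrite (le_lt_trans h2)// mulrC -ltr_pdivlMr.
have h4 := Ld (f t') (fAB t' tab) h3.
rewrite (_ : _ - _ - _ = (L (f t') - L (f t) - (f t' - f t) * m) +
  m * (f t' - f t - (t' - t) * n)); last by ring.
rewrite (le_trans (ler_normD _ _))//.
have h5 : `|m * (f t' - f t - (t' - t) * n)| <= e * `|t' - t|.
  rewrite normrM (le_trans (ler_wpM2l (normr_ge0 m) h1))// mulrA ler_wpM2r//.
have h6 : e * `|f t' - f t| <= e * ((`|n| + 1) * `|t' - t|) by rewrite ler_wpM2l// ltW.
rewrite (le_trans (lerD h4 h5))// (le_trans (lerD h6 (lexx _)))//.
by rewrite le_eqVlt; apply/orP; left; apply/eqP; ring.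
Qed.

Lemma approx_derive_left_lt (R : realType) (a b e : R) (f : R -> R) (t m : R) :
  e < m -> approx_derive a b e f t m -> exists2 d : R, 0 < d &
    forall t' : R, a <= t' <= b -> t - d < t' < t -> f t' < f t.
Proof.
move=> em [d d0 fd]; exists d => // t' tab /andP[td tt'].
have tt'd : `|t' - t| < d by rewrite distrC gtr0_norm ?subr_gt0//; lra.
have := fd t' tab tt'd; rewrite ler_norml => /andP[_].
rewrite distrC gtr0_norm ?subr_gt0// => h.
nra.
Qed.

(** At a first zero the function would be strictly smaller, hence negative, just before. The two
    functions are treated together so that each crossing condition may use the sign of both. *)
Lemma stay_positive (R : realType) (f g : R -> R) (a b : R) :
  (forall t, a <= t <= b -> lip_at a b f t) ->
  (forall t, a <= t <= b -> lip_at a b g t) ->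
  0 < f a -> 0 < g a ->
  (forall t, a < t <= b -> 0 <= f t -> 0 <= g t ->
    (f t = 0 -> exists2 d : R, 0 < d &
      forall t', a <= t' <= b -> t - d < t' < t -> f t' < f t) /\
    (g t = 0 -> exists2 d : R, 0 < d &
      forall t', a <= t' <= b -> t - d < t' < t -> g t' < g t)) ->
  forall t, a <= t <= b -> 0 < f t /\ 0 < g t.
Proof.
move=> fl gl fa ga cross; apply: real_induction => //.
- move=> t /andP[at_ tb] Pt; have [ft gt] : 0 < f t /\ 0 < g t.
    by apply: Pt; rewrite at_ lexx.
  have tab : a <= t <= b by rewrite at_ ltW.
  have [d1 d10 fd] := lip_at_near (fl t tab) ft.
  have [d2 d20 gd] := lip_at_near (gl t tab) gt.
  exists (Num.min d1 d2); first by rewrite lt_min d10.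
  move=> t' /andP[tt' t'd] t'b.
  have t'ab : a <= t' <= b by rewrite t'b (le_trans at_ (ltW tt')).
  have td : `|t' - t| < d1 /\ `|t' - t| < d2.
    rewrite gtr0_norm ?subr_gt0//; move: t'd; rewrite -ltrBlDl lt_min.
    by move=> /andP[].
  have := fd t' t'ab td.1; have := gd t' t'ab td.2.
  by rewrite !ltr_norml => /andP[? ?] /andP[? ?]; split; lra.
- move=> t /andP[at_ tb] Pt.
  have tab : a <= t <= b by rewrite tb ltW.
  have before (k : R -> R) : lip_at a b k t -> (forall s, a <= s < t -> 0 < k s) ->
      0 <= k t.
    move=> kl kpos; rewrite leNgt; apply/negP => kt.
    have nkt : 0 < - k t by rewrite oppr_gt0.
    have [d d0 kd] := lip_at_near kl nkt.
    pose z := Num.max a (t - d / 2).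
    have az : a <= z by rewrite le_max lexx.
    have zt : z < t by rewrite gt_max at_ ltrBlDr ltrDl divr_gt0.
    have zd : `|z - t| < d.
      rewrite distrC gtr0_norm ?subr_gt0// ltrBlDr -ltrBlDl lt_max.
      by apply/orP; right; lra.
    have := kd z; rewrite az (le_trans (ltW zt) tb) zd => /(_ isT isT).
    have := kpos z; rewrite az zt => /(_ isT) k0.
    by rewrite ltr_norml => /andP[_]; lra.
  have ft : 0 <= f t by apply: before => [|z /Pt[]//]; exact: fl.
  have gt : 0 <= g t by apply: before => [|z /Pt[]//]; exact: gl.
  have tat : a < t <= b by rewrite at_.
  have [fc gc] := cross t tat ft gt.
  have strict (k : R -> R) : 0 <= k t -> (forall s, a <= s < t -> 0 < k s) ->
     (k t = 0 -> exists2 d : R, 0 < d &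
      forall t', a <= t' <= b -> t - d < t' < t -> k t' < k t) -> 0 < k t.
    move=> kt kpos kc; rewrite lt_neqAle kt andbT; apply/eqP => k0.
    have [d d0 kd] := kc (esym k0).
    pose z := Num.max a (t - d / 2).
    have az : a <= z by rewrite le_max lexx.
    have zt : z < t by rewrite gt_max at_ ltrBlDr ltrDl divr_gt0.
    have zd : t - d < z by rewrite lt_max; apply/orP; right; lra.
    have := kd z; rewrite az (le_trans (ltW zt) tb) zd zt => /(_ isT isT).
    by rewrite -k0 ltNge ltW// kpos// az.
  by split; apply: strict => // z /Pt[].
Qed.

(** Real induction on t for uniform continuity on [a, t]; continuity at t glues a small interval
    around t to a segment already treated. *)
Lemma heine_segment (R : realType) (f : R -> R) (a b e : R) :
  (forall t, a <= t <= b -> {for t, continuous f}) -> 0 < e ->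
  exists2 d : R, 0 < d & forall x y : R, a <= x <= b -> a <= y <= b ->
    `|x - y| < d -> `|f x - f y| <= e.
Proof.
move=> fc e0.
have [ab|ba] := leP a b; last first.
  exists 1 => // x y /andP[ax xb]; have := le_trans ax xb; rewrite leNgt ba//.
pose P t := exists2 d : R, 0 < d & forall x y : R, a <= x <= t -> a <= y <= t ->
    `|x - y| < d -> `|f x - f y| <= e.
have fnear t : a <= t <= b -> exists2 d : R, 0 < d &
    forall x, `|x - t| < d -> `|f x - f t| <= e / 2.
  have e2 : 0 < e / 2 by rewrite divr_gt0.
  move=> /fc/cvgrPdist_le/(_ _ e2)/nbhs_ballP[d /= d0 fd].
  by exists d => // x xt; rewrite distrC; apply: fd; rewrite /ball/= distrC.
have glue s t s' : a <= t <= b -> s <= t -> P s -> 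
    (exists2 d : R, 0 < d & (t - d < s /\ s' < t + d) /\
       forall x, `|x - t| < 2 * d -> `|f x - f t| <= e / 2) -> P s'.
  move=> tab st [d1 d10 Ps] [d d0 [[tds s'td] fd]].
  exists (Num.min d1 d) => [|x y /andP[ax xs'] /andP[ay ys']].
    by rewrite lt_min d10.
  rewrite lt_min => /andP[xy1 xyd].
  have [/andP[xs ys]|] := boolP ((x <= s) && (y <= s)).
    by apply: Ps; rewrite ?ax ?ay.
  rewrite negb_and -!ltNge => sxy.
  have close : `|x - t| < 2 * d /\ `|y - t| < 2 * d.
    move: xyd; rewrite !ltr_norml => /andP[? ?].
    by case/orP: sxy => ?; split; apply/andP; split; lra.
  have h1 := fd x close.1; have h2 := fd y close.2.
  by rewrite (le_trans (ler_distD (f t) _ _))// (distrC (f t)); lra.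
have Pb : P b.
  apply: (@real_induction R P a b); last by rewrite ab lexx.
  - exists 1 => // x y; rewrite -!eq_le => /eqP <- /eqP <- _.
    by rewrite subrr normr0 ltW.
  - move=> t /andP[at_ tb] Pt; have tab : a <= t <= b by rewrite at_ ltW.
    have [d d0 fd] := fnear t tab; exists (d / 2); first by rewrite divr_gt0.
    move=> s /andP[ts std] sb; apply: (glue t t) => //.
      by apply: Pt; rewrite at_ lexx.
    exists (d / 2); first by rewrite divr_gt0.
    by split; [split; lra|move=> x xd; apply: fd; lra].
  - move=> t /andP[at_ tb] Pt; have tab : a <= t <= b by rewrite tb ltW.
    have [d d0 fd] := fnear t tab.
    pose z := Num.max a (t - d / 4).
    have az : a <= z by rewrite le_max lexx.
    have zt : z < t by rewrite gt_max at_ ltrBlDr ltrDl divr_gt0.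
    apply: (glue z t) => //; first exact: ltW.
      by apply: Pt; rewrite az.
    have zd : t - d / 2 < z by rewrite lt_max; apply/orP; right; lra.
    exists (d / 2); first by rewrite divr_gt0.
    by split; [split; lra|move=> x xd; apply: fd; lra].
by have [d d0 fd] := Pb; exists d.
Qed.

Lemma approx_derive_near (R : realType) (a b e d : R) (f g : R -> R) (t m : R) :
  0 < d -> (forall t' : R, a <= t' <= b -> `|t' - t| < d -> f t' = g t') ->
  a <= t <= b -> approx_derive a b e f t m -> approx_derive a b e g t m.
Proof.
move=> d0 fg tab [d1 d10 fd]; exists (Num.min d d1); first by rewrite lt_min d0.
move=> t' t'ab; rewrite lt_min => /andP[td td1].
by rewrite -!fg ?subrr ?normr0//; exact: fd.
Qed.

(** * Leaves as graphs over v, and Euler polygons following them *)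

Section barrier.
Context (R : realType) (F : R * R -> R * R) (r0 sg : R) (s h : R -> R).
Hypothesis sm : saddle_model F r0 sg s h.
Variable r : R.
Hypotheses (rpos : 0 < r) (r8 : 8 * r <= r0).
Local Notation u := (ucoord s).
Local Notation v := (vcoord sg h).

(* the point with coordinates v = w and y *)
Definition vpoint (w y : R) : R * R := (sg * w + h y, y).

(** The slope dy / dt of a leaf in the parameter t = 2 r - v, which increases along the flow; hence
    the sign. Through derive1 h it is in general only continuous. *)
Definition vslope (w y : R) : R :=
  - (F (vpoint w y)).2 / vrate sg h (vpoint w y) (F (vpoint w y)).

Lemma y_lt_r0 (y : R) : `|y| <= 2 * r -> `|y| < r0.
Proof. by move=> yr; move: rpos r8; lra. Qed.

Lemma vpoint_lt (w y : R) : 0 <= w <= 2 * r -> `|y| <= 2 * r ->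
  `|vpoint w y| < r0 /\ `|(vpoint w y).1| <= 3 * r.
Proof.
move=> /andP[w0 wr] yr; have hy := h_small sm (y_lt_r0 yr).
have h1 : `|sg * w + h y| <= 3 * r.
  rewrite (le_trans (ler_normD _ _))// (sg_normM sm) ger0_norm//; lra.
split => //; rewrite norm_pair_lt; apply/andP; split; last exact: y_lt_r0.
by apply: le_lt_trans h1 _; move: rpos r8; lra.
Qed.

Lemma vcoord_vpoint (w y : R) : v (vpoint w y) = w.
Proof. by rewrite /vcoord/= addrK (sg_sqr sm). Qed.

Lemma vpointE (p : R * R) : vpoint (v p) p.2 = p.
Proof. by rewrite /vpoint /vcoord (sg_sqr sm) subrK -surjective_pairing. Qed.

Lemma vrate_vpoint (w y : R) : 0 < w <= 2 * r -> `|y| <= 2 * r ->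
  - (9 / 8) * w <= vrate sg h (vpoint w y) (F (vpoint w y)) <= - (7 / 8) * w.
Proof.
move=> /andP[w0 wr] yr; have w_ : 0 <= w <= 2 * r by rewrite ltW.
have [pr _] := vpoint_lt w_ yr; have := vrate_le sm pr.
rewrite vcoord_vpoint (gtr0_norm w0) ler_norml => /andP[? ?].
by apply/andP; split; lra.
Qed.

Lemma vpoint_dist (w y w' y' : R) : `|y| <= 2 * r -> `|y'| <= 2 * r ->
  `|vpoint w y - vpoint w' y'| <= `|w - w'| + `|y - y'|.
Proof.
move=> yr yr'; have hh := h_lip sm (y_lt_r0 yr) (y_lt_r0 yr').
rewrite prod_norm_le !pairE/=; apply/andP; split; last by rewrite lerDr.
have -> : sg * w + h y - (sg * w' + h y') = sg * (w - w') + (h y - h y') by ring.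
rewrite (le_trans (ler_normD _ _))// (sg_normM sm) lerD2l (le_trans hh)//.
by rewrite ler_pdivrMr// ler_peMr// ler1n.
Qed.

Lemma field_bound (w y : R) : 0 <= w <= 2 * r -> `|y| <= 2 * r ->
  `|(F (vpoint w y)).2| <= 2 * r0.
Proof.
move=> w_ yr; have [pr _] := vpoint_lt w_ yr.
have z : `|0 : R * R| < r0 by rewrite normr0; exact: sm_r0 sm.
have := field_lip sm pr z; rewrite (sm_F0 sm) !subr0.
move: (norm_snd_le (F (vpoint w y))) pr; lra.
Qed.

Lemma vslope_bound (vm w y : R) : 0 < vm -> vm <= w <= 2 * r -> `|y| <= 2 * r ->
  `|vslope w y| <= 4 * r0 / vm.
Proof.
move=> vm0 /andP[vmw wr] yr; have w0 : 0 < w <= 2 * r by rewrite (lt_le_trans vm0).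
have w0' : 0 <= w <= 2 * r by rewrite wr (le_trans (ltW vm0)).
have /andP[_ D] := vrate_vpoint w0 yr; have N := field_bound w0' yr.
rewrite /vslope normrM normrN normfV.
set V := vrate _ _ _ _ in D *.
have V0 : vm / 2 <= `|V| by rewrite ler0_norm; lra.
have Vp : 0 < `|V| by apply: lt_le_trans V0; rewrite divr_gt0.
rewrite ler_pdivrMr// (le_trans N)//.
have -> : 4 * r0 / vm * `|V| = 2 * r0 * (`|V| / (vm / 2)) by field; rewrite gt_eqF.
rewrite ler_peMr//; first by move: (sm_r0 sm); lra.
by rewrite ler_pdivlMr ?divr_gt0// mul1r.
Qed.

Lemma vslope_uniformly_continuous (vm e : R) : 0 < vm -> 0 < e ->
  exists2 d : R, 0 < d & forall w y w' y' : R,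
    vm <= w <= 2 * r -> vm <= w' <= 2 * r -> `|y| <= 2 * r -> `|y'| <= 2 * r ->
    `|w - w'| <= d -> `|y - y'| <= d -> `|vslope w y - vslope w' y'| <= e.
Proof.
move=> vm0 e0; have r00 := sm_r0 sm.
pose c := 7 / 8 * vm; have c0 : 0 < c by rewrite mulr_gt0.
pose e1 := Num.min (e * c / 2) (e * c ^+ 2 / (4 * r0)).
have e10 : 0 < e1 by rewrite lt_min !divr_gt0 ?mulr_gt0// exprn_gt0.
have hc t : - (2 * r) <= t <= 2 * r -> {for t, continuous (derive1 h)}.
  by rewrite -ler_norml => /y_lt_r0/(sm_dh sm)[].
have w0 : 0 < e1 / (8 * r0) by rewrite divr_gt0// mulr_gt0.
have [d1 d10 hd] := heine_segment hc w0.
exists (Num.min (d1 / 2) (e1 / 16)); first by rewrite lt_min !divr_gt0.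
move=> w y w' y' vw vw' yr yr'; rewrite !le_min => /andP[ww1 ww2] /andP[yy1 yy2].
have wp z : vm <= z <= 2 * r -> 0 < z <= 2 * r /\ 0 <= z <= 2 * r.
  by move=> /andP[z1 ->]; rewrite (lt_le_trans vm0 z1) (le_trans (ltW vm0) z1).
have [wa wb] := wp w vw; have [wa' wb'] := wp w' vw'.
have [pr _] := vpoint_lt wb yr; have [pr' _] := vpoint_lt wb' yr'.
have pp : `|F (vpoint w y) - F (vpoint w' y')| <= e1 / 4.
  rewrite (le_trans (field_lip sm pr pr'))//.
  by have := vpoint_dist w w' yr yr'; lra.
have P1 := le_trans (norm_fst_le _) pp; have Q1 := le_trans (norm_snd_le _) pp.
rewrite !pairE in P1 Q1.
have hh : `|derive1 h y - derive1 h y'| <= e1 / (8 * r0).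
  by apply: hd; rewrite -?ler_norml//; lra.
have /andP[_ D1] := vrate_vpoint wa yr; have /andP[_ D2] := vrate_vpoint wa' yr'.
have N2 := field_bound wb' yr'.
have [_ hb _] := sm_dh sm (y_lt_r0 yr).
rewrite /vslope.
have DD : `|vrate sg h (vpoint w y) (F (vpoint w y)) -
    vrate sg h (vpoint w' y') (F (vpoint w' y'))| <= e1.
  rewrite /vrate -mulrBr (sg_normM sm)/=.
  move: P1 Q1 N2; move: (F (vpoint w y)) (F (vpoint w' y')) => A B P1 Q1 N2.
  have -> : A.1 - derive1 h y * A.2 - (B.1 - derive1 h y' * B.2) =
    (A.1 - B.1) - (derive1 h y * (A.2 - B.2) + (derive1 h y - derive1 h y') * B.2) by ring.
  have n1 : `|derive1 h y * (A.2 - B.2)| <= 1 / 16 * (e1 / 4).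
    by rewrite normrM; apply: ler_pM.
  have n2 : `|(derive1 h y - derive1 h y') * B.2| <= e1 / (8 * r0) * (2 * r0).
    by rewrite normrM; apply: ler_pM.
  have n3 : e1 / (8 * r0) * (2 * r0) = e1 / 4 by field; rewrite gt_eqF.
  rewrite n3 in n2.
  rewrite (le_trans (ler_normB _ _))// (le_trans (lerD (lexx _) (ler_normD _ _)))//.
  lra.
move: DD D1 D2 Q1 N2.
move: (vrate _ _ _ _) (vrate _ _ _ _) (F (vpoint w y)).2 (F (vpoint w' y')).2
  => D' D N N' DD D1 D2 Q1 N2.
have Dc : c <= `|D|.
  by case/andP: vw => vw _; rewrite ler0_norm /c; lra.
have Dc' : c <= `|D'|.
  by case/andP: vw' => vw' _; rewrite ler0_norm /c; lra.
have Dn0 : D != 0 by rewrite -normr_gt0 (lt_le_trans c0).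
have Dn0' : D' != 0 by rewrite -normr_gt0 (lt_le_trans c0).
have -> : - N / D - - N' / D' = (N' - N) / D + N' * ((D - D') / (D * D')).
  by field; rewrite Dn0 Dn0'.
rewrite (le_trans (ler_normD _ _))//.
have m1 : `|(N' - N) / D| <= e / 2.
  rewrite normrM normfV ler_pdivrMr ?normr_gt0// distrC.
  have : e1 <= e * c / 2 by rewrite ge_min lexx.
  have : e / 2 * c <= e / 2 * `|D| by rewrite ler_wpM2l// divr_ge0// ltW.
  lra.
have m2 : `|N' * ((D - D') / (D * D'))| <= e / 2.
  rewrite !normrM normfV normrM mulrA ler_pdivrMr ?mulr_gt0 ?normr_gt0//.
  have k1 : `|N'| * `|D - D'| <= 2 * r0 * e1 by apply: ler_pM.
  have k2 : c * c <= `|D| * `|D'| by apply: ler_pM => //; exact: ltW.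
  have k3 : e1 <= e * c ^+ 2 / (4 * r0) by rewrite ge_min lexx orbT.
  have k4 : 2 * r0 * e1 <= e / 2 * (c * c).
    rewrite (le_trans (ler_wpM2l _ k3)) ?mulr_ge0 ?(ltW r00)//.
    by rewrite le_eqVlt; apply/orP; left; apply/eqP; field; rewrite gt_eqF.
  apply: le_trans k1 (le_trans k4 _).
  by apply: ler_wpM2l => //; apply: divr_ge0 => //; exact: ltW.
lra.
Qed.

(** With v clamped to [vm, 2 r] and y to [-2 r, 2 r], the slope is bounded and uniformly continuous,
    which is enough for an Euler polygon. The equation holds for the true slope wherever the clamps
    are inactive. *)
Lemma barrier_exists (vm e y0 : R) : 0 < vm -> vm <= 2 * r -> 0 < e ->
  exists L : R -> R, [/\ L 0 = y0,
    forall t, 0 <= t <= 2 * r - vm -> lip_at 0 (2 * r - vm) L t &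
    forall t, 0 <= t <= 2 * r - vm -> `|L t| <= 2 * r ->
      approx_derive 0 (2 * r - vm) e L t (vslope (2 * r - t) (L t))].
Proof.
move=> vm0 vmr e0; have r00 := sm_r0 sm.
pose cl t := Num.max vm (Num.min (2 * r) (2 * r - t)).
pose f t y : R^o := vslope (cl t) (clampr (2 * r) y).
have clE t : vm <= cl t <= 2 * r.
  by rewrite /cl le_max lexx/= ge_max vmr ge_min lexx.
have r20 : 0 <= 2 * r by rewrite mulr_ge0// ltW.
have cln y := @clampr_norm R (2 * r) y r20.
have cld t t' : `|cl t - cl t'| <= `|t - t'|.
  rewrite /cl -[leRHS]normrN (_ : - (t - t') = (2 * r - t) - (2 * r - t')); last by ring.
  exact: le_trans (maxr_dist _ _ _) (minr_dist _ _ _).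
have M0 : 0 <= 4 * r0 / vm by rewrite divr_ge0 ?mulr_ge0// ltW.
have fM t y : `|f t y| <= 4 * r0 / vm by apply: vslope_bound.
have UC (eps : R) : 0 < eps -> exists2 d : R, 0 < d & forall (t t' : R) (x y : R^o),
     `|t - t'| <= d -> `|x - y| <= d -> `|f t x - f t' y| <= eps.
  move=> eps0; have [d d0 hd] := vslope_uniformly_continuous vm0 eps0.
  exists d => // t t' x y tt xy; apply: hd => //.
    by rewrite (le_trans (cld _ _)).
  by rewrite (le_trans (clampr_dist _ _ _)).
have T0 : 0 <= 2 * r - vm by rewrite subr_ge0.
have [L L0 Ld] := @approximate_solution R R^o f y0 _ M0 fM UC e _ e0 T0.
have Lapp t : 0 <= t <= 2 * r - vm -> approx_derive 0 (2 * r - vm) e L t (f t (L t)).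
  by move=> tT; have [d d0 hd] := Ld t tT; exists d.
exists L; split => // t tT.
  exact: approx_derive_lip (ltW e0) (Lapp t tT).
move=> Lr; have := Lapp t tT; rewrite /f clampr_id// (_ : cl t = 2 * r - t)//.
case/andP: tT => t0 tT; rewrite /cl (min_idPr _) ?gerBl//; apply/max_idPr; lra.
Qed.

End barrier.

Lemma approx_derive_sub (R : realType) (a b c e : R) (f : R -> R) (t m : R) :
  c <= b -> approx_derive a b e f t m -> approx_derive a c e f t m.
Proof.
move=> cb [d d0 fd]; exists d => // t' /andP[at' t'c]; apply: fd.
by rewrite at' (le_trans t'c).
Qed.

Section barrier_height.
Context (R : realType) (F : R * R -> R * R) (r0 sg : R) (s h : R -> R).
Hypothesis sm : saddle_model F r0 sg s h.
Variable r : R.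
Hypotheses (rpos : 0 < r) (r8 : 8 * r <= r0).
Local Notation u := (ucoord s).
Local Notation v := (vcoord sg h).
Local Notation vpoint := (vpoint sg h).
Local Notation vslope := (vslope F sg h).

(** The left side is du / dt along the leaf, that is u' / (-v'); the bounds on the rates give (|u| /
    8) / (7 w / 8). *)
Lemma ucoord_vpoint_rate (w y : R) : 0 < w <= 2 * r -> `|y| <= 2 * r ->
  `|vslope w y - derive1 s (vpoint w y).1 * (- sg + derive1 h y * vslope w y)|
    <= `|u (vpoint w y)| / (7 * w).
Proof.
move=> w_ yr; have /andP[w0 wr] := w_.
have w_' : 0 <= w <= 2 * r by rewrite ltW.
have [pr _] := vpoint_lt sm rpos r8 w_' yr.
have /andP[_ D] := vrate_vpoint sm rpos r8 w_ yr.
have du := urate_le sm pr.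
rewrite /vslope.
have VE : vrate sg h (vpoint w y) (F (vpoint w y)) =
   sg * ((F (vpoint w y)).1 - derive1 h y * (F (vpoint w y)).2) by [].
have UE : urate s (vpoint w y) (F (vpoint w y)) =
   (F (vpoint w y)).2 - derive1 s (vpoint w y).1 * (F (vpoint w y)).1 by [].
move: du D; rewrite UE; move: VE.
move: (vrate _ _ _ _) (F (vpoint w y)).1 (F (vpoint w y)).2 (derive1 s _)
  (derive1 h _) (u _) => V P Q s' h' X VE du D.
have V0 : V < 0 by nra.
have sgP : sg * V = P - h' * Q by rewrite VE (sg_sqr sm).
have sgn : - sg + h' * (- Q / V) = - P / V.
  have -> : P = sg * V + h' * Q by rewrite sgP; ring.
  by field; rewrite lt_eqF.
rewrite sgn.
have -> : - Q / V - s' * (- P / V) = - (Q - s' * P) / V by field; rewrite lt_eqF.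
rewrite normrM normrN normfV (ltr0_norm V0) ler_pdivrMr ?oppr_gt0//.
rewrite (le_trans du)// -[leRHS]mulrA ler_wpM2l//.
by rewrite mulrC ler_pdivlMr ?mulr_gt0//; lra.
Qed.

(** At fixed v, raising y moves x by at most 1/16 as much, and s(x) by at most 1/16 of that. *)
Lemma ucoord_vpoint_incr (w y y' : R) : 0 <= w <= 2 * r -> `|y| <= 2 * r ->
  `|y'| <= 2 * r -> y <= y' -> u (vpoint w y) <= u (vpoint w y').
Proof.
move=> w_ yr yr' yy.
have [pr _] := vpoint_lt sm rpos r8 w_ yr; have [pr' _] := vpoint_lt sm rpos r8 w_ yr'.
move: pr pr'; rewrite !norm_pair_lt => /andP[xr yr0] /andP[xr' yr0'].
have hs := s_lip sm xr xr'; have hh := h_lip sm yr0 yr0'.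
rewrite /ucoord/= in hs hh *.
have e1 : sg * w + h y - (sg * w + h y') = h y - h y' by ring.
rewrite e1 in hs.
have E : `|y - y'| = y' - y by rewrite distrC ger0_norm ?subr_ge0.
rewrite E in hh.
have := ler_norm (s (sg * w + h y') - s (sg * w + h y)).
rewrite (distrC (s (sg * w + h y'))); lra.
Qed.

Section claim.
Variables (vm vs U0 e : R) (L : R -> R).
Hypotheses (vm0 : 0 < vm) (vms : vm <= vs) (vsr : vs <= 2 * r).
Hypotheses (U00 : 0 < U0) (U0vs : 4 * U0 <= vs) (e0 : 0 < e).
Hypothesis eU : e <= U0 / (20 * r).
Hypothesis L_lip : forall t, 0 <= t <= 2 * r - vm -> lip_at 0 (2 * r - vm) L t.
Hypothesis L_app : forall t, 0 <= t <= 2 * r - vm -> `|L t| <= 2 * r ->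
  approx_derive 0 (2 * r - vm) e L t (vslope (2 * r - t) (L t)).
Hypothesis L_start : `|L 0| <= 2 * r /\ u (vpoint (2 * r) (L 0)) = U0.

(** The height is clamped so that h and s are evaluated where they are controlled, before [L] is
    known to stay in that range. *)
Let yc t := clampr (2 * r) (L t).
Let X t := sg * (2 * r - t) + h (yc t).
Let U t := yc t - s (X t).

Let ycr t : `|yc t| <= 2 * r.
Proof. by apply: clampr_norm; rewrite mulr_ge0// ltW. Qed.

Let w_ t : 0 <= t <= 2 * r - vs -> vs <= 2 * r - t <= 2 * r.
Proof. by move=> /andP[? ?]; apply/andP; split; lra. Qed.

Let vs0 : 0 < vs. Proof. exact: lt_le_trans vms. Qed.

Let w0 t : 0 <= t <= 2 * r - vs -> 0 < 2 * r - t <= 2 * r.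
Proof. by move=> /w_/andP[vw ->]; rewrite (lt_le_trans vs0 vw). Qed.

Let w0' t : 0 <= t <= 2 * r - vs -> 0 <= 2 * r - t <= 2 * r.
Proof. by move=> /w0/andP[/ltW -> ->]. Qed.

Let tm t : 0 <= t <= 2 * r - vs -> 0 <= t <= 2 * r - vm.
Proof. by move=> /andP[-> tv]; rewrite (le_trans tv)// lerD2l lerN2. Qed.

Let sub : 2 * r - vs <= 2 * r - vm. Proof. by rewrite lerD2l lerN2. Qed.

Let sX t : 0 <= t <= 2 * r - vs -> `|s (X t)| <= 3 * r / 16 /\ `|X t| < r0.
Proof.
move=> /w0' wt; have [] := vpoint_lt sm rpos r8 wt (ycr t).
rewrite norm_pair_lt/= => /andP[xr _] x3; split => //.
by rewrite (le_trans (s_small sm xr))// ler_wpM2r.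
Qed.

(** Since |s| <= 3 r / 16 there, 0 <= U <= r keeps the clamped height strictly inside (-2 r, 2 r),
    so the clamp does nothing. *)
Let inert t : 0 <= t <= 2 * r - vs -> 0 <= U t <= r -> `|L t| < 2 * r.
Proof.
move=> tT /andP[Ut0 Utr]; have [sx _] := sX tT.
rewrite ltNge; apply/negP => Lr.
have : `|yc t| = 2 * r.
  rewrite /yc /clampr; move: Lr; rewrite ler_normr => /orP[Lr|Lr].
    rewrite (min_idPl Lr) (max_idPr _) ?gtr0_norm ?mulr_gt0//.
    by rewrite lerNl; move: rpos; lra.
  have Ln : L t <= - (2 * r) by rewrite lerNr.
  have r20 : 0 < 2 * r by rewrite mulr_gt0.
  rewrite (min_idPr _); last by move: rpos; lra.
  by rewrite (max_idPl _)// normrN gtr0_norm.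
move: sx Ut0 Utr; rewrite /U ler_norml => /andP[? ?] ? ?.
have [y0|y0] := leP 0 (yc t); [rewrite ger0_norm//|rewrite ltr0_norm//].
  by move: rpos; lra.
by move: rpos; lra.
Qed.

Let U_lip t : 0 <= t <= 2 * r - vs -> lip_at 0 (2 * r - vs) U t.
Proof.
move=> tT; have [C [d [C0 d0 LC]]] := L_lip (tm tT).
exists (2 * C + 1), d; split => //; first by rewrite addr_ge0// mulr_ge0.
move=> t' t'T td; have {}LC := LC t' (tm t'T) td.
have yy : `|yc t' - yc t| <= C * `|t' - t| := le_trans (clampr_dist _ _ _) LC.
have hh := h_lip sm (y_lt_r0 rpos r8 (ycr t')) (y_lt_r0 rpos r8 (ycr t)).
have [_ Xr] := sX tT; have [_ Xr'] := sX t'T.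
have ss := s_lip sm Xr' Xr.
have XX : `|X t' - X t| <= `|t' - t| + `|h (yc t') - h (yc t)|.
  have -> : X t' - X t = sg * (t - t') + (h (yc t') - h (yc t)) by rewrite /X; ring.
  by rewrite (le_trans (ler_normD _ _))// (sg_normM sm) (distrC t).
have -> : U t' - U t = (yc t' - yc t) - (s (X t') - s (X t)) by rewrite /U; ring.
rewrite (le_trans (ler_normB _ _))//.
have n0 := normr_ge0 (t' - t); have n1 := mulr_ge0 C0 n0.
lra.
Qed.

Let U_app t : 0 <= t <= 2 * r - vs -> 0 <= U t <= r ->
  exists2 m : R, `|m| <= U t / (7 * (2 * r - t)) &
    approx_derive 0 (2 * r - vs) (3 * e) U t m.
Proof.
move=> tT Ut; have Lr := inert tT Ut.
have ycE : yc t = L t by apply: clampr_id; exact: ltW.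
have wt := w0 tT.
pose f := vslope (2 * r - t) (L t).
have Xt : X t = (vpoint (2 * r - t) (L t)).1 by rewrite /X ycE.
have UtE : U t = u (vpoint (2 * r - t) (L t)) by rewrite /U /ucoord -Xt ycE.
exists (f - derive1 s (X t) * (- sg + derive1 h (L t) * f)).
  rewrite Xt; case/andP: (Ut) => Ut0 _.
  by rewrite -[U t in leRHS]ger0_norm// UtE; apply: ucoord_vpoint_rate => //; exact: ltW.
have Lapp := approx_derive_sub sub (L_app (tm tT) (ltW Lr)).
have gap : 0 < 2 * r - `|L t| by rewrite subr_gt0.
have [d d0 Ld] := lip_at_near (L_lip (tm tT)) gap.
have yapp : approx_derive 0 (2 * r - vs) e yc t f.
  apply: approx_derive_near d0 _ tT Lapp => t' t'T td.
  rewrite /yc clampr_id//; have := Ld t' (tm t'T) td.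
  have := ler_distD 0 (L t') (L t); have := ler_normD (L t' - L t) (L t).
  rewrite subrK; lra.
have [dh hb _] := sm_dh sm (y_lt_r0 rpos r8 (ltW Lr)).
have happ : approx_derive 0 (2 * r - vs) e (fun t => h (yc t)) t (derive1 h (L t) * f).
  apply: (approx_derive_comp_small (f := yc)) => //.
  by rewrite ycE; exact: is_derive_derive1.
have lin : approx_derive 0 (2 * r - vs) e (fun t => sg * (2 * r - t)) t (- sg).
  exists 1 => // t' _ _.
  rewrite (_ : _ - _ - _ = 0) ?normr0 ?mulr_ge0 ?(ltW e0)//; ring.
have Xapp : approx_derive 0 (2 * r - vs) (e + e) X t (- sg + derive1 h (L t) * f).
  exact: approx_deriveD.
have [_ Xr] := sX tT; have [ds sb _] := sm_ds sm Xr.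
have e2 : 0 < e + e by rewrite addr_gt0.
have sapp : approx_derive 0 (2 * r - vs) (e + e) (fun t => s (X t)) t
    (derive1 s (X t) * (- sg + derive1 h (L t) * f)).
  by apply: approx_derive_comp_small => //; exact: is_derive_derive1.
have -> : 3 * e = e + (e + e) by ring.
exact: approx_deriveD yapp (approx_deriveN sapp).
Qed.

(** With w = 2 r - t, an exact solution has |dU / dt| <= U / (7 w), so it lies between multiples of
    w^(1/7) and w^(-1/7). The comparison functions are proportional to w and 1 / w, and this gap
    absorbs the slope error of [L]. At w = 2 r they are U0 / 2 and 2 U0. *)
Lemma barrier_height t : 0 <= t <= 2 * r - vs ->
  `|L t| < 2 * r /\
  U0 * (2 * r - t) / (4 * r) < u (vpoint (2 * r - t) (L t)) < 4 * r * U0 / (2 * r - t).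
Proof.
pose f1 t := U t - U0 * (2 * r - t) / (4 * r).
pose f2 t := 4 * r * U0 / (2 * r - t) - U t.
have U0r : 0 < U0 / r by rewrite divr_gt0.
have lin z : 0 <= z <= 2 * r - vs ->
    approx_derive 0 (2 * r - vs) e (fun t => - (U0 * (2 * r - t) / (4 * r))) z (U0 / r / 4).
  move=> _; exists 1 => // t' _ _.
  rewrite (_ : _ - _ - _ = 0) ?normr0 ?mulr_ge0 ?(ltW e0)//.
  by field; rewrite gt_eqF.
have hyp z : 0 <= z <= 2 * r - vs -> is_derive z (1 : R)
    (fun t => 4 * r * U0 / (2 * r - t) : R^o) (4 * r * U0 / (2 * r - z) ^+ 2).
  move=> /w0/andP[wz _].
  have dl : is_derive z (1 : R) (fun t => 2 * r - t : R^o) (- 1).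
    apply/is_derive1_distP => e' e'0; exists 1 => // t' _.
    rewrite (_ : _ - _ - _ = 0) ?normr0 ?mulr_ge0 ?(ltW e'0)//.
    by rewrite [_ *: _]mulrN1; ring.
  have wn0 : 2 * r - z != 0 by rewrite gt_eqF.
  have dv := is_deriveV (f := fun t => 2 * r - t) wn0 dl.
  have E : 4 * r * U0 / (2 * r - z) ^+ 2 =
      (4 * r * U0) *: (- (2 * r - z) ^- 2 *: (- 1 : R)).
    by rewrite -[RHS]/(4 * r * U0 * (- (2 * r - z) ^- 2 * (- 1))) mulrN1 opprK.
  by rewrite E; exact: is_deriveZ.
have flip1 z : 0 <= z <= 2 * r - vs -> lip_at 0 (2 * r - vs) f1 z.
  move=> zT; have [C1 [d1 [C10 d10 h1]]] := U_lip zT.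
  have [C2 [d2 [C20 d20 h2]]] := approx_derive_lip (ltW e0) (lin z zT).
  exists (C1 + C2), (Num.min d1 d2); split; rewrite ?addr_ge0 ?lt_min ?d10//.
  move=> t' t'T; rewrite lt_min => /andP[/(h1 t' t'T) k1 /(h2 t' t'T) k2].
  rewrite (_ : _ - _ = (U t' - U z) + (- (U0 * (2 * r - t') / (4 * r)) -
    - (U0 * (2 * r - z) / (4 * r)))); last by rewrite /f1; ring.
  by rewrite (le_trans (ler_normD _ _))// [leRHS]mulrDl lerD.
have flip2 z : 0 <= z <= 2 * r - vs -> lip_at 0 (2 * r - vs) f2 z.
  move=> zT; have [C1 [d1 [C10 d10 h1]]] := U_lip zT.
  have := approx_derive_of_derive 0 (2 * r - vs) e0 (hyp z zT).
  move=> /(approx_derive_lip (ltW e0))[C2 [d2 [C20 d20 h2]]].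
  exists (C1 + C2), (Num.min d1 d2); split; rewrite ?addr_ge0 ?lt_min ?d10//.
  move=> t' t'T; rewrite lt_min => /andP[/(h1 t' t'T) k1 /(h2 t' t'T) k2].
  rewrite (_ : _ - _ = (4 * r * U0 / (2 * r - t') - 4 * r * U0 / (2 * r - z)) -
    (U t' - U z)); last by rewrite /f2; ring.
  by rewrite (le_trans (ler_normB _ _))// addrC [leRHS]mulrDl lerD.
have bounds z : 0 <= z <= 2 * r - vs -> 0 <= f1 z -> 0 <= f2 z -> 0 <= U z <= r.
  move=> zT; have /andP[wz wz2] := w0 zT; have /andP[vz _] := w_ zT.
  move=> g1 g2.
  have {}g1 : U0 * (2 * r - z) / (4 * r) <= U z by rewrite -subr_ge0.
  have {}g2 : U z <= 4 * r * U0 / (2 * r - z) by rewrite -subr_ge0.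
  apply/andP; split.
    apply: le_trans g1; apply: divr_ge0; apply: mulr_ge0 => //; exact: ltW.
  apply: (le_trans g2); rewrite ler_pdivrMr// -mulrA mulrCA.
  by apply: ler_wpM2l; [exact: ltW|exact: le_trans vz].
have start : U 0 = U0.
  by rewrite /U /X /yc clampr_id ?subr0; [case: L_start => _ <-|case: L_start].
have T0 : 0 <= 2 * r - vs by rewrite subr_ge0.
have f10 : 0 < f1 0.
  rewrite /f1 start subr0 (_ : _ - _ = U0 / 2) ?divr_gt0//.
  by field; rewrite gt_eqF.
have f20 : 0 < f2 0.
  rewrite /f2 start subr0 (_ : _ - _ = U0)//.
  by field; rewrite gt_eqF.
have := stay_positive flip1 flip2 f10 f20 => /(_ _)/[swap] tT pos.
have {pos}[p1 p2] : 0 < f1 t /\ 0 < f2 t.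
  apply: pos (tT) => z /andP[z0 zT] g1 g2.
  have zT' : 0 <= z <= 2 * r - vs by rewrite ltW.
  have Uz := bounds z zT' g1 g2.
  have [m mb Uapp] := U_app zT' Uz.
  have /andP[wz wz2] := w0 zT'.
  (* At a contact the slope of f1 is at least (1/4 - 1/28) U0 / r and that of f2 at least (6/7) U0 /
     r. Both exceed U0 / (5 r), whence the hypothesis on [e]. *)
  have e4 : 3 * e + e <= U0 / r / 5.
    have -> : U0 / r / 5 = 4 * (U0 / (20 * r)) by field; rewrite gt_eqF.
    by move: eU; lra.
  split=> [g10|g20].
    apply: (@approx_derive_left_lt _ _ _ (3 * e + e) f1 z (m + U0 / r / 4)); last first.
      exact: approx_deriveD Uapp (lin z zT').
    have : U z / (7 * (2 * r - z)) = U0 / r / 28.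
      have -> : U z = U0 * (2 * r - z) / (4 * r) by move: g10; rewrite /f1; lra.
      by field; rewrite !gt_eqF.
    move: mb; rewrite ler_norml => /andP[mb _] E; rewrite E in mb.
    lra.
  apply: (@approx_derive_left_lt _ _ _ (e + 3 * e) f2 z
      (4 * r * U0 / (2 * r - z) ^+ 2 - m)); last first.
    have happ := approx_derive_of_derive 0 (2 * r - vs) e0 (hyp z zT').
    exact: approx_deriveD happ (approx_deriveN Uapp).
  have E : U z / (7 * (2 * r - z)) = 4 * r * U0 / (2 * r - z) ^+ 2 / 7.
    have -> : U z = 4 * r * U0 / (2 * r - z) by move: g20; rewrite /f2; lra.
    by field; rewrite !gt_eqF.
  move: mb; rewrite ler_norml => /andP[_ mb]; rewrite E in mb.
  have : U0 / r <= 4 * r * U0 / (2 * r - z) ^+ 2.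
    rewrite ler_pdivlMr ?exprn_gt0//.
    have -> : 4 * r * U0 = U0 / r * (2 * r) ^+ 2 by field; rewrite gt_eqF.
    apply: ler_wpM2l; first exact: ltW.
    have r20 : 0 <= 2 * r by rewrite mulr_ge0// ltW.
    by apply: lerXn2r => //; rewrite nnegrE; exact: ltW.
  lra.
have Lr := inert tT (bounds t tT (ltW p1) (ltW p2)); split => //.
have ycE : yc t = L t by apply: clampr_id; exact: ltW.
have UE : U t = u (vpoint (2 * r - t) (L t)) by rewrite /U /X ycE.
by move: p1 p2; rewrite /f1 /f2 UE !subr_gt0 => -> ->.
Qed.

End claim.
End barrier_height.

Lemma lip_at_comp (R : realType) (a b A B : R) (L f : R -> R) (t : R) :
  (forall t, a <= t <= b -> A <= f t <= B) ->
  lip_at A B L (f t) -> lip_at a b f t -> lip_at a b (fun t => L (f t)) t.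
Proof.
move=> fAB [C1 [d1 [C10 d10 h1]]] fl; have [C2 [d2 [C20 d20 h2]]] := fl.
have [d3 d30 h3] := lip_at_near fl d10.
exists (C1 * C2), (Num.min d2 d3); split; rewrite ?mulr_ge0 ?lt_min ?d20//.
move=> t' tab; rewrite lt_min => /andP[td2 td3].
rewrite (le_trans (h1 _ (fAB t' tab) (h3 t' tab td3)))// -mulrA ler_wpM2l//.
exact: h2.
Qed.

Lemma within_segment_continuous (R : realType) (f : R -> R) (a b : R) :
  (forall t, a <= t <= b -> {for t, continuous f}) ->
  {within `[a, b], continuous f}.
Proof.
move=> fc; apply: continuous_in_subspaceT => t; rewrite inE/= in_itv/=.
exact: fc.
Qed.

(** * Transversal arcs against a barrier *)

Section transversal_arc.
Context (R : realType) (F : R * R -> R * R) (r0 sg : R) (s h : R -> R).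
Hypothesis sm : saddle_model F r0 sg s h.
Variable r : R.
Hypotheses (rpos : 0 < r) (r8 : 8 * r <= r0).
Local Notation u := (ucoord s).
Local Notation v := (vcoord sg h).

(** The transversality determinant; the factor [sg] makes its sign in the coordinates (v, y) the
    same on both branches. *)
Definition cross (p w : R * R) : R := sg * (w.1 * (F p).2 - w.2 * (F p).1).

Lemma r_lt_r0 (p : R * R) : `|p| < r -> `|p| < r0.
Proof. by move: rpos r8; lra. Qed.

Lemma vcoord_lt (p : R * R) : `|p| < r -> v p < 2 * r.
Proof.
move=> pr; have := r_lt_r0 pr; move: pr; rewrite !norm_pair_lt.
move=> /andP[xr yr] /andP[_ yr0]; have hy := h_small sm yr0.
rewrite (le_lt_trans (ler_norm _))// (sg_normM sm).
have := ler_normB p.1 (h p.2); have := normr_ge0 p.2; lra.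
Qed.

Lemma ucoord_lt (p : R * R) : `|p| < r -> u p < 2 * r.
Proof.
move=> pr; have := r_lt_r0 pr; move: pr; rewrite !norm_pair_lt.
move=> /andP[xr yr] /andP[xr0 _]; have sx := s_small sm xr0.
have := ler_norm p.2; have := ler_norm (- s p.1); rewrite normrN /ucoord.
have := normr_ge0 p.1; lra.
Qed.

(** The map (x, y) -> (v, y) has Jacobian determinant sg, so the terms in derive1 h cancel. *)
Lemma crossE (p w : R * R) : cross p w =
  vrate sg h p w * (F p).2 - w.2 * vrate sg h p (F p).
Proof. by rewrite /cross /vrate; ring. Qed.

Lemma continuous_of_derive (G : R -> R * R) (t : R) (w : R * R) :
  is_derive t (1 : R) G w -> {for t, continuous G}.
Proof. by move=> [dG _]; apply/differentiable_continuous/derivable1_diffP. Qed.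

Lemma field_continuous (p : R * R) : `|p| < r0 -> {for p, continuous F}.
Proof.
move=> pr; apply/cvgrPdist_le => e e0.
have g0 : 0 < r0 - `|p| by rewrite subr_gt0.
have d0 : 0 < Num.min (e / 2) (r0 - `|p|) by rewrite lt_min divr_gt0.
have idp : q @[q --> p] --> p by exact: cvg_id.
move: idp => /cvgrPdist_lt/(_ _ d0); apply: filterS => q.
rewrite lt_min => /andP[pe pd].
have qr : `|q| < r0.
  rewrite -(subrK p q) (le_lt_trans (ler_normD _ _))// distrC.
  by move: pd; lra.
by rewrite (le_trans (field_lip sm pr qr))//; lra.
Qed.

Lemma cross_continuous (G G' : R -> R * R) (t : R) :
  is_derive t (1 : R) G (G' t) -> `|G t| < r0 -> {for t, continuous G'} ->
  {for t, continuous (fun t => cross (G t) (G' t))}.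
Proof.
move=> dG Gr cG'; have cG := continuous_of_derive dG.
have cF : {for t, continuous (F \o G)}.
  by apply: continuous_comp => //; exact: field_continuous.
have c1 (A : R -> R * R) : {for t, continuous A} -> (A z).1 @[z --> t] --> (A t).1.
  by move=> cA; apply: (cvg_comp _ _ cA); exact: cvg_fst.
have c2 (A : R -> R * R) : {for t, continuous A} -> (A z).2 @[z --> t] --> (A t).2.
  by move=> cA; apply: (cvg_comp _ _ cA); exact: cvg_snd.
apply: cvgM; first exact: cvg_cst.
apply: cvgB; apply: cvgM.
- exact: c1.
- exact: (c2 _ cF).
- exact: c2.
- exact: (c1 _ cF).
Qed.

(* A transversal arc cannot come back below the leaf it started above. *)
Lemma transversal_height (G G' : R -> R * R) (t1 t2 vs : R) : t1 <= t2 ->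
  (forall t, t1 <= t <= t2 -> [/\ `|G t| < r, is_derive t (1 : R) G (G' t),
     {for t, continuous G'}, 0 < v (G t) & 0 < cross (G t) (G' t)]) ->
  0 < vs -> vs <= v (G t1) -> vs <= v (G t2) -> 0 < u (G t1) ->
  u (G t1) * vs ^+ 2 / (32 * r ^+ 2) < u (G t2).
Proof.
move=> t12 arc vs0 vs1 vs2 u1.
have t1_ : t1 <= t1 <= t2 by rewrite lexx.
have t2_ : t1 <= t2 <= t2 by rewrite lexx t12.
have Gr t : t1 <= t <= t2 -> `|G t| < r by move=> /arc[].
have dG t : t1 <= t <= t2 -> is_derive t (1 : R) G (G' t) by move=> /arc[].
have dv t : t1 <= t <= t2 -> is_derive t (1 : R) (fun t => v (G t) : R^o)
    (vrate sg h (G t) (G' t)).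
  by move=> tt; apply: (is_derive_vcoord sm) (r_lt_r0 (Gr t tt)); exact: dG.
(* Compactness of [t1, t2] bounds v and the determinant from below and the speed from above: the
   barrier needs v >= vm > 0, the crossing estimate needs the other two. *)
have [tm tmT vmin] : exists2 c, c \in `[t1, t2] &
    forall t, t \in `[t1, t2] -> v (G c) <= v (G t).
  apply: (@EVT_min R (fun t => v (G t)) t1 t2 t12).
  by apply: derivable_within_continuous => t; rewrite in_itv/= => /dv[].
have [te teT Emin] : exists2 c, c \in `[t1, t2] &
    forall t, t \in `[t1, t2] -> cross (G c) (G' c) <= cross (G t) (G' t).
  apply: (@EVT_min R (fun t => cross (G t) (G' t)) t1 t2 t12).
  apply: within_segment_continuous => t tt; apply: cross_continuous.
  - exact: dG.
  - exact: r_lt_r0 (Gr t tt).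
  - by have [] := arc t tt.
have [tw twT Wmax] : exists2 c, c \in `[t1, t2] &
    forall t, t \in `[t1, t2] -> `|G' t| <= `|G' c|.
  apply: (@EVT_max R (fun t => `|G' t|) t1 t2 t12).
  apply: within_segment_continuous => t tt.
  by apply: cvg_norm; have [] := arc t tt.
pose vm := Num.min (v (G tm)) vs.
have vm0 : 0 < vm by rewrite lt_min vs0 andbT; have [] := arc tm _; rewrite ?in_itv in tmT.
have vms : vm <= vs by rewrite ge_min lexx orbT.
have vmle t : t1 <= t <= t2 -> vm <= v (G t).
  by move=> tt; rewrite ge_min vmin// in_itv.
have vsr : vs <= 2 * r by rewrite (le_trans vs1)// ltW// vcoord_lt// Gr.
have E0 : 0 < cross (G te) (G' te) by have [] := arc te _; rewrite ?in_itv in teT.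
set E := cross _ _ in E0 Emin.
set W := `|G' tw| in Wmax.
have W0 : 0 <= W by exact: normr_ge0.
(* At [G t1] the upper bound 4 r U0 / v on the barrier is at most u (G t1) / 2, so the arc starts
   above it. At [G t2] the lower bound is at least U0 vs / (4 r), the height claimed. *)
pose U0 := u (G t1) * vs / (8 * r).
have U00 : 0 < U0 by rewrite divr_gt0 ?mulr_gt0.
have ur := ucoord_lt (Gr t1 t1_).
have U0vs : 4 * U0 <= vs.
  have -> : 4 * U0 = u (G t1) * vs / (2 * r) by rewrite /U0; field; rewrite gt_eqF.
  by rewrite ler_pdivrMr ?mulr_gt0// mulrC ler_wpM2l// ltW.
have r20 : 0 < 2 * r by rewrite mulr_gt0.
have r2_ : 0 <= 2 * r <= 2 * r by rewrite lexx ltW.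
have [y0 y0r Uy0] : exists2 y, y \in `[- (2 * r), 2 * r] &
    u (vpoint sg h (2 * r) y) = U0.
  have yr0 y : - (2 * r) <= y <= 2 * r -> `|y| <= 2 * r by rewrite ler_norml.
  have r2a : `|2 * r| <= 2 * r by rewrite gtr0_norm.
  have r2b : `|- (2 * r)| <= 2 * r by rewrite normrN.
  have ends y : `|y| <= 2 * r -> `|s (vpoint sg h (2 * r) y).1| <= 3 * r / 16.
    move=> yr; have [] := vpoint_lt sm rpos r8 r2_ yr.
    rewrite norm_pair_lt => /andP[xr _] x3; have := s_small sm xr; lra.
  apply: (@IVT R (fun y => u (vpoint sg h (2 * r) y)) (- (2 * r)) (2 * r) U0).
  - by rewrite ge0_cp ?ltW.
  - apply: derivable_within_continuous => y; rewrite in_itv/= => /yr0 yr.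
    have [] := vpoint_lt sm rpos r8 r2_ yr; rewrite norm_pair_lt => /andP[xr _] _.
    have [dh _ _] := sm_dh sm (y_lt_r0 rpos r8 yr); have [ds _ _] := sm_ds sm xr.
    suff : is_derive y (1 : R) (fun y => y - s (sg * (2 * r) + h y) : R^o)
      (1 - derive1 s (sg * (2 * r) + h y) * (0 + derive1 h y)) by case.
    apply: is_deriveB; apply: is_derive1_comp; first exact: is_derive_derive1.
    by apply: is_deriveD; exact: is_derive_derive1.
  - have := ends _ r2a; have := ends _ r2b; rewrite !ler_norml /ucoord/=.
    move=> /andP[? ?] /andP[? ?]; have : U0 <= r / 2 by move: U0vs; lra.
    move=> ?; rewrite ge_min le_max; apply/andP; split; apply/orP; [left|right]; lra.
pose mu := E / (9 / 4 * r).
have mu0 : 0 < mu by apply: divr_gt0 => //; apply: mulr_gt0 => //; lra.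
(* The first bound is required by [barrier_height]; the second keeps the total slope error e (2 W +
   3) below mu, which bounds from below the slope of [K] at a contact because -v' <= 9 r / 4. *)
pose e := Num.min (U0 / (20 * r)) (mu / (2 * (2 * W + 3))).
have W3 : 0 < 2 * W + 3 by lra.
have e0 : 0 < e.
  by rewrite lt_min; apply/andP; split; apply: divr_gt0 => //; exact: mulr_gt0.
have eU : e <= U0 / (20 * r) by rewrite ge_min lexx.
have eW : e * (2 * W + 3) < mu.
  have : e <= mu / (2 * (2 * W + 3)) by rewrite ge_min lexx orbT.
  rewrite ler_pdivlMr ?mulr_gt0//; lra.
have vmr : vm <= 2 * r by exact: le_trans vsr.
have [L [L0 Llip Lapp]] := barrier_exists sm rpos r8 y0 vm0 vmr e0.
have Lstart : `|L 0| <= 2 * r /\ u (vpoint sg h (2 * r) (L 0)) = U0.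
  by rewrite L0; split => //; rewrite ler_norml; move: y0r; rewrite in_itv.
have height := barrier_height sm rpos r8 vm0 vms vsr U00 U0vs e0 eU Llip Lapp Lstart.
pose tau t := 2 * r - v (G t).
have tau_ t : t1 <= t <= t2 -> 0 <= tau t <= 2 * r - vm.
  move=> tt; rewrite subr_ge0 (ltW (vcoord_lt (Gr t tt)))/= lerD2l lerN2.
  exact: vmle.
have dtau t : t1 <= t <= t2 -> is_derive t (1 : R) (tau : R -> R^o)
    (- vrate sg h (G t) (G' t)).
  move=> tt; have := is_deriveB (is_derive_cst (2 * r : R^o) t 1) (dv t tt).
  by rewrite sub0r.
have dy t : t1 <= t <= t2 -> is_derive t (1 : R) (fun t => (G t).2 : R^o) (G' t).2.
  by move=> tt; apply: is_derive1_snd; exact: dG.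
(* The height of the arc above the barrier point with the same v. *)
pose K t := (G t).2 - L (tau t).
have Klip t : t1 <= t <= t2 -> lip_at t1 t2 K t.
  move=> tt.
  have ylip := approx_derive_lip (ltW e0) (approx_derive_of_derive t1 t2 e0 (dy t tt)).
  have tlip := approx_derive_lip (ltW e0) (approx_derive_of_derive t1 t2 e0 (dtau t tt)).
  have [C2 [d2 [C20 d20 h2]]] := lip_at_comp tau_ (Llip _ (tau_ t tt)) tlip.
  have [C1 [d1 [C10 d10 h1]]] := ylip.
  exists (C1 + C2), (Num.min d1 d2); split; rewrite ?addr_ge0 ?lt_min ?d10//.
  move=> t' t'T; rewrite lt_min => /andP[/(h1 t' t'T) k1 /(h2 t' t'T) k2].
  rewrite (_ : _ - _ = ((G t').2 - (G t).2) - (L (tau t') - L (tau t))).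
    by rewrite (le_trans (ler_normB _ _))// [leRHS]mulrDl lerD.
  by rewrite /K; ring.
have yr t : t1 <= t <= t2 -> `|(G t).2| <= 2 * r.
  move=> /Gr; rewrite norm_pair_lt => /andP[_ /ltW]; move: rpos; lra.
have w_ t : t1 <= t <= t2 -> 0 <= v (G t) <= 2 * r.
  move=> tt; rewrite (le_trans (ltW vm0) (vmle t tt)) ltW//.
  exact: vcoord_lt (Gr t tt).
have ht t : t1 <= t <= t2 -> vs <= v (G t) -> [/\ `|L (tau t)| < 2 * r,
    U0 * v (G t) / (4 * r) < u (vpoint sg h (v (G t)) (L (tau t))) &
    u (vpoint sg h (v (G t)) (L (tau t))) < 4 * r * U0 / v (G t)].
  move=> tt vt; have hT : 0 <= tau t <= 2 * r - vs.
    by have /andP[-> _] := tau_ t tt; rewrite lerD2l lerN2.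
  have := height (tau t) hT.
  have -> : 2 * r - tau t = v (G t) by rewrite /tau; ring.
  by move=> [? /andP[? ?]]; split.
have K1 : 0 < K t1.
  have [Lr _ Uu] := ht t1 t1_ vs1; rewrite subr_gt0 ltNge; apply/negP => yL.
  have := ucoord_vpoint_incr sm rpos r8 (w_ t1 t1_) (yr t1 t1_) (ltW Lr) yL.
  rewrite (vpointE sm) leNgt (lt_trans Uu)//.
  have v1 : 0 < v (G t1) by exact: lt_le_trans vs1.
  rewrite ltr_pdivrMr//.
  have -> : 4 * r * U0 = u (G t1) * (vs / 2) by rewrite /U0; field; rewrite gt_eqF.
  by rewrite ltr_pM2l//; lra.
(* At a contact the barrier has the slope of the leaf, so K' is the determinant divided by -v' up to
   the slope error; hence K is smaller just before. *)
have crossing t : t1 < t <= t2 -> 0 <= K t -> K t = 0 -> exists2 d : R, 0 < d &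
      forall t', t1 <= t' <= t2 -> t - d < t' < t -> K t' < K t.
  move=> /andP[t1t tt2] _ Kt0; have tt : t1 <= t <= t2 by rewrite ltW.
  have LE : L (tau t) = (G t).2 by move: Kt0; rewrite /K; lra.
  have Lr : `|L (tau t)| <= 2 * r by rewrite LE yr.
  have LA := Lapp (tau t) (tau_ t tt) Lr.
  have LB := approx_derive_comp_derive e0 tau_ LA (dtau t tt).
  have YA := approx_derive_of_derive t1 t2 e0 (dy t tt).
  apply: approx_derive_left_lt (approx_deriveD YA (approx_deriveN LB)).
  have -> : 2 * r - tau t = v (G t) by rewrite /tau; ring.
  rewrite LE /vslope (vpointE sm).
  have v0 : 0 < v (G t) by have [] := arc t tt.
  have := vrate_le sm (r_lt_r0 (Gr t tt)); rewrite (gtr0_norm v0) ler_norml.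
  have vle := vcoord_lt (Gr t tt).
  move=> /andP[V1 V2].
  have Et : E <= cross (G t) (G' t) by apply: Emin; rewrite in_itv.
  rewrite crossE in Et.
  have vt : `|vrate sg h (G t) (G' t)| <= 2 * W.
    have Wt : `|G' t| <= W by apply: Wmax; rewrite in_itv.
    have w1 := norm_fst_le (G' t); have w2 := norm_snd_le (G' t).
    rewrite /vrate (sg_normM sm) (le_trans (ler_normB _ _))// normrM.
    have := r_lt_r0 (Gr t tt); rewrite norm_pair_lt => /andP[_ yr0].
    have [_ hb _] := sm_dh sm yr0.
    have : `|derive1 h (G t).2| * `|(G' t).2| <= 1 / 16 * W.
      by apply: ler_pM => //; exact: le_trans Wt.
    lra.
  move: Et V1 V2 vt; move: (vrate sg h (G t) (G' t)) (vrate sg h (G t) (F (G t)))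
    (F (G t)).2 (G' t).2 => X V Q Y Et V1 V2 vt.
  rewrite normrN.
  have V0 : V < 0 by lra.
  have -> : Y - - Q / V * - X = (X * Q - Y * V) / - V by field; rewrite lt_eqF.
  have slope : mu <= (X * Q - Y * V) / - V.
    rewrite ler_pdivlMr ?oppr_gt0// (le_trans _ Et)//.
    have -> : E = mu * (9 / 4 * r) by rewrite /mu; field; rewrite gt_eqF.
    by rewrite ler_wpM2l ?(ltW mu0)//; lra.
  apply: lt_le_trans slope; apply: le_lt_trans eW.
  have : e * `|X| <= e * (2 * W) by rewrite ler_wpM2l// ltW.
  lra.
have [K2 _] : 0 < K t2 /\ 0 < K t2.
  apply: (stay_positive Klip Klip K1 K1) t2_ => t tt k0 _.
  by split; exact: crossing.
have [Lr Uu _] := ht t2 t2_ vs2.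
have yL : L (tau t2) <= (G t2).2 by rewrite -subr_ge0 ltW.
have := ucoord_vpoint_incr sm rpos r8 (w_ t2 t2_) (ltW Lr) (yr t2 t2_) yL.
rewrite (vpointE sm); apply: lt_le_trans; apply: le_lt_trans Uu.
have -> : u (G t1) * vs ^+ 2 / (32 * r ^+ 2) = U0 / (4 * r) * vs.
  by rewrite /U0; field; rewrite gt_eqF.
rewrite [leRHS]mulrAC; apply: ler_wpM2l => //.
by apply: divr_ge0; [exact: ltW|apply: mulr_ge0 => //; exact: ltW].
Qed.

End transversal_arc.

Section no_approach.
Context (R : realType) (F : R * R -> R * R) (r0 sg : R) (s h : R -> R).
Hypothesis sm : saddle_model F r0 sg s h.
Variable r : R.
Hypotheses (rpos : 0 < r) (r8 : 8 * r <= r0).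
Local Notation u := (ucoord s).
Local Notation v := (vcoord sg h).
Local Notation cross := (cross F sg).

(* A positively transversal arc crosses both sides of the sector inwards. *)
Lemma cross_boundary (p w : R * R) : `|p| < r0 -> 0 < cross p w ->
  0 <= u p -> 0 <= v p ->
  (v p = 0 -> 0 < vrate sg h p w) /\ (u p = 0 -> 0 < urate s p w).
Proof.
move=> pr E0 u0 v0; have := pr; rewrite norm_pair_lt => /andP[xr yr].
have hy := h_small sm yr; have sx := s_small sm xr.
have vabs : `|v p| = `|p.1 - h p.2| by rewrite (sg_normM sm).
(* The corner of the sector is excluded: the field, and with it the determinant, vanishes at the
   origin. *)
have p0 : p <> 0.
  move=> pE; move: E0; rewrite /cross pE (sm_F0 sm) /= !mulr0 subrr mulr0.
  by rewrite ltxx.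
have y_of_v : v p = 0 -> 0 < p.2.
  move=> vp; have xE : p.1 = h p.2.
    by apply/eqP; rewrite -subr_eq0 -normr_le0 -vabs vp normr0.
  have : 0 <= p.2.
    rewrite leNgt; apply/negP => y0; move: u0 sx hy; rewrite /ucoord xE.
    rewrite (ltr0_norm y0); have := ler_norm (- s (h p.2)).
    rewrite normrN; lra.
  rewrite le_eqVlt => /predU1P[y0|//]; case: p0.
  by apply: pair_ext; rewrite ?xE -y0 ?(sm_h0 sm).
have Vb := vrate_le sm pr; have Ub := urate_le sm pr.
split=> [vp|up].
  have y0 := y_of_v vp.
  have V0 : vrate sg h p (F p) = 0.
    by move: Vb; rewrite vp normr0 mul0r addr0 normr_le0 => /eqP.
  have Q0 : 0 < (F p).2.
    have xE : p.1 = h p.2.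
      by apply/eqP; rewrite -subr_eq0 -normr_le0 -vabs vp normr0.
    have := sm_Qpos sm (y := p.2); rewrite -xE -surjective_pairing; apply.
    by rewrite y0 (le_lt_trans (ler_norm _)).
  by move: E0; rewrite (crossE F sg h) V0 mulr0 subr0 pmulr_lgt0.
have vp : 0 < v p.
  rewrite lt_neqAle v0 andbT; apply/eqP => vp; have y0 := y_of_v (esym vp).
  have xE : p.1 = h p.2.
    by apply/eqP; rewrite -subr_eq0 -normr_le0 -vabs -vp normr0.
  move: up sx hy; rewrite /ucoord xE (gtr0_norm y0).
  have := ler_norm (s (h p.2)); lra.
have QE : (F p).2 = derive1 s p.1 * (F p).1.
  by move: Ub; rewrite up normr0 mul0r normr_le0 subr_eq0 => /eqP.
have VE : vrate sg h p (F p) = sg * (F p).1 * (1 - derive1 h p.2 * derive1 s p.1).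
  by rewrite /vrate QE; ring.
have [_ hb _] := sm_dh sm yr; have [_ sb _] := sm_ds sm xr.
have hs1 : `|derive1 h p.2 * derive1 s p.1| <= 1 / 16 * (1 / 16).
  by rewrite normrM; apply: ler_pM.
have sP : sg * (F p).1 < 0.
  move: Vb hs1; rewrite VE (gtr0_norm vp) !ler_norml => /andP[_ ?] /andP[? ?].
  nra.
move: E0; rewrite /cross QE.
rewrite (_ : _ * _ = - (sg * (F p).1) * urate s p w); last by rewrite /urate; ring.
by rewrite pmulr_rgt0// oppr_gt0.
Qed.

(** * An arc that enters the sector through the center branch *)

Section arc.
Variables (G G' : R -> R * R) (a b c : R).
Hypothesis arc : forall t, a < t < b -> [/\ `|G t| < r,
  is_derive t (1 : R) G (G' t), {for t, continuous G'} & 0 < cross (G t) (G' t)].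
Hypothesis cab : a < c < b.
Hypothesis startc : v (G c) = 0 /\ 0 < u (G c).

Let Gr0 t : a < t < b -> `|G t| < r0.
Proof. by move=> /arc[Gr _ _ _]; exact: r_lt_r0 rpos r8 _ Gr. Qed.

Let du t : a < t < b -> is_derive t (1 : R) (fun t => u (G t) : R^o) (urate s (G t) (G' t)).
Proof. by move=> tt; apply: (is_derive_ucoord sm) (Gr0 tt); have [] := arc tt. Qed.

Let dv t : a < t < b -> is_derive t (1 : R) (fun t => v (G t) : R^o) (vrate sg h (G t) (G' t)).
Proof. by move=> tt; apply: (is_derive_vcoord sm) (Gr0 tt); have [] := arc tt. Qed.

Let sub t1 t2 t : a < t1 -> t2 < b -> t1 <= t <= t2 -> a < t < b.
Proof.
by move=> at1 t2b /andP[t1t tt2]; rewrite (lt_le_trans at1 t1t) (le_lt_trans tt2).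
Qed.

(** At a first exit one coordinate vanishes while both are nonnegative, and [cross_boundary] makes
    the vanishing one strictly increasing. *)
Lemma arc_stays_in_sector t1 t2 : a < t1 -> t1 <= t2 -> t2 < b ->
  0 < u (G t1) -> 0 < v (G t1) -> 0 < u (G t2) /\ 0 < v (G t2).
Proof.
move=> at1 t12 t2b u1 v1.
have lip (f : R -> R) m t : is_derive t (1 : R) (f : R -> R^o) m -> lip_at t1 t2 f t.
  by move=> /(approx_derive_of_derive t1 t2 ltr01)/approx_derive_lip; apply.
have t2_ : t1 <= t2 <= t2 by rewrite t12 lexx.
apply: (@stay_positive R (fun t => u (G t)) (fun t => v (G t)) t1 t2) (t2_) => //.
- by move=> t /(sub at1 t2b)/du/lip.
- by move=> t /(sub at1 t2b)/dv/lip.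
move=> t /andP[t1t tt2] ut vt.
have tt : a < t < b by apply: (sub at1 t2b); rewrite ltW.
have [_ _ _ E0] := arc tt.
have [cv cu] := cross_boundary (Gr0 tt) E0 ut vt.
have left (f : R -> R) m : 0 < m -> is_derive t (1 : R) (f : R -> R^o) m ->
    exists2 d : R, 0 < d &
    forall t', t1 <= t' <= t2 -> t - d < t' < t -> f t' < f t.
  move=> m0 df; have m2 : 0 < m / 2 by rewrite divr_gt0.
  apply: (approx_derive_left_lt _ (approx_derive_of_derive t1 t2 m2 df)).
  by rewrite gtr_pMr// invf_lt1// ltr1n.
split=> [/cu m0|/cv m0]; [exact: left m0 (du tt)|exact: left m0 (dv tt)].
Qed.

(** At c, u is positive and v has a positive derivative, so the arc is inside just after c and then
    cannot leave. *)
Lemma arc_enters_sector t : c < t < b -> 0 < u (G t) /\ 0 < v (G t).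
Proof.
move=> /andP[ct tb]; have [v0 u0] := startc; case/andP: cab => ac cb.
have cc : a < c < b by [].
have [_ _ _ E0] := arc cc.
have v0c : 0 <= v (G c) by rewrite v0.
have [+ _] := cross_boundary (Gr0 cc) E0 (ltW u0) v0c.
move=> /(_ v0) m0.
have m2 : 0 < vrate sg h (G c) (G' c) / 2 by rewrite divr_gt0.
have [d1 d10 vd] := approx_derive_of_derive a b m2 (dv cc).
have ulip := approx_derive_lip ler01 (approx_derive_of_derive a b ltr01 (du cc)).
have [d2 d20 ud] := lip_at_near ulip u0.
pose z := Num.min t (c + Num.min d1 d2 / 2).
have dm : 0 < Num.min d1 d2 by rewrite lt_min d10.
have cz : c < z by rewrite lt_min ct ltrDl divr_gt0.
have zt : z <= t by rewrite ge_min lexx.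
have zd : `|z - c| < Num.min d1 d2.
  rewrite gtr0_norm ?subr_gt0// ltrBlDl gt_min; apply/orP; right.
  by rewrite ltrD2l gtr_pMr// invf_lt1// ltr1n.
move: zd; rewrite lt_min => /andP[zd1 zd2].
have zab : a <= z <= b by rewrite (ltW (lt_trans ac cz)) (ltW (le_lt_trans zt tb)).
have uz : 0 < u (G z).
  by have := ud z zab zd2; rewrite ltr_norml => /andP[]; lra.
have vz : 0 < v (G z).
  have := vd z zab zd1; have zc : 0 < z - c by rewrite subr_gt0.
  rewrite v0 subr0 (gtr0_norm zc) ler_norml => /andP[vz _].
  by have := mulr_gt0 m2 zc; lra.
by apply: arc_stays_in_sector (lt_trans ac cz) zt tb uz vz.
Qed.

(** An arc in the sector at some t <= c would still be there at c, where v vanishes. *)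
Lemma arc_sector_after t : a < t < b -> 0 < u (G t) -> 0 < v (G t) -> c < t.
Proof.
move=> /andP[at_ tb] ut vt; rewrite ltNge; apply/negP => tc.
case/andP: cab => _ cb.
have [_] := arc_stays_in_sector at_ tc cb ut vt.
by have [-> _] := startc; rewrite ltxx.
Qed.

(* Once the arc is in the sector at t1, its height u over v >= v p / 2 remains
   above a positive constant, so it cannot get close to p after t1; before t1
   it stays at a positive distance by compactness. *)
Lemma arc_no_approach (p : R * R) : `|p| < r -> u p = 0 -> 0 < v p ->
  (forall e : R, 0 < e -> exists2 t, a < t < b &
    [/\ `|G t - p| < e, 0 < u (G t) & 0 < v (G t)]) -> False.
Proof.
move=> pr up vp near; case/andP: (cab) => ac cb.
have pr0 := r_lt_r0 rpos r8 pr.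
have vlip q : `|q| < r0 -> `|v p - v q| <= 2 * `|q - p|.
  move=> qr; have := pr0; have := qr; rewrite !norm_pair_lt => /andP[_ yq] /andP[_ yp].
  have hh := h_lip sm yp yq; rewrite -mulrBr (sg_normM sm).
  have h1 := norm_fst_le (p - q); have h2 := norm_snd_le (p - q).
  rewrite !pairE in h1 h2; rewrite distrC (distrC q).
  have -> : q.1 - h q.2 - (p.1 - h p.2) = - ((p.1 - q.1) - (h p.2 - h q.2)) by ring.
  rewrite normrN (le_trans (ler_normB _ _))//.
  have := normr_ge0 (p.2 - q.2); lra.
pose vs := v p / 2; have vs0 : 0 < vs by rewrite divr_gt0.
have close q : `|q| < r0 -> `|q - p| < v p / 4 -> vs <= v q.
  move=> qr qp; have := vlip q qr; rewrite ler_norml /vs => /andP[_]; lra.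
have v4 : 0 < v p / 4 by rewrite divr_gt0.
have [t1 t1ab [Gt1 u1 v1]] := near _ v4.
have ct1 := arc_sector_after t1ab u1 v1.
have [at1 t1b] := andP t1ab.
have ct1b t : c <= t <= t1 -> a < t < b by exact: sub.
(* The least distance from p on [c, t1] is positive: v (G c) = 0 < v p at c, and u > 0 = u p
   afterwards. *)
have [tm tmT mmin] : exists2 z, z \in `[c, t1] &
    forall t, t \in `[c, t1] -> `|G z - p| <= `|G t - p|.
  apply: (@EVT_min R (fun t => `|G t - p|) c t1 (ltW ct1)).
  apply: within_segment_continuous => t /ct1b tt.
  have [_ dG _ _] := arc tt; have cG := continuous_of_derive dG.
  by apply: cvg_norm; apply: cvgB => //; exact: cvg_cst.
have m0 : 0 < `|G tm - p|.
  rewrite normr_gt0 subr_eq0; apply/eqP => Gp.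
  move: tmT; rewrite in_itv/= => /andP[+ tmt1]; rewrite le_eqVlt => /predU1P[tc|ctm].
    by move: vp; rewrite -Gp -tc (proj1 startc) ltxx.
  have tmb : c < tm < b by rewrite ctm (le_lt_trans tmt1).
  by have [] := arc_enters_sector tmb; rewrite Gp up ltxx.
pose height := u (G t1) * vs ^+ 2 / (32 * r ^+ 2).
have height0 : 0 < height.
  by apply: divr_gt0; apply: mulr_gt0 => //; exact: exprn_gt0.
(* The three bounds force v >= vs at t2, t2 >= t1, and, as u is 2-Lipschitz, u (G t2) < height. *)
pose e2 := Num.min (Num.min (v p / 4) `|G tm - p|) (height / 2).
have e20 : 0 < e2 by rewrite !lt_min v4 m0 divr_gt0.
have [t2 t2ab [Gt2 u2 v2]] := near _ e20.
have ct2 := arc_sector_after t2ab u2 v2.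
have [_ t2b] := andP t2ab.
move: Gt2; rewrite !lt_min => /andP[/andP[Gv Gm] Gh].
have t12 : t1 <= t2.
  rewrite leNgt; apply/negP => t21.
  by have := mmin t2; rewrite in_itv/= (ltW ct2) (ltW t21) leNgt Gm => /(_ isT).
have := @transversal_height _ _ _ _ _ _ sm r rpos r8 G G' t1 t2 vs t12.
move=> /(_ _ vs0 (close _ (Gr0 t1ab) Gt1) (close _ (Gr0 t2ab) Gv) u1) h1.
have : height < u (G t2).
  apply: h1 => t /andP[t1t tt2]; have tab : a < t < b by apply: (sub at1 t2b); rewrite t1t.
  have [? ? ? ?] := arc tab; split => //.
  have ctb : c < t < b by rewrite (lt_le_trans ct1 t1t) (le_lt_trans tt2).
  by have [] := arc_enters_sector ctb.
apply/negP; rewrite -leNgt.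
have := ucoord_lip sm (Gr0 t2ab) pr0; rewrite up subr0.
have := ler_norm (u (G t2)); lra.
Qed.

End arc.
End no_approach.

Lemma C1_on_is_derive (R : realType) (V : normedModType R) (g : R -> V) (a b t : R) :
  C1_on g a b -> a < t < b -> is_derive t (1 : R) g (derive1 g t).
Proof. by move=> gC /gC[dg _]; rewrite derive1E; apply/derivableP. Qed.

Lemma constant_sign (R : realType) (f : R -> R) (a b : R) :
  (forall t, a < t < b -> {for t, continuous f}) ->
  (forall t, a < t < b -> f t != 0) ->
  (forall t, a < t < b -> 0 < f t) \/ (forall t, a < t < b -> f t < 0).
Proof.
move=> fc f0.
have hs x y : a < x < b -> a < y < b -> x <= y -> f x * f y < 0 -> False.
  move=> /andP[ax xb] /andP[ay yb] xy fxy.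
  have ab z : x <= z <= y -> a < z < b.
    by move=> /andP[xz zy]; rewrite (lt_le_trans ax xz) (le_lt_trans zy yb).
  have [z zT fz] : exists2 z, z \in `[x, y] & f z = 0.
    apply: IVT => //.
      by apply: within_segment_continuous => z /ab/fc.
    rewrite ge_min le_max; case: (ltP 0 (f x)) fxy => [fx0|fx0] fxy.
      by move: fxy; rewrite pmulr_rlt0// => /ltW ->; rewrite orbT (ltW fx0).
    have fy : 0 <= f y by rewrite leNgt; apply/negP => fy; nra.
    by rewrite fy orbT.
  by move: zT; rewrite in_itv/= => /ab/f0; rewrite fz eqxx.
have [ab|ba] := ltP a b; last first.
  by left=> t /andP[at_ tb]; move: (lt_trans at_ tb); rewrite ltNge ba.
have mid : a < (a + b) / 2 < b by apply/andP; split; lra.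
have hs2 x y : a < x < b -> a < y < b -> f x * f y < 0 -> False.
  move=> xx yy; have [xy|/ltW yx] := leP x y; first exact: hs.
  by rewrite mulrC; exact: hs.
have := f0 _ mid; case: ltgtP => // fm _; [right|left] => t tt.
  have := f0 _ tt; case: ltgtP => // ft _.
  by case: (hs2 _ _ mid tt); nra.
have := f0 _ tt; case: ltgtP => // ft _.
by case: (hs2 _ _ mid tt); nra.
Qed.

Section exit_transversal.
Context (R : realType) (F : R * R -> R * R) (r0 sg : R) (s h : R -> R).
Hypothesis sm : saddle_model F r0 sg s h.
Variable r : R.
Hypotheses (rpos : 0 < r) (r8 : 8 * r <= r0).
Local Notation u := (ucoord s).
Local Notation v := (vcoord sg h).

Lemma exit_transversal_no_approach (rho : R) (g : R -> R * R) (a b c : R)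
    (p : R * R) :
  transversal_to F (box r) (upper_center_branch rho h) g a b c ->
  `|p| < r -> u p = 0 -> 0 < v p ->
  (forall e : R, 0 < e -> exists2 t, a < t < b &
    [/\ `|g t - p| < e, 0 < u (g t) & 0 < v (g t)]) -> False.
Proof.
move=> [[gC1 gtr] cab [/andP[yc _] xc]] pr up vp near.
have gr t : a < t < b -> `|g t| < r by move=> /gtr[].
have dg t : a < t < b -> is_derive t (1 : R) g (derive1 g t).
  exact: C1_on_is_derive.
have cg t : a < t < b -> {for t, continuous (derive1 g)} by move=> /gC1[].
have startc : v (g c) = 0 /\ 0 < u (g c).
  have := r_lt_r0 rpos r8 (gr c cab); rewrite norm_pair_lt => /andP[xr yr].
  split; first by rewrite /vcoord xc subrr mulr0.
  have := h_small sm yr; have := s_small sm xr; rewrite xc (gtr0_norm yc).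
  have := ler_norm (s (h (g c).2)); rewrite /ucoord xc; lra.
have E0 t : a < t < b -> cross F sg (g t) (derive1 g t) != 0.
  move=> /gtr[_ E0]; rewrite /cross mulf_neq0// -normr_gt0 (sg_norm sm).
  exact: ltr01.
have cE t (tt : a < t < b) :=
  cross_continuous sm (dg t tt) (r_lt_r0 rpos r8 (gr t tt)) (cg t tt).
have [Ep|En] := constant_sign cE E0.
  apply: (arc_no_approach sm rpos r8 _ cab startc pr up vp near) => t tt.
  by split; [exact: gr|exact: dg|exact: cg|exact: Ep].
(* With a negative determinant the arc is traversed backwards, which reverses its velocity and hence
   the sign. *)
have opp_ab t : - b < t < - a -> a < - t < b.
  by rewrite ltrNr (ltrNl b) andbC.
apply: (@arc_no_approach _ _ _ _ _ _ sm r rpos r8 (fun t => g (- t))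
    (fun t => - derive1 g (- t)) (- b) (- a) (- c) _ _ _ p) => //.
- move=> t /opp_ab tt; split; first exact: gr.
  + apply/is_derive1_distP => e /(proj1 (is_derive1_distP _ _ _) (dg _ tt))[d d0 hd].
    exists d => // t' t'd.
    have tE : - t' - - t = - (t' - t) by rewrite opprD.
    have := hd (- t'); rewrite tE normrN scaleNr => /(_ t'd).
    by rewrite scalerN.
  + apply: cvgN; apply: (@continuous_comp _ _ _ -%R (derive1 g)).
      exact: opp_continuous.
    exact: cg.
  + have := En _ tt; rewrite /cross /=; lra.
- by rewrite !ltrN2 andbC.
- by rewrite opprK.
move=> e /near[t tt gt]; exists (- t); last by rewrite opprK.
by rewrite !ltrN2 andbC.
Qed.

End exit_transversal.

(** * Passages through the saddle sector *)

Section passage.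
Context (R : realType) (F : R * R -> R * R) (r0 sg : R) (s h : R -> R).
Hypothesis sm : saddle_model F r0 sg s h.
Variable r : R.
Hypotheses (rpos : 0 < r) (r8 : 8 * r <= r0).
Local Notation u := (ucoord s).
Local Notation v := (vcoord sg h).

Lemma stable_branch_coord (rho : R) (p : R * R) : `|p| < r0 ->
  stable_branch rho s sg p -> u p = 0 /\ 0 < v p.
Proof.
move=> pr [/andP[x0 _] yE]; rewrite /ucoord yE subrr; split=> //.
have := pr; rewrite norm_pair_lt => /andP[xr yr].
have := s_small sm xr; have := h_small sm yr; rewrite -yE.
have xE : `|p.1| = sg * p.1 by rewrite -(sg_normM sm) gtr0_norm.
rewrite /vcoord mulrBr xE -(sg_normM sm (h p.2)).
have := ler_norm (sg * h p.2); lra.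
Qed.

Section data.
Variables (rho : R) (gS gU : R -> R * R) (aS bS cS aU bU cU : R).
Variables (y : nat -> R) (phi : nat -> R -> R * R) (T : nat -> R).
Hypotheses (r0rho : r0 < rho)
  (invs : locally_invariant F (box rho) [set p | `|p.1| < rho /\ p.2 = s p.1])
  (invh : locally_invariant F (box rho) [set p | `|p.2| < rho /\ p.1 = h p.2])
  (tS : transversal_to F (box r) (stable_branch rho s sg) gS aS bS cS)
  (tU : transversal_to F (box r) (upper_center_branch rho h) gU aU bU cU)
  (yS : forall n, aS < y n < bS /\ saddle_sector rho s h sg (gS (y n)))
  (y_cvg : y @ \oo --> cS)
  (phiF : forall n, [/\ 0 <= T n, trajectory F (box r) (phi n) 0 (T n),
       phi n 0 = gS (y n) & exists2 t, aU < t < bU & phi n (T n) = gU t]).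

Let gSr t : aS < t < bS -> `|gS t| < r.
Proof. by move=> tt; have [[_ gF] _ _] := tS; have [] := gF t tt. Qed.

Let start_coord n : 0 < u (gS (y n)) /\ 0 < v (gS (y n)).
Proof. by have [_ [_ u0 v0]] := yS n; rewrite /ucoord subr_gt0. Qed.

Let rr0 : r <= r0. Proof. by move: rpos r8; lra. Qed.

Lemma passage_in_sector n t : 0 <= t <= T n ->
  0 < u (phi n t) /\ 0 < v (phi n t).
Proof.
have [T0 phinF phi0 _] := phiF n; have [u0 v0] := start_coord n.
by apply: (trajectory_in_sector sm rr0 r0rho invs invh phinF); rewrite phi0.
Qed.

(** The field is at most 2 r in norm on the box, so a short passage ends near its start; the starts
    converge to [gS cS], which lies on the stable branch. *)
Lemma passage_time_bounded_below : exists2 tau : R, 0 < tau &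
  exists n0, forall n, (n0 <= n)%N -> tau <= T n.
Proof.
apply: contrapT => short.
have [[gC1 gF] cab pS] := tS; have pr := gSr cab; have pr0 := r_lt_r0 rpos r8 pr.
have [up vp] := stable_branch_coord pr0 pS.
apply: (exit_transversal_no_approach sm rpos r8 tU pr up vp) => e e0.
have gc : gS (y n) @[n --> \oo] --> gS cS.
  have := continuous_of_derive (C1_on_is_derive gC1 cab).
  by move=> gc; apply: (cvg_comp _ _ y_cvg).
have e2 : 0 < e / 2 by rewrite divr_gt0.
move: gc => /cvgrPdist_lt/(_ _ e2)[n0 _ near].
have tau0 : 0 < e / (4 * r) by rewrite divr_gt0 ?mulr_gt0.
have [n n0n Tn] : exists2 n, (n0 <= n)%N & T n < e / (4 * r).
  apply: contrapT => long; apply: short; exists (e / (4 * r)) => //.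
  exists n0 => n n0n; rewrite leNgt; apply/negP => Tn.
  by apply: long; exists n.
have [T0 phinF phi0 [t tab tE]] := phiF n.
exists t => //; rewrite -tE.
have TT : 0 <= T n <= T n by rewrite lexx T0.
have [uT vT] := passage_in_sector TT; split => //.
have small : `|phi n (T n) - phi n 0| <= 2 * r * (T n - 0).
  apply: (@mean_value_norm R _ (phi n) (fun t => F (phi n t)) 0 (T n) (2 * r)) => //.
    by move=> z /phinF[].
  move=> z /phinF[zr _]; have z0 : `|(0 : R * R)| < r0 by rewrite normr0 (sm_r0 sm).
  have := field_lip sm (r_lt_r0 rpos r8 zr) z0; rewrite (sm_F0 sm) !subr0.
  by move: zr; rewrite /box/=; lra.
have -> : phi n (T n) - gS cS = (phi n (T n) - phi n 0) - (gS cS - gS (y n)).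
  by rewrite phi0 opprB addrA subrK.
rewrite (le_lt_trans (ler_normB _ _))//.
have h1 := near n n0n.
have h2 : 2 * r * T n < e / 2.
  have -> : e / 2 = 2 * r * (e / (4 * r)) by field; rewrite gt_eqF.
  by rewrite ltr_pM2l ?mulr_gt0.
move: small; rewrite subr0; move: h1 => /=; lra.
Qed.

(** Near cS both [gS] and u are Lipschitz and u vanishes at [gS cS]; at parameter distance at least
    d, the crude bound u < 2 r is enough. *)
Lemma start_height : exists2 C : R, 0 < C &
  forall n, u (gS (y n)) <= C * `|y n - cS|.
Proof.
have [[gC1 gF] cab pS] := tS; have pr0 := r_lt_r0 rpos r8 (gSr cab).
have [up vp] := stable_branch_coord pr0 pS.
have [d d0 hd] := C1_strict_derivative gC1 cab ltr01.
pose K := 2 * (`|derive1 gS cS| + 1).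
have K0 : 0 < K by rewrite mulr_gt0// ltr_wpDl.
exists (K + 2 * r / d); first by rewrite addr_gt0 ?divr_gt0 ?mulr_gt0.
move=> n; have yab := proj1 (yS n); have yr := gSr yab.
rewrite mulrDl; have [yd|yd] := ltP `|y n - cS| d; last first.
  have := ucoord_lt sm rpos r8 yr => ur.
  rewrite (le_trans (ltW ur))// (@le_trans _ _ (2 * r / d * `|y n - cS|))//.
    by rewrite mulrAC ler_pdivlMr// ler_wpM2l// ltW ?mulr_gt0.
  by rewrite lerDr mulr_ge0// ltW.
have c0 : `|cS - cS| < d by rewrite subrr normr0.
have [_ gd] := hd _ _ yd c0.
have := ucoord_lip sm (r_lt_r0 rpos r8 yr) pr0; rewrite up subr0 => ul.
rewrite (le_trans (ler_norm _))// (le_trans ul)//.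
have rd : 0 <= 2 * r / d * `|y n - cS| by rewrite !mulr_ge0// ?invr_ge0 ltW.
have := ler_normD (gS (y n) - gS cS - (y n - cS) *: derive1 gS cS)
  ((y n - cS) *: derive1 gS cS).
rewrite subrK normrZ => h1; rewrite /K; lra.
Qed.

Lemma passage_tube_le (w : nat -> R) (sgn : R) : sgn = 1 \/ sgn = - 1 ->
  y = (fun n => cS + sgn * w n) ->
  (forall n, 0 <= w n) -> nonincreasing_seq w ->
  nonincreasing_seq (fun n => w n - w n.+1) ->
  exists2 C : R, 0 < C & forall delta : R, 0 < delta < 1 ->
    let f := fine (lebesgue_measure (tube (@dist1 R) (range y) delta)) in
    0 < f /\ (lebesgue2 R (tube (@dist2 R)
      (\bigcup_n (phi n @` `[0%R, T n])) delta) <= (C * f)%:E)%E.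
Proof.
move=> sgnE yE w0 wdecr gap.
have wE n : `|y n - cS| = w n.
  rewrite yE addrAC subrr add0r normrM.
  by case: sgnE => ->; rewrite ?normrN normr1 mul1r ger0_norm.
have [C C0 uC] := start_height.
(* The starting points lie in the open sector, so none is on the stable manifold and no term equals
   the limit. *)
have wpos n : 0 < w n.
  rewrite lt_neqAle w0 andbT eq_sym; apply/eqP => wn0.
  have := uC n; rewrite wE wn0 mulr0 leNgt.
  by have [-> _] := start_coord n.
have wcvg : w @ \oo --> 0.
  have <- : (fun n => `|y n - cS|) = w by apply/funext.
  rewrite -(normr0 R) -(subrr cS); apply: cvg_norm; apply: cvgB => //.
  exact: cvg_cst.
have L0 : 0 < 22 * r + 1 by move: rpos; lra.
have k0 : (0 : R) < 5 by [].
pose C1 := 4 * r * C + (4 * r + 2).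
have C10 : 0 < C1 by rewrite /C1; have := mulr_gt0 rpos C0; move: rpos; lra.
rewrite yE.
apply: (@tube_area_le_of_covered R w cS sgn _ 5 (22 * r + 1) C1) => //.
  move=> n delta d01; have [T0 phinF _ _] := phiF n.
  by apply: (covered_trajectory sm rr0 T0 phinF) => // t; exact: passage_in_sector.
move=> N delta d01; have [d0 d1] := andP d01.
have CN : 0 <= C * w N by rewrite mulr_ge0 ?ltW.
apply: (coveredW _ (covered_sub _ (covered_nucleus sm rpos rr0 CN d01))).
  have a0 : 0 <= delta^-1 by rewrite invr_ge0 ltW.
  have b0 : 0 <= w N / delta ^+ 2 by rewrite divr_ge0 ?sqr_ge0.
  rewrite /C1 -[C * w N / _]mulrA.
  have := mulr_ge0 (ltW (mulr_gt0 rpos C0)) a0; have := mulr_ge0 (ltW rpos) b0.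
  lra.
move=> p [n /= Nn [t tT <-]]; move: tT; rewrite /= in_itv/= => tT.
have [T0 phinF phi0 _] := phiF n; have [ut vt] := passage_in_sector tT.
split=> //; first by have [] := phinF t tT.
have [t0 tTn] := andP tT.
have inS z : 0 <= z <= T n -> 0 < u (phi n z) /\ 0 < v (phi n z).
  exact: passage_in_sector.
(* At the start v <= 2 r and u <= C w n <= C w N, so u^2 v is at most 2 r eta^2 with eta = C w N,
   and it can only decrease. *)
have decr : u (phi n t) ^+ 2 * v (phi n t) <= u (phi n 0) ^+ 2 * v (phi n 0).
  exact: (u2v_decr sm rr0 phinF inS).
rewrite (le_trans decr)// phi0 mulrC.
have [u0 v0] := start_coord n.
apply: ler_pM; rewrite ?sqr_ge0 ?(ltW v0) ?(ltW (vcoord_lt sm rpos r8 _))//.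
  exact: gSr (proj1 (yS n)).
rewrite ler_pXn2r ?nnegrE ?(ltW u0)// (le_trans (uC n))// wE.
by rewrite ler_wpM2l ?(ltW C0)// wdecr.
Qed.

Lemma passage_tube_ge (B : R) : (forall n, `|y n - cS| <= B) ->
  exists2 C : R, 0 < C & forall delta : R, 0 < delta ->
    ((C * fine (lebesgue_measure (tube (@dist1 R) (range y) delta)))%:E <=
      lebesgue2 R (tube (@dist2 R) (\bigcup_n (phi n @` `[0%R, T n])) delta))%E.
Proof.
move=> yB; have B0 : 0 <= B by exact: le_trans (yB 0).
have [tS1 cab _] := tS.
have [tau1 tau10 [n1 T1]] := passage_time_bounded_below.
have phi0 n : phi n 0 = gS (y n) by have [] := phiF n.
have phinF n : trajectory F (box r) (phi n) 0 (T n) by have [] := phiF n.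
have [n0 [tau [k [tau0 k0 Ttau sep]]]] :=
  transversal_flow_separation sm rr0 tS1 cab y_cvg phinF phi0 tau10 T1.
apply: (@tube_area_ge_of_separated R y cS B _ phi n0 tau k) => //.
move=> n t n0n /andP[t0 tt]; exists n => //; exists t => //=.
by rewrite in_itv/= t0 (le_trans tt)// Ttau.
Qed.

End data.
End passage.

Lemma monotone_distances (R : realType) (y : nat -> R) (c : R) :
  nondecreasing_seq y \/ nonincreasing_seq y -> y @ \oo --> c ->
  exists (sgn : R) (w : nat -> R), [/\ sgn = 1 \/ sgn = - 1,
    y = (fun n => c + sgn * w n), forall n, 0 <= w n & nonincreasing_seq w].
Proof.
move=> ymon ycvg; have ylim : lim (y @ \oo) = c by apply: cvg_lim.
have yc : cvgn y by apply/cvg_ex; exists c.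
case: ymon => ymon.
  exists (- 1), (fun n => c - y n); split; [by right| | |].
  - by apply/funext => n; ring.
  - by move=> n; rewrite subr_ge0 -ylim; exact: nondecreasing_cvgn_le.
  - by move=> m n mn; rewrite lerD2l lerN2 ymon.
exists 1, (fun n => y n - c); split; [by left| | |].
- by apply/funext => n; ring.
- by move=> n; rewrite subr_ge0 -ylim; exact: nonincreasing_cvgn_ge.
- by move=> m n mn; rewrite lerD2r ymon.
Qed.

Theorem theorem4 (R : realType) (alpha : R) (m : nat)
    (U : set (R * R)) (F : R * R -> R * R)
    (alpha_gt0 : 0 < alpha) (m_ge2 : (2 <= m)%N)
    (U_open : open U) (U0 : U 0) (F_analytic : analytic_field U F)
    (F1 : leads_with (fun p => (F p).1) 1 0 (- 1))
    (F2 : leads_with (fun p => (F p).2) 0 m alpha)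
    (rho : R) (s h : R -> R) (sigma : R)
    (rho_gt0 : 0 < rho) (rhoU : box rho `<=` U)
    (s_stable : stable_manifold F rho s)
    (h_center : center_manifold F rho h)
    (sigma_branch : sigma = 1 \/ sigma = - 1) :
  exists2 r : R, 0 < r <= rho &
  forall (gS gU : R -> R * R) (aS bS cS aU bU cU : R)
    (y : nat -> R) (phi : nat -> R -> R * R) (T : nat -> R) (d : R),
    transversal_to F (box r) (stable_branch rho s sigma) gS aS bS cS ->
    transversal_to F (box r) (upper_center_branch rho h) gU aU bU cU ->
    (forall n, aS < y n < bS /\ saddle_sector rho s h sigma (gS (y n))) ->
    (nondecreasing_seq y \/ nonincreasing_seq y) ->
    y @ \oo --> cS ->
    nonincreasing_seq (fun n => `|y n.+1 - y n|) ->
    (forall n, [/\ 0 <= T n, trajectory F (box r) (phi n) 0 (T n),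
       phi n 0 = gS (y n) &
       exists2 u, aU < u < bU & phi n (T n) = gU u]) ->
    has_minkowski_dim1 (range y) d ->
    has_minkowski_dim2 (\bigcup_n (phi n @` `[0, T n])) (1 + d).
Proof.
have [r0 r0rho sm] := saddle_model_exists alpha_gt0 m_ge2 F1 F2 rho_gt0
  s_stable h_center sigma_branch.
have r00 := sm_r0 sm.
have r0pos : 0 < r0 / 8 by rewrite divr_gt0.
have r8 : 8 * (r0 / 8) <= r0 by lra.
(* The barriers reach |x| <= 3 r and |y| <= 2 r, outside the box of radius r; the factor 8 keeps
   them inside the box of radius [r0]. *)
exists (r0 / 8); first by rewrite r0pos/=; lra.
move=> gS gU aS bS cS aU bU cU y phi T d tS tU yS ymon ycvg ygap phiF ydim.
have [_ _ _ invs] := s_stable; have [_ _ _ invh] := h_center.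
have [sgn [w [sgnE yE w0 wdecr]]] := monotone_distances ymon ycvg.
have sgn1 x : `|sgn * x| = `|x|.
  by rewrite normrM; case: sgnE => ->; rewrite ?normrN normr1 mul1r.
have wgap : nonincreasing_seq (fun n => w n - w n.+1).
  suff <- : (fun n => `|y n.+1 - y n|) = (fun n => w n - w n.+1) by [].
  apply/funext => n; have -> : y n.+1 - y n = sgn * (w n.+1 - w n).
    by rewrite yE; ring.
  rewrite sgn1 distrC ger0_norm//.
  by rewrite subr_ge0 wdecr.
have [C C0 hC] := passage_tube_le sm r0pos r8 r0rho invs invh tS yS ycvg phiF
  sgnE yE w0 wdecr wgap.
have yB n : `|y n - cS| <= w 0.
  by rewrite yE addrAC subrr add0r sgn1 ger0_norm// wdecr.
have [c c0 hc] := passage_tube_ge sm r0pos r8 r0rho invs invh tS tU yS ycvg phiF yB.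
apply: (has_minkowski_dim_comparable c0 C0 ltr01 _ ydim) => delta d01.
have [f0 fC] := hC delta d01; have := hc delta; case/andP: (d01) => -> _ /(_ isT) fc.
set A := lebesgue2 _ _ in fC fc *.
(* The two area bounds exclude both infinities, so they hold for the real value that the dimension
   uses. *)
have Afin : A \is a fin_num.
  rewrite fin_numE; apply/andP; split; apply/eqP => AE.
    by move: fc; rewrite AE leeNy_eq.
  by move: fC; rewrite AE leye_eq.
by split; rewrite // -lee_fin fineK.
Qed.
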